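(* Let $n\ge2$, let $W=(w_1,\dots,w_N)$ be a weight vector with $N_W>2$, let $m=2k-1+\varepsilon$ ($\varepsilon\in\{0,1\}$) be the positive integer with $D(n,m)<N_W\le D(n,m+1)$, and let $s$ and $(\alpha_i,\rho_i)_{i=0}^{k-1+\varepsilon}$ be the parameters determined by $n$ and $N_W$ as in the context. Let $h$ be absolutely monotone, and define $$Q_j(n,s)=\frac1{N_W}+\sum_{i=0}^{k-1+\varepsilon}\rho_iP_j^{(n)}(\alpha_i),\qquad j\ge1.$$ (a) If $Q_j(n,s)\ge0$ for every positive integer $j$, then the bound $\mathrm{ULB}_m(W,h)$ cannot be improved by any polynomial from $L_h^{(n)}$; i.e., $\mathrm{ULB}(W,h)=\mathrm{ULB}_m(W,h)$. (b) If $h$ is strictly absolutely monotone, $h^{(i)}(-1)>0$ for all $i\ge0$, and $Q_j(n,s)<0$ for some positive integer $j\ge m+1$, then there exists a polynomial $f\in L_h^{(n)}$ of degree $j$ that gives a better bound on $\mathcal{E}^h(W)$ than $\mathrm{ULB}_m(W,h)$, that is, $f_0-f(1)\sum_{i=1}^Nw_i^2>\mathrm{ULB}_m(W,h)$; i.e., $\mathrm{ULB}(W,h)>\mathrm{ULB}_m(W,h)$.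
   Context: **Energy.** $\mathbb{S}^{n-1}$ is the unit sphere in $\mathbb{R}^n$. A weight vector is $W=(w_1,\dots,w_N)$ with all $w_i>0$ and $\sum_i w_i=1$. A potential is a continuous extended-real-valued $h:[-1,1]\to\mathbb{R}\cup\{+\infty\}$, finite on $[-1,1)$. It is absolutely monotone if $h^{(i)}(t)\ge 0$ for all $i=0,1,2,\dots$ and all $t\in[-1,1)$, and strictly absolutely monotone if $h^{(i)}(t)>0$ for all $i=0,1,2,\dots$ and all $t\in(-1,1)$. For an $N$-tuple $C=(x_1,\dots,x_N)$ of distinct points of $\mathbb{S}^{n-1}$, $E_h(C,W)=\sum_{i\ne j}w_iw_jh(x_i\cdot x_j)$, and $\mathcal{E}^h(W)=\inf_C E_h(C,W)$ over all such $C$. Put $N_W=1/\sum_{i=1}^N w_i^2$. **Gegenbauer polynomials.** $d\mu_n(t)=\gamma_n(1-t^2)^{(n-3)/2}dt$ is the probability measure on $[-1,1]$ with $\gamma_n=\Gamma(n/2)/(\sqrt{\pi}\,\Gamma((n-1)/2))$; $P_i^{(n)}$ is the degree $i$ orthogonal polynomial for $\mu_n$ with $P_i^{(n)}(1)=1$. Any real polynomial is expanded as $f=\sum_i f_iP_i^{(n)}$ (so $f_0=\int f\,d\mu_n$). $\mathcal{P}_m$ is the set of real polynomials of degree at most $m$. **Linear programs.** $L_h^{(n)}$ is the set of real polynomials $f=\sum_i f_iP_i^{(n)}$ with $f(t)\le h(t)$ on $[-1,1)$ and $f_i\ge0$ for $i\ge1$. Each $f\in L_h^{(n)}$ gives the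 lower bound $\mathcal{E}^h(W)\ge f_0-f(1)\sum_i w_i^2$. $\mathrm{ULB}(W,h)$ is the supremum of $f_0-f(1)\sum_{i=1}^N w_i^2$ over $f\in L_h^{(n)}$, and $\mathrm{ULB}_m(W,h)$ is its maximum over $f\in L_h^{(n)}\cap\mathcal{P}_m$ (for the $m$ associated with $N_W$ and absolutely monotone $h$, $\mathrm{ULB}_m(W,h)=\sum_{i=0}^{k-1+\varepsilon}\rho_ih(\alpha_i)$). **Parameters.** For $m=2k-1+\varepsilon$, $\varepsilon\in\{0,1\}$, $k\ge 1$, put $D(n,m)=\binom{n+k-2+\varepsilon}{n-1}+\binom{n+k-2}{n-1}$. The intervals $(D(n,m),D(n,m+1)]$, $m\ge1$, partition $(2,\infty)$, so $N_W>2$ determines $m$. For $a,b\in\{0,1\}$ let $t_k^{a,b}$ be the largest zero of the Jacobi polynomial $P_k^{(a+(n-3)/2,\,b+(n-3)/2)}$, $k\ge1$, with $t_0^{1,1}=-1$, and let $I_m=[t_{k-1+\varepsilon}^{1,1-\varepsilon},t_k^{1,\varepsilon}]$. The Levenshtein function is $$L_m(n,s)=\binom{k+n-3+\varepsilon}{n-2}\left[\frac{2k+n-3+2\varepsilon}{n-1}-\frac{(1+s)^{\varepsilon}\left(P_{k-1+\varepsilon}^{(n)}(s)-P_{k+\varepsilon}^{(n)}(s)\right)}{(1-s)\left(\varepsilon P_k^{(n)}(s)+P_{k+\varepsilon}^{(n)}(s)\right)}\right],$$ which is known to be an increasing bijection from $I_m$ onto $[D(n,m),D(n,m+1)]$.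 Let $s\in I_m$ be the unique solution of $L_m(n,s)=N_W$. The Levenshtein polynomial $f_m^{(n,s)}$ is the monic multiple of $(1+t)^{\varepsilon}(t-s)K_{k-1}(t,s)^2$, where $K_{k-1}$ is the reproducing kernel of $\mathcal{P}_{k-1}$ in $L^2((1-t)(1+t)^{\varepsilon}d\mu_n)$. Its distinct roots are $\alpha_0<\alpha_1<\dots<\alpha_{k-1+\varepsilon}=s$, where $\alpha_0\ge -1$ with $\alpha_0=-1$ if and only if $\varepsilon=1$. The weights are $\rho_i=\left(\int\ell_i\,d\mu_n-\ell_i(1)/N_W\right)/\ell_i(\alpha_i)$ with $\ell_i(t)=\prod_{j\ne i}(t-\alpha_j)$. It is known that the weights are positive and that $f_0=\frac{f(1)}{N_W}+\sum_{i=0}^{k-1+\varepsilon}\rho_if(\alpha_i)$ for every polynomial $f$ of degree at most $m$. *)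

(* Defs.v *)
From HB Require Import structures.
From mathcomp Require Import all_boot all_order all_algebra.
From mathcomp Require Import all_classical all_reals all_analysis.
Set Implicit Arguments.
Unset Strict Implicit.
Unset Printing Implicit Defensive.
Import Order.TTheory GRing.Theory Num.Theory.
Import numFieldNormedType.Exports.
Local Open Scope classical_set_scope.
Local Open Scope ring_scope.

Section Defs.
Context {R : realType}.
Implicit Types (h : R -> \bar R) (p q f : {poly R}).

(* The values of a potential outside [-1, 1] are never used. Derivatives are taken within [-1, 1[, so that they are
   ordinary derivatives on ]-1, 1[ and one-sided ones at -1. *)

Definition potential h : Prop :=
  [/\ {within `[-1, 1], continuous h},
      (forall t, -1 <= t <= 1 -> h t != -oo%E) &
      (forall t, -1 <= t < 1 -> h t \is a fin_num)].

Definition diff_quotient (g : R -> R) (t u : R) : R := (g u - g t) / (u - t).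

Definition derivable_within (A : set R) (g : R -> R) (t : R) : Prop :=
  cvg (diff_quotient g t u @[u --> within A t^']).

Definition derive_within (A : set R) (g : R -> R) (t : R) : R :=
  lim (diff_quotient g t u @[u --> within A t^']).

Definition potential_derive h (i : nat) : R -> R :=
  iter i (derive_within `[-1, 1[) (fun t => fine (h t)).

Definition smooth_potential h : Prop :=
  forall i t, -1 <= t < 1 -> derivable_within `[-1, 1[ (potential_derive h i) t.

Definition absolutely_monotone h : Prop :=
  smooth_potential h /\
  forall i t, -1 <= t < 1 -> 0 <= potential_derive h i t.

Definition strictly_absolutely_monotone h : Prop :=
  smooth_potential h /\
  forall i t, -1 < t < 1 -> 0 < potential_derive h i t.

Definition weight_vector (N : nat) (w : 'I_N -> R) : Prop :=
  (forall i, 0 < w i) /\ \sum_(i < N) w i = 1.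

Definition sum_sqr (N : nat) (w : 'I_N -> R) : R := \sum_(i < N) w i ^+ 2.

Definition eff_card (N : nat) (w : 'I_N -> R) : R := (sum_sqr w)^-1.

(* [orthopoly w v k] is the polynomial of degree [k]
   which is orthogonal, for the density [w] on [-1, 1], to all polynomials of
   smaller degree, normalized by the value [v] at 1. *)

Definition orthopoly (w : R -> R) (v : R) (k : nat) : {poly R} :=
  xget 0 [set p : {poly R} | [/\ size p = k.+1, p.[1] = v &
    forall q : {poly R}, (size q <= k)%N ->
      \int[lebesgue_measure]_(t in `[-1, 1]) (p.[t] * q.[t] * w t) = 0]].

Definition Gamma (x : R) : R :=
  \int[lebesgue_measure]_(t in `]0, +oo[) (t `^ (x - 1) * expR (- t)).

Definition gamma_const (n : nat) : R :=
  Gamma (n%:R / 2) / (Num.sqrt pi * Gamma ((n%:R - 1) / 2)).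

Definition mu_density (n : nat) (t : R) : R :=
  gamma_const n * (1 - t ^+ 2) `^ ((n%:R - 3) / 2).

Definition mu_int (n : nat) (p : {poly R}) : R :=
  \int[lebesgue_measure]_(t in `[-1, 1]) (p.[t] * mu_density n t).

Definition gegenbauer (n i : nat) : {poly R} := orthopoly (mu_density n) 1 i.

(* [(gegenbauer_coefs n f)`_i] is the coefficient f_i in the expansion of f
   in the basis [gegenbauer n i]; the coefficient sequence is itself stored as
   a polynomial, i.e. without trailing zeroes. *)
Definition gegenbauer_coefs (n : nat) (f : {poly R}) : {poly R} :=
  xget 0 [set c : {poly R} | f = \sum_(i < size c) c`_i *: gegenbauer n i].

(* Usual normalization P_k^(a,b)(1) = (a + 1) ... (a + k) / k!. *)
Definition jacobi (a b : R) (k : nat) : {poly R} :=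
  orthopoly (fun t => (1 - t) `^ a * (1 + t) `^ b)
            (\prod_(i < k) ((a + i.+1%:R) / i.+1%:R)) k.

Definition largest_root p : R :=
  xget 0 [set t | root p t /\ forall u, root p u -> u <= t].

(* t_k^{a,b}; the value at k = 0 is only used for a = b = 1. *)
Definition jacobi_zero (n a b k : nat) : R :=
  if k is 0%N then -1
  else largest_root
         (jacobi (a%:R + (n%:R - 3) / 2) (b%:R + (n%:R - 3) / 2) k).

Definition lp_feasible (n : nat) h : set {poly R} :=
  [set f : {poly R} | (forall t, -1 <= t < 1 -> (f.[t]%:E <= h t)%E) /\
           (forall i, (1 <= i)%N -> 0 <= (gegenbauer_coefs n f)`_i)].

Definition lp_value (n N : nat) (w : 'I_N -> R) (f : {poly R}) : R :=
  (gegenbauer_coefs n f)`_0 - f.[1] * sum_sqr w.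

Definition ULB (n N : nat) (w : 'I_N -> R) h : \bar R :=
  ereal_sup [set (lp_value n w f)%:E | f in lp_feasible n h].

(* The supremum is the maximum whenever the latter exists. *)
Definition ULB_deg (m n N : nat) (w : 'I_N -> R) h : \bar R :=
  ereal_sup [set (lp_value n w f)%:E |
              f in lp_feasible n h `&` [set f : {poly R} | (size f <= m.+1)%N]].

(* A positive integer m is uniquely 2k - 1 + eps with
   k = (m + 1)./2 and eps = 1 iff m is even. *)

Definition delsarte_bound (n m : nat) : nat :=
  let k := m.+1./2 in
  let eps : nat := ~~ odd m in
  ('C(n + k + eps - 2, n - 1) + 'C(n + k - 2, n - 1))%N.

Definition levenshtein_interval (n k : nat) (eps : bool) : set R :=
  `[jacobi_zero n 1 (1 - eps) (k - 1 + eps), jacobi_zero n 1 eps k].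

Definition levenshtein_fun (n k : nat) (eps : bool) (s : R) : R :=
  let P i := (gegenbauer n i).[s] in
  'C(k + n + eps - 3, n - 2)%:R *
  ((2 * k + n + 2 * eps - 3)%:R / (n - 1)%:R -
   (1 + s) ^+ eps * (P (k - 1 + eps)%N - P (k + eps)%N) /
   ((1 - s) * (eps%:R * P k + P (k + eps)%N))).

(* The kernel K_{k-1}(., s), as a polynomial in its first variable. *)
Definition reproducing_kernel (n k : nat) (eps : bool) (s : R) : {poly R} :=
  xget 0 [set K : {poly R} | (size K <= k)%N /\
    forall q : {poly R}, (size q <= k)%N ->
      mu_int n (K * q * ((1 - 'X) * (1 + 'X) ^+ eps)) = q.[s]].

Definition levenshtein_poly (n k : nat) (eps : bool) (s : R) : {poly R} :=
  let g := (1 + 'X) ^+ eps * ('X - s%:P) * reproducing_kernel n k eps s ^+ 2 in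
  (lead_coef g)^-1 *: g.

Definition levenshtein_nodes (n k : nat) (eps : bool) (s : R)
    (alpha : 'I_(k + eps) -> R) : Prop :=
  (forall i j : 'I_(k + eps), (i < j)%N -> alpha i < alpha j) /\
  (forall t, root (levenshtein_poly n k eps s) t <-> exists i, alpha i = t).

Definition node_poly (r : nat) (alpha : 'I_r -> R) (i : 'I_r) : {poly R} :=
  \prod_(j < r | j != i) ('X - (alpha j)%:P).

Definition levenshtein_weight (n r : nat) (M : R) (alpha : 'I_r -> R)
    (i : 'I_r) : R :=
  let l := node_poly alpha i in (mu_int n l - l.[1] / M) / l.[alpha i].

Definition test_function (n r : nat) (M : R) (alpha : 'I_r -> R) (j : nat) : R :=
  M^-1 + \sum_(i < r)
           levenshtein_weight n M alpha i * (gegenbauer n j).[alpha i].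

End Defs.

(* Main.v *)
(* Write lp(f) = f_0 - f(1) / N_W.  The quadrature formula turns lp(f) into
   sum_i rho_i f(alpha_i) for every f of degree at most m, and lp(P_j) into
   sum_i rho_i P_j(alpha_i) - Q_j for every j >= 1.  Since f <= h at the nodes
   and rho_i >= 0, both ULB_m and, when all Q_j >= 0, ULB are at most
   V = sum_i rho_i h(alpha_i).

   The value V is approached from below.  The Taylor polynomials T_M of h at -1
   are below h and converge to it on [-1, 1).  Newton interpolation of T_M at
   the nodes, doubled except for -1, gives T_M = H + (1 + t)^eps B^2 G, where G
   again has nonnegative coefficients in powers of t + 1; so H <= h, and
   lp(H) = sum_i rho_i T_M(alpha_i) tends to V.  The Gegenbauer coefficients of
   H are nonnegative because those of the partial products of B are (Cohn and
   Kumar) and products of Gegenbauer polynomials have nonnegative coefficients.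
   If Q_j < 0, interpolating T_M - eta P_j instead and adding eta P_j back
   gives the value sum_i rho_i T_M(alpha_i) - eta Q_j, which exceeds V for a
   small eta > 0 and large M.

   That the nodes lie in [-1, 1) and the weights are nonnegative follows from
   D(n, m) < N_W and the extremal property D q(1)^2 <= int q^2 of the kernels
   at 1. *)
Require Import Defs.
From mathcomp Require Import all_boot all_order all_algebra.
From mathcomp Require Import all_classical all_reals all_analysis.
From mathcomp Require Import measurable_realfun zify ring lra.
Import Order.TTheory GRing.Theory Num.Theory.
Import numFieldNormedType.Exports.
Set Implicit Arguments.
Unset Strict Implicit.
Unset Printing Implicit Defensive.
Local Open Scope ring_scope.

(** * Gegenbauer polynomials *)

(** The measure enters only through linearity, mass 1, positivity and the Pearson identity, which is
    integration by parts against (1 - t^2)^((n-3)/2). These properties already force the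
    orthogonality and the norms of the P_i, so the whole theory of the quadrature is polynomial
    algebra over an ordered field; analysis serves only to verify them for mu_n and to treat h.
    Replacing h by Taylor polynomials turns Hermite interpolation into polynomial division, and the
    sign of its remainder into that of divided differences of powers of t + 1, nonnegative because
    every node is at least -1. The price is that V is reached only as a supremum. The expansion
    point -1 is also where (b) finds room: h^(i)(-1) > 0 allows eta P_j to be subtracted coefficient
    by coefficient. The argument of Cohn and Kumar covers the proper partial products of B. For B
    itself, N_W <= D(n, m+1) enters: it makes B a nonnegative combination of two consecutive kernels
    at 1. *)

Lemma poly_basis (F : fieldType) (p : nat -> {poly F}) (m : nat) (f : {poly F}) :
  (forall i, (i < m)%N -> size (p i) = i.+1) -> (size f <= m)%N ->
  exists c : nat -> F, f = \sum_(i < m) c i *: p i.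
Proof.
elim: m f => [|m IH] f sp sf.
  exists (fun=> 0); rewrite big_ord0; apply/eqP.
  by rewrite -size_poly_eq0; move: sf; rewrite leqn0.
have lp : lead_coef (p m) != 0 by rewrite lead_coef_eq0 -size_poly_eq0 sp.
pose a := f`_m / lead_coef (p m).
have sg : (size (f - a *: p m)%R <= m)%N.
  apply/leq_sizeP => j; rewrite leq_eqVlt => /predU1P[<-|mj].
    rewrite coefB coefZ /a lead_coefE sp// -mulrA mulVf ?mulr1 ?subrr//.
    by move: lp; rewrite lead_coefE sp.
  rewrite coefB coefZ !nth_default ?mulr0 ?subrr ?sp//.
  exact: leq_trans sf _.
have [||c cE] := IH (f - a *: p m) => //.
  by move=> i im; apply: sp; apply: ltnW.
exists (fun i => if i == m then a else c i).
rewrite big_ord_recr/= eqxx.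
rewrite (eq_bigr (fun i : 'I_m => c i *: p i)) -?cE ?subrK//.
by move=> i _; rewrite (ltn_eqF (ltn_ord i)).
Qed.

Section PolynomialFunctional.
Variables (R : realFieldType) (L : {poly R} -> R).
Hypothesis LD : forall p q, L (p + q) = L p + L q.
Hypothesis LZ : forall a p, L (a *: p) = a * L p.
Implicit Types (p q f : {poly R}).

Lemma functional0 : L 0 = 0.
Proof. by rewrite -(scale0r 0) LZ mul0r. Qed.

Lemma functionalN p : L (- p) = - L p.
Proof. by rewrite -scaleN1r LZ mulN1r. Qed.

Lemma functionalB p q : L (p - q) = L p - L q.
Proof. by rewrite LD functionalN. Qed.

Lemma functional_sum (I : Type) (r : seq I) (P : pred I) (F : I -> {poly R}) :
  L (\sum_(i <- r | P i) F i) = \sum_(i <- r | P i) L (F i).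
Proof. exact: (big_morph L LD functional0). Qed.

Lemma functionalC a p : L (a%:P * p) = a * L p.
Proof. by rewrite mul_polyC LZ. Qed.

Lemma functional_nat k p : L (k%:R * p) = k%:R * L p.
Proof. by rewrite -polyC_natr functionalC. Qed.

Lemma functional_orth p k : (forall j, (j < k)%N -> L (p * 'X^j) = 0) ->
  forall q, (size q <= k)%N -> L (p * q) = 0.
Proof.
move=> po q sq; rewrite -[q]coefK poly_def mulr_sumr functional_sum big1// => i _.
by rewrite -scalerAr LZ po ?mulr0//; apply: leq_trans sq.
Qed.
End PolynomialFunctional.

Section Gegenbauer.
Variables (R : realFieldType) (d : nat).
Implicit Types (i j k : nat) (p q f : {poly R}).

(** With d = n - 2, [gb_dim i] is the dimension of the spherical harmonics of degree i in R^n, and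
    the inverse of the squared norm of P_i ([gb_norm]). Its two summands are the coefficients of the
    recurrence r_i t P_i = b_i P_(i+1) + b_(i-1) P_(i-1), whence P_i(1) = 1. *)
Definition gb_bin i : nat := 'C(i + d, d).
Definition gb_binp i : nat := if i is i'.+1 then gb_bin i' else 0.
Definition gb_dim i : nat := gb_bin i + gb_binp i.

Fixpoint gb_pair i : {poly R} * {poly R} :=
  if i is i'.+1 then
    let pq := gb_pair i' in
    (pq.2, (gb_bin i)%:R^-1 *: ((gb_dim i)%:R * ('X * pq.2) - (gb_bin i')%:R * pq.1))
  else (1, 'X).

Definition gb i : {poly R} := (gb_pair i).1.
Arguments gb : simpl never.

Notation b := gb_bin. Notation b' := gb_binp. Notation r := gb_dim. Notation P := gb.

Lemma gb_bin_gt0 i : (0 < b i)%N. Proof. by rewrite bin_gt0 leq_addl. Qed.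
Lemma gb_dim_gt0 i : (0 < r i)%N. Proof. by rewrite addn_gt0 gb_bin_gt0. Qed.

Lemma gb_binS i : (i.+1 * b i.+1 = (i.+1 + d) * b i)%N.
Proof.
have := mul_bin_down (i.+1 + d) d.
by rewrite addnK addSn /= => ->; rewrite -addSn.
Qed.

Lemma gb_binpE i : ((i + d) * b' i = i * b i)%N.
Proof. by case: i => [|i]; rewrite ?muln0 ?mul0n// gb_binS. Qed.

Lemma gb_dimE i : ((i + d) * r i = (2 * i + d) * b i)%N.
Proof. by rewrite mulnDr gb_binpE -mulnDl; congr (_ * _)%N; lia. Qed.

Lemma gb0 : P 0 = 1. Proof. by []. Qed.
Lemma gb1 : P 1 = 'X. Proof. by []. Qed.

Lemma gb_rec i : (r i)%:R * ('X * P i) = (b i)%:R * P i.+1 + (b' i)%:R * P i.-1.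
Proof.
case: i => [|i] /=.
  by rewrite /gb_dim /gb_bin /gb_binp add0n binn addn0 mul0r addr0 !mul1r gb0 gb1 mulr1.
rewrite {2}/gb /= -/(P i) -[X in _ = _ * X + _]/(_ *: _) /=.
rewrite -[(b i.+1)%:R]polyC_natr mul_polyC scalerA divff ?pnatr_eq0 -?lt0n ?gb_bin_gt0//.
by rewrite scale1r subrK.
Qed.

Lemma size_gb i : size (P i) = i.+1 /\ 0 < lead_coef (P i).
Proof.
suff : (size (P i) = i.+1 /\ 0 < lead_coef (P i)) /\
       (size (P i.+1) = i.+2 /\ 0 < lead_coef (P i.+1)) by case.
elim: i => [|i [[s1 l1] [s2 l2]]].
  by rewrite gb0 gb1 size_poly1 lead_coef1 size_polyX lead_coefX.
split=> //; rewrite {1 2}/gb /= -/(P i) -/(P i.+1).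
have bV : 0 < (b i.+1)%:R^-1 :> R by rewrite invr_gt0 ltr0n gb_bin_gt0.
set q := (X in _ *: (X - _)); set q' := (X in _ *: (_ - X)).
have rn : (r i.+1)%:R != 0 :> R by rewrite pnatr_eq0 -lt0n gb_dim_gt0.
have p0 : P i.+1 != 0 by rewrite -size_poly_eq0 s2.
have sq : size q = i.+3.
  by rewrite /q -polyC_natr mul_polyC size_scale// mulrC size_mulX// s2.
have sq' : (size q' < size q)%N.
  rewrite sq /q' -polyC_natr mul_polyC; apply: leq_ltn_trans (size_scale_leq _ _) _.
  by rewrite s1; lia.
have sd : size (- q') = size q' by rewrite size_polyN.
rewrite size_scale ?gt_eqF// size_polyDl ?sd// sq; split=> //.
rewrite lead_coefZ lead_coefDl ?sd// mulr_gt0//.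
rewrite /q -polyC_natr mul_polyC lead_coefZ ['X * _]mulrC lead_coefMX.
by rewrite mulr_gt0// ltr0n gb_dim_gt0.
Qed.

Lemma horner1_gb i : (P i).[1] = 1.
Proof.
suff : (P i).[1] = 1 /\ (P i.+1).[1] = 1 by case.
elim: i => [|i [s1 s2]]; first by rewrite gb0 gb1 !hornerE.
split=> //; have := congr1 (fun p : {poly R} => p.[1]) (gb_rec i.+1).
rewrite -!polyC_natr !(hornerM, hornerD, hornerC, hornerX) /= s1 s2 !mulr1 /gb_dim natrD.
have b0 : (b i.+1)%:R != 0 :> R by rewrite pnatr_eq0 -lt0n gb_bin_gt0.
by move=> /addIr h; apply: (mulfI b0); rewrite mulr1 -h.
Qed.

Lemma gb_rec_int i :
  (i + d)%:R * P i.+1 = (2 * i + d)%:R * ('X * P i) - i%:R * P i.-1.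
Proof.
have b0 : (b i)%:R != 0 :> {poly R}.
  by rewrite -polyC_natr polyC_eq0 pnatr_eq0 -lt0n gb_bin_gt0.
apply: (mulfI b0).
have e1 : (b i)%:R * P i.+1 = (r i)%:R * ('X * P i) - (b' i)%:R * P i.-1.
  by rewrite gb_rec addrK.
rewrite mulrCA e1 !mulrBr !mulrA -!natrM gb_dimE gb_binpE.
by rewrite [(b i * i)%N]mulnC [(b i * _)%N]mulnC.
Qed.

(** This expresses the left side of the Pearson identity for P_i through P_(i-1) and t P_i. The
    induction differentiates the recurrence and multiplies it by 1 - t^2. *)
Lemma gb_deriv i : (1 - 'X^2) * (P i)^`() = i%:R * (P i.-1 - 'X * P i).
Proof.
suff : (1 - 'X^2) * (P i)^`() = i%:R * (P i.-1 - 'X * P i) /\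
       (1 - 'X^2) * (P i.+1)^`() = i.+1%:R * (P i - 'X * P i.+1) by case.
elim: i => [|i [A1 A2]].
  rewrite gb0 gb1 derivX (_ : (1 : {poly R})^`() = 0); last exact: derivC.
  by rewrite /= ?gb0; split; ring.
split=> //=.
have nz : (i.+1 + d)%:R != 0 :> {poly R} by rewrite -polyC_natr polyC_eq0 pnatr_eq0.
apply: (mulfI nz).
have e := gb_rec_int i.+1.
have derivnat k (q : {poly R}) : (k%:R * q)^`() = k%:R * q^`().
  by rewrite -polyC_natr mul_polyC derivZ -mul_polyC.
have de : (i.+1 + d)%:R * (P i.+2)^`() = (2 * i.+1 + d)%:R * (P i.+1 + 'X * (P i.+1)^`()) -
    i.+1%:R * (P i)^`().
  by rewrite -derivnat e derivB !derivnat derivM derivX mul1r.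
have B := gb_rec_int i.
transitivity ((1 - 'X^2) * ((i.+1 + d)%:R * (P i.+2)^`())); first by ring.
rewrite de.
transitivity ((2 * i.+1 + d)%:R * ((1 - 'X^2) * P i.+1 + 'X * ((1 - 'X^2) * (P i.+1)^`())) -
   i.+1%:R * ((1 - 'X^2) * (P i)^`())); first by ring.
rewrite A1 A2.
transitivity (i.+2%:R * ((i.+1 + d)%:R * P i.+1 - 'X * ((i.+1 + d)%:R * P i.+2))); last by ring.
rewrite e /=.
have -> : i%:R * (P i.-1 - 'X * P i) = (i + d)%:R * ('X * P i - P i.+1).
  by rewrite [RHS]mulrBr B; ring.
ring.
Qed.

(* The properties of integration against mu_n, with d = n - 2, from which
   everything else is derived algebraically. *)
Record gb_functional (L : {poly R} -> R) : Prop := GbFunctional {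
  gbfD : forall p q, L (p + q) = L p + L q;
  gbfZ : forall a p, L (a *: p) = a * L p;
  gbf1 : L 1 = 1;
  gbf_pearson : forall p, L ((1 - 'X^2) * p^`()) = d.+1%:R * L ('X * p);
  gbf_ge0 : forall p, (forall t, -1 <= t <= 1 -> 0 <= p.[t]) -> 0 <= L p }.

Section Functional.
Variable L : {poly R} -> R.
Hypothesis HL : gb_functional L.

Let LD := gbfD HL.
Let LZ := gbfZ HL.
Let L1 := gbf1 HL.
Let pearson := gbf_pearson HL.
Let Lnat := functional_nat LZ.
Let LB := functionalB LD LZ.

(** The Pearson identity for P_(j+1) expresses L(t P_(j+1)) by L(P_j), and the recurrence then gives
    (j + 1 + d) L(P_(j+2)) = j L(t P_(j+1)). The factor j makes L(P_2) vanish although L(P_0) =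
    1. *)
Lemma functional_gb i : L (P i.+1) = 0.
Proof.
suff : L (P i.+1) = 0 /\ L (P i.+2) = 0 by case.
have key j : (j.+1 + d)%:R * L (P j.+2) = j%:R * L ('X * P j.+1) /\
             (d.+1 + j.+1)%:R * L ('X * P j.+1) = j.+1%:R * L (P j).
  have := pearson (P j.+1); rewrite gb_deriv Lnat LB /= => e1.
  have := congr1 L (gb_rec_int j.+1); rewrite /= LB !Lnat => e2.
  by split; move: e1 e2; rewrite !(natrD, natrM, natr1) -!natr1; lra.
have nz k : (k.+1 + d)%:R != 0 :> R by rewrite pnatr_eq0.
elim: i => [|i [h1 h2]].
  split.
    have := pearson 1; rewrite -[1 in X in X -> _]/(1%:P) derivC mulr0 (functional0 LZ) mulr1.
    by move/esym/eqP; rewrite mulf_eq0 pnatr_eq0 /= => /eqP.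
  have [h _] := key 0%N; apply: (mulfI (nz 0%N)).
  by rewrite h mul0r mulr0.
split=> //; have [h3 h4] := key i.+1.
apply: (mulfI (nz i.+1)); rewrite h3 mulr0.
suff -> : L ('X * P i.+2) = 0 by rewrite mulr0.
apply: (@mulfI _ (d.+1 + i.+2)%:R); first by rewrite pnatr_eq0.
by rewrite h4 h1 !mulr0.
Qed.

Lemma gb_orthX m i : (m < i)%N -> L (P i * 'X^m) = 0.
Proof.
elim: m i => [|m IH] [//|i] mi; first by rewrite expr0 mulr1 functional_gb.
have r0 : (r i.+1)%:R != 0 :> R by rewrite pnatr_eq0 -lt0n gb_dim_gt0.
apply: (mulfI r0); rewrite mulr0 -Lnat.
have -> : (r i.+1)%:R * (P i.+1 * 'X^(m.+1)) = (r i.+1)%:R * ('X * P i.+1) * 'X^m :> {poly R}.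
  by rewrite exprS; ring.
rewrite gb_rec mulrDl LD -!mulrA !Lnat !IH ?mulr0 ?addr0//=; lia.
Qed.

Lemma gb_orth i q : (size q <= i)%N -> L (P i * q) = 0.
Proof. by move: q; apply: functional_orth => // j; exact: gb_orthX. Qed.

Lemma gb_orth_neq i j : i != j -> L (P i * P j) = 0.
Proof.
have [s _] := size_gb i; have [s' _] := size_gb j.
by rewrite neq_ltn => /orP[?|?]; [rewrite mulrC|]; apply: gb_orth; rewrite ?s ?s'.
Qed.

(** L(t P_i P_(i+1)) is evaluated by the recurrence for t P_i and by the one for t P_(i+1); both
    involve the same b_i, so r_i L(P_i^2) does not depend on i. *)
Lemma gb_norm i : (r i)%:R * L (P i * P i) = 1.
Proof.
elim: i => [|i IH].
  by rewrite gb0 mulr1 L1 mulr1 /gb_dim /gb_bin add0n binn.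
have b0 : (b i)%:R != 0 :> R by rewrite pnatr_eq0 -lt0n gb_bin_gt0.
have o1 : L (P i.+2 * P i) = 0 by apply: gb_orth_neq; rewrite gtn_eqF.
have o2 : (b' i)%:R * L (P i.-1 * P i.+1) = 0.
  by rewrite gb_orth_neq ?mulr0//; lia.
have := congr1 (fun p => L (p * P i.+1)) (gb_rec i).
rewrite mulrDl LD -!mulrA !Lnat o2 addr0 => e1.
have := congr1 (fun p => L (p * P i)) (gb_rec i.+1).
rewrite mulrDl LD -!mulrA !Lnat o1 mulr0 add0r /= => e2.
have e3 : L ('X * (P i.+1 * P i)) = L ('X * (P i * P i.+1)) by congr L; ring.
have e4 : (b i)%:R * ((r i.+1)%:R * L (P i.+1 * P i.+1)) =
          (b i)%:R * ((r i)%:R * L (P i * P i)).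
  rewrite mulrCA -e1 -e3 [RHS]mulrCA -e2; ring.
by apply: (mulfI b0); rewrite e4 IH.
Qed.

Lemma gb_norm_gt0 i : 0 < L (P i * P i).
Proof.
have r0 : 0 < (r i)%:R :> R by rewrite ltr0n gb_dim_gt0.
by rewrite -(pmulr_rgt0 _ r0) gb_norm.
Qed.

Lemma gb_expand f m : (size f <= m)%N ->
  f = \sum_(i < m) ((r i)%:R * L (f * P i)) *: P i.
Proof.
move=> sf; have [|c fE] := @poly_basis R P m f _ sf.
  by move=> i _; have [] := size_gb i.
rewrite {1}fE; apply: eq_bigr => i _; congr (_ *: _).
rewrite fE mulr_suml (functional_sum LD LZ) (bigD1 i)//= big1 ?addr0.
  by rewrite -scalerAl LZ mulrCA gb_norm mulr1.
by move=> j ji; rewrite -scalerAl LZ gb_orth_neq ?mulr0.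
Qed.

End Functional.
End Gegenbauer.

(** * Nonnegative Gegenbauer coefficients and products *)

Section PositiveDefinite.
Variables (R : realFieldType) (d : nat) (L : {poly R} -> R).
Hypothesis HL : gb_functional d L.
Implicit Types (p q f g : {poly R}).

Let LD := gbfD HL.
Let LZ := gbfZ HL.

Notation b := (gb_bin d). Notation b' := (gb_binp d). Notation r := (gb_dim d).
Notation P := (@gb R d).

(** By [gb_expand], L(f P_j) is the j-th Gegenbauer coefficient divided by [gb_dim j]; the
    coefficient f_0 is included. These are Schoenberg's positive definite functions on the
    sphere. *)
Definition posdef f := forall j, 0 <= L (f * P j).

Lemma posdef_gb i : posdef (P i).
Proof.
move=> j; have [->|ij] := eqVneq i j; first by rewrite ltW// (gb_norm_gt0 HL).
by rewrite (gb_orth_neq HL).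
Qed.

Lemma posdefD f g : posdef f -> posdef g -> posdef (f + g).
Proof. by move=> pf pg j; rewrite mulrDl LD addr_ge0. Qed.

Lemma posdefZ a f : 0 <= a -> posdef f -> posdef (a *: f).
Proof. by move=> a0 pf j; rewrite -scalerAl LZ mulr_ge0. Qed.

Lemma posdef0 : posdef 0.
Proof. by move=> j; rewrite mul0r (functional0 LZ). Qed.

Lemma posdef_sum (I : Type) (s : seq I) (Q : pred I) (F : I -> {poly R}) :
  (forall i, Q i -> posdef (F i)) -> posdef (\sum_(i <- s | Q i) F i).
Proof.
by move=> pF; apply: (big_ind posdef posdef0 posdefD).
Qed.

Lemma posdef1 : posdef 1. Proof. exact: posdef_gb 0%N. Qed.

(* Szwarc's argument: the products p_i p_j solve a discrete boundary value
   problem whose solution is a nonnegative combination of the boundary values. *)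
Let c i : R := i%:R / (2 * i + d)%:R.
Let p i : {poly R} := (r i)%:R * P i.

Let c_bin i : c i * (r i)%:R = (b' i)%:R.
Proof.
case: i => [|i]; first by rewrite /c !mul0r.
have nz k : (i.+1 + k)%:R != 0 :> R by rewrite pnatr_eq0.
apply: (mulfI (nz d)); rewrite -natrM gb_binpE /c.
transitivity (i.+1%:R / (2 * i.+1 + d)%:R * ((i.+1 + d) * r i.+1)%:R : R).
  by rewrite natrM; ring.
by rewrite gb_dimE !natrM mulrA mulfVK ?pnatr_eq0.
Qed.

Let c_bin' i : (1 - c i) * (r i)%:R = (b i)%:R.
Proof. by rewrite mulrBl c_bin mul1r /gb_dim natrD addrK. Qed.

Let c_mono i j : (i <= j)%N -> c i <= c j.
Proof.
case: i => [|i] ij; first by rewrite /c mul0r divr_ge0.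
rewrite /c ler_pdivrMr ?ltr0n// mulrAC ler_pdivlMr ?ltr0n; last by lia.
by rewrite -!natrM ler_nat; nia.
Qed.

Let c_half i : c i <= 1 / 2.
Proof.
case: i => [|i]; first by rewrite /c mul0r divr_ge0.
by rewrite /c ler_pdivrMr ?ltr0n// mulrAC ler_pdivlMr// mul1r -natrM ler_nat; lia.
Qed.

Let p_rec i : 'X * p i = (c i.+1)%:P * p i.+1 + (1 - c i.-1)%:P * p i.-1 *+ (i != 0%N).
Proof.
rewrite /p mulrCA gb_rec.
have e k (a : R) : a%:P * ((r k)%:R * P k) = (a * (r k)%:R)%:P * P k.
  by rewrite mulrA -[(r k)%:R]polyC_natr -polyCM.
rewrite e c_bin /= polyC_natr; congr (_ + _).
case: i => [|i] /=; first by rewrite mul0r mulr0n.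
by rewrite mulr1n e c_bin' polyC_natr.
Qed.

Let U k m := \sum_(0 <= y < m) (1 - c (k + y) - c y)%:P * (p (k + y) * p y).
Let V e m := \sum_(0 <= y < m) (c (e - y) - c y)%:P * (p (e - y) * p y).

(** The product at (k + m, m) is expressed by products with second index y < m: [U] runs along
    constant difference k, [V] along constant sum k + 2m. Their coefficients are nonnegative because
    c <= 1/2 and c is nondecreasing, so an induction on the smaller index applies. *)
Let claim k m := (c m)%:P * (p (k + m) * p m) = U k m + V (k + 2 * m) m.

Let claimP m : (forall k, claim k m) /\ (forall k, claim k m.+1).
Proof.
elim: m => [|m [IH1 IH2]].
  split=> k; rewrite /claim /U /V ?big_nat1 ?big_geq//.
    by rewrite /c !mul0r addr0.
  have := p_rec k.+1; have := p_rec 0%N; rewrite /= mulr0n addr0 mulr1n.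
  rewrite addn1 addn0 subn0 (_ : k + 2 * 1 = k.+2)%N; last by lia.
  have -> : c 0 = 0 by rewrite /c mul0r.
  rewrite !subr0 => e1 e2.
  transitivity (p k.+1 * ((c 1)%:P * p 1)); first by ring.
  rewrite -e1.
  transitivity (('X * p k.+1) * p 0); first by ring.
  by rewrite e2; ring.
(* The identity (t p_a) p_b = p_a (t p_b) is a discrete wave equation. For a = k + m + 2 and b = m +
   1 it yields the claim at (k, m + 2) from those at (k + 2, m), (k, m + 1) and (k + 2, m + 1). *)
split=> // k; rewrite /claim.
have US a j : U a j.+1 = U a j + (1 - c (a + j) - c j)%:P * (p (a + j) * p j).
  by rewrite /U big_nat_recr.
have VS a j : V a j.+1 = V a j + (c (a - j) - c j)%:P * (p (a - j) * p j).
  by rewrite /V big_nat_recr.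
have := IH1 k.+2; have := IH2 k; have := IH2 k.+2; rewrite /claim.
have -> : (k.+2 + m.+1 = k + m.+3)%N by lia.
have -> : (k.+2 + 2 * m.+1 = k + 2 * m.+2)%N by lia.
have -> : (k.+2 + m = k + m.+2)%N by lia.
have -> : (k.+2 + 2 * m = k + 2 * m.+1)%N by lia.
rewrite (US k m.+1) (VS (k + 2 * m.+2)%N m.+1) (US k.+2 m) (VS (k + 2 * m.+1)%N m).
have -> : (k + 2 * m.+2 - m.+1 = k + m.+3)%N by lia.
have -> : (k + 2 * m.+1 - m = k + m.+2)%N by lia.
have -> : (k.+2 + m = k + m.+2)%N by lia.
have := p_rec (k + m.+2); have := p_rec m.+1.
rewrite (_ : ((k + m.+2)%N != 0%N)); last by rewrite addnS.
rewrite /= mulr1n (_ : (k + m.+2).-1 = k + m.+1)%N; last by lia.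
rewrite (_ : (k + m.+2).+1 = k + m.+3)%N; last by lia.
rewrite !polyCB.
move: (U _ _) (U _ _) (V _ _) (V _ _) => u1 u2 v1 v2.
move: (p _) (p _) (p _) (p _) (p _) (p _) => p1 p2 p3 p4 p5 p6.
rewrite polyC1 mulr1n.
move: (_%:P) (_%:P) (_%:P) (_%:P) (_%:P) (_%:P) => x1 x2 x3 x4 x5 x6 e1 e2 h1 h2 h3.
have eu : u1 = x2 * (p1 * p6) - (v1 + (x1 - x5) * (p3 * p4)) by rewrite h2 addrK.
have ev : v2 = x2 * (p2 * p6) - (u2 + (1 - x1 - x5) * (p3 * p4)) by rewrite h1 addrC addKr.
transitivity (('X * p3) * p6 - (1 - x5) * (p3 * p4)).
  transitivity (p3 * (x6 * p5 + (1 - x5) * p4) - (1 - x5) * (p3 * p4)); first by ring.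
  by rewrite -e1; ring.
rewrite e2 eu ev.
transitivity ((x4 * p2 + (1 - x3) * p1) * p6 - (1 - 2 * x5) * (p3 * p4) - x5 * (p3 * p4)).
  by ring.
by rewrite h3; ring.
Qed.

Lemma posdef_gbM i j : posdef (P i * P j).
Proof.
wlog ij : i j / (i <= j)%N => [H|].
  by have [|/ltnW] := leqP i j => ij; [|rewrite mulrC]; apply: H.
suff pp m : forall k, posdef (p (k + m) * p m).
  have r0 k : 0 < (r k)%:R :> R by rewrite ltr0n gb_dim_gt0.
  have := pp i (j - i)%N; rewrite subnK// => H k; have := H k.
  have -> : p j * p i * P k = ((r j)%:R * (r i)%:R) *: (P i * P j * P k).
    by rewrite /p -!polyC_natr -mul_polyC polyCM; ring.
  by rewrite LZ pmulr_rge0// mulr_gt0.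
elim/ltn_ind: m => -[_|m IH] k.
  have -> : p (k + 0) * p 0 = (r k)%:R *: P k.
    rewrite addn0 /p gb0 /gb_dim /gb_bin /= add0n binn addn0 !mulr1.
    by rewrite -polyC_natr mul_polyC.
  by apply: posdefZ => //; exact: posdef_gb.
have c0 : 0 < c m.+1 by rewrite /c divr_gt0 ?ltr0n.
have [_ /(_ k)] := claimP m; rewrite /claim => E.
have -> : p (k + m.+1) * p m.+1 =
    (c m.+1)^-1 *: ((c m.+1)%:P * (p (k + m.+1) * p m.+1)).
  by rewrite mul_polyC scalerA mulVf ?scale1r// gt_eqF.
rewrite E; apply: posdefZ; first by rewrite invr_ge0 ltW.
apply: posdefD; rewrite /U /V big_mkord; apply: posdef_sum => y _; rewrite mul_polyC.
  apply: posdefZ; last exact: IH.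
  by have := c_half (k + y); have := c_half y; lra.
apply: posdefZ.
  by rewrite subr_ge0; apply: c_mono; have := ltn_ord y; lia.
rewrite (_ : (k + 2 * m.+1 - y = (k + 2 * m.+1 - 2 * y) + y)%N); last by have := ltn_ord y; lia.
exact: IH.
Qed.

Lemma posdefM f g : posdef f -> posdef g -> posdef (f * g).
Proof.
move=> pf pg.
rewrite (gb_expand HL (leqnn (size f))) (gb_expand HL (leqnn (size g))) mulr_suml.
apply: posdef_sum => i _; rewrite mulr_sumr; apply: posdef_sum => j _.
rewrite -scalerAl -scalerAr.
by do 2 (apply: posdefZ; first by rewrite mulr_ge0); exact: posdef_gbM.
Qed.

End PositiveDefinite.

Lemma poly_split1 (F : idomainType) (q : {poly F}) j : (size q <= j.+1)%N ->
  exists2 u : {poly F}, (size u <= j)%N & q = q.[1]%:P + (1 - 'X) * u.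
Proof.
move=> sq.
have /factor_theorem [u uE] : root (q - q.[1]%:P) 1.
  by rewrite /root hornerD hornerN hornerC subrr.
exists (- u).
  rewrite size_polyN; have [->|u0] := eqVneq u 0; first by rewrite size_poly0.
  have : size (u * ('X - 1%:P)) = (size u).+1.
    by rewrite size_Mmonic ?monicXsubC// size_XsubC addn2.
  rewrite -uE => h; rewrite -ltnS -h.
  apply: (leq_trans (size_polyD _ _)); rewrite geq_max sq size_polyN.
  by rewrite (leq_trans (size_polyC_leq1 _)).
rewrite -[LHS](subrK q.[1]%:P) uE polyC1; ring.
Qed.

(** * Kernels at the point 1 and their extremal property *)

Section ChristoffelDarboux.
Variables (R : realFieldType) (d : nat).
Implicit Types (p q f g : {poly R}) (eps : bool).

Notation b := (gb_bin d). Notation b' := (gb_binp d). Notation r := (gb_dim d).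
Notation P := (@gb R d).

(* [gb_kernel eps j] is proportional to the kernel at 1 of the polynomials of
   degree at most [j] for the measure (1 + t)^eps dmu_n, i.e. to the Jacobi
   polynomial P_j^(1,eps). *)
Fixpoint gb_kernel1 j : {poly R} :=
  match j with
  | 0 => 2%:R
  | 1 => (2 * r 1)%:R * 'X
  | (j'.+1 as j1).+1 => gb_kernel1 j' + (2 * r j1.+1)%:R * P j1.+1
  end.

Definition gb_kernel eps j : {poly R} :=
  if eps then gb_kernel1 j else \sum_(i < j.+1) (r i)%:R * P i.

(** This is the value of the kernel at 1: [gb_total false j] is D(n, 2j) and [gb_total true j] is
    D(n, 2j + 1). *)
Definition gb_total eps j : nat :=
  if eps then \sum_(i < j.+1) 2 * b i else \sum_(i < j.+1) r i.

Notation S := gb_kernel. Notation D := gb_total.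

Lemma gb_kernel1S j : S true j.+2 = S true j + (2 * r j.+2)%:R * P j.+2.
Proof. by []. Qed.

Lemma gb_kernel0S j : S false j.+1 = S false j + (r j.+1)%:R * P j.+1.
Proof. by rewrite /S big_ord_recr. Qed.

Lemma gb_totalS eps j : D eps j.+1 = (D eps j + if eps then 2 * b j.+1 else r j.+1)%N.
Proof. by case: eps; rewrite /D big_ord_recr. Qed.

Lemma gb_kernel_CD0 j : (1 - 'X) * S false j = (b j)%:R * (P j - P j.+1).
Proof.
elim: j => [|j IH].
  rewrite /S big_ord1 gb0 gb1 /gb_dim /gb_bin /= add0n binn.
  by rewrite addn0 mulrC mulr1.
rewrite gb_kernel0S mulrDr IH.
have := gb_rec R d j.+1 => /= e.
transitivity ((b j)%:R * (P j - P j.+1) + (r j.+1)%:R * P j.+1 - (r j.+1)%:R * ('X * P j.+1)).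
  by ring.
by rewrite e /gb_dim /= natrD; ring.
Qed.

(** [S true j] is twice the sum of r_i P_i over the i <= j of the parity of j, hence the induction
    by steps of two. On the right, P_j and t P_(j+1) are both orthogonal to all degrees below j. *)
Lemma gb_kernel_CD1 j :
  (1 - 'X^2) * S true j = 2%:R * (b j)%:R * (P j - 'X * P j.+1).
Proof.
suff : (1 - 'X^2) * S true j = 2%:R * (b j)%:R * (P j - 'X * P j.+1) /\
       (1 - 'X^2) * S true j.+1 = 2%:R * (b j.+1)%:R * (P j.+1 - 'X * P j.+2) by case.
elim: j => [|j [IH1 IH2]].
  have e : (r 1)%:R * ('X * P 1) = (b 1)%:R * P 2 + (b 0)%:R * P 0 by rewrite gb_rec.
  have b0 : b 0 = 1%N by rewrite /gb_bin add0n binn.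
  have r1 : r 1 = (b 1 + 1)%N by rewrite /gb_dim /= b0.
  rewrite /= gb1 gb0 b0; split; first by ring.
  transitivity (2%:R * (b 1)%:R * 'X - 2%:R * 'X * ((r 1)%:R * ('X * P 1) - 1)).
    by rewrite gb1 r1 natrM natrD; ring.
  by rewrite e b0 gb0; ring.
split=> //; rewrite gb_kernel1S mulrDr IH1.
have e1 : (r j.+1)%:R * ('X * P j.+1) = (b j.+1)%:R * P j.+2 + (b j)%:R * P j by rewrite gb_rec.
have e2 : (r j.+2)%:R * ('X * P j.+2) = (b j.+2)%:R * P j.+3 + (b j.+1)%:R * P j.+1 by rewrite gb_rec.
have e3 : (b j)%:R * P j = (r j.+1)%:R * ('X * P j.+1) - (b j.+1)%:R * P j.+2.
  by rewrite e1 addrC addKr.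
have e4 : (b j.+2)%:R * P j.+3 = (r j.+2)%:R * ('X * P j.+2) - (b j.+1)%:R * P j.+1.
  by rewrite e2 addrK.
transitivity (2%:R * ((b j)%:R * P j) - 2%:R * (b j)%:R * 'X * P j.+1 +
   (1 - 'X^2) * ((2 * r j.+2)%:R * P j.+2)); first by ring.
transitivity (2%:R * (b j.+2)%:R * P j.+2 - 2%:R * 'X * ((b j.+2)%:R * P j.+3)); last by ring.
have rD i : (r i.+1)%:R = (b i.+1)%:R + (b i)%:R :> {poly R} by rewrite -natrD.
by rewrite e3 e4 natrM !rD; ring.
Qed.

Lemma size_gb_kernel eps j : size (S eps j) = j.+1 /\ 0 < lead_coef (S eps j).
Proof.
have nz k : (0 < k)%N -> (k%:R != 0 :> R) by rewrite pnatr_eq0 -lt0n.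
have szP k i : (0 < k)%N ->
    size ((k%:R : {poly R}) * P i) = i.+1 /\ 0 < lead_coef ((k%:R : {poly R}) * P i).
  move=> k0; have [s l] := size_gb R d i.
  rewrite -polyC_natr mul_polyC size_scale ?nz// lead_coefZ; split=> //.
  by rewrite mulr_gt0// ltr0n.
have add q k i : (0 < k)%N -> (size q <= i)%N ->
    size (q + (k%:R : {poly R}) * P i) = i.+1 /\
    0 < lead_coef (q + (k%:R : {poly R}) * P i).
  move=> k0 sq; have [s l] := szP k i k0.
  by rewrite addrC size_polyDl ?lead_coefDl ?s.
case: eps.
  suff : (size (S true j) = j.+1 /\ 0 < lead_coef (S true j)) /\
         (size (S true j.+1) = j.+2 /\ 0 < lead_coef (S true j.+1)) by case.
  elim: j => [|j [[s1 l1] [s2 l2]]].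
    split; last by have := szP (2 * r 1)%N 1%N; rewrite gb1; apply; rewrite muln_gt0 gb_dim_gt0.
    by have := szP 2%N 0%N isT; rewrite gb0 mulr1.
  split=> //; rewrite gb_kernel1S; apply: add; first by rewrite muln_gt0 gb_dim_gt0.
  by rewrite s1.
elim: j => [|j [s1 l1]].
  by rewrite /S big_ord1; apply: szP; exact: gb_dim_gt0.
by rewrite gb_kernel0S; apply: add; rewrite ?s1 ?gb_dim_gt0.
Qed.

Lemma horner1_gb_kernel eps j : (S eps j).[1] = (D eps j)%:R.
Proof.
have hP k i : ((k%:R : {poly R}) * P i).[1] = k%:R.
  by rewrite -polyC_natr hornerM hornerC horner1_gb mulr1.
case: eps; last first.
  by rewrite /S /D natr_sum horner_sum; apply: eq_bigr => i _; rewrite hP.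
suff : (S true j).[1] = (D true j)%:R /\ (S true j.+1).[1] = (D true j.+1)%:R by case.
have b0 : b 0 = 1%N by rewrite /gb_bin add0n binn.
elim: j => [|j [IH1 IH2]].
  have := hP 2%N 0%N; rewrite gb0 mulr1 => h0.
  have := hP (2 * r 1)%N 1%N; rewrite gb1 => h1.
  rewrite /= h0 h1 /D big_ord1 2!big_ord_recr big_ord0 /= /gb_dim /= b0; split=> //.
  by congr _%:R; lia.
split=> //; rewrite gb_kernel1S hornerD IH1 hP -natrD; congr _%:R.
by rewrite 2!gb_totalS /gb_dim /=; lia.
Qed.

Lemma gb_total0E j : D false j = ('C(j + d.+1, d.+1) + 'C(j + d, d.+1))%N.
Proof.
elim: j => [|j IH].
  by rewrite /D big_ord1 /gb_dim /gb_bin /= !add0n !binn bin_small.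
rewrite gb_totalS IH /gb_dim /= /gb_bin.
by rewrite !addSn !binS !addnS !binS; lia.
Qed.

Lemma gb_total1E j : D true j = (2 * 'C(j + d.+1, d.+1))%N.
Proof.
elim: j => [|j IH]; first by rewrite /D big_ord1 /gb_bin !add0n !binn.
rewrite gb_totalS IH /gb_bin -mulnDr.
by rewrite [in RHS]addSn binS addSnnS.
Qed.

Lemma gb_total_gt0 eps j : (0 < D eps j)%N.
Proof.
by case: eps; rewrite ?gb_total0E ?gb_total1E ?addn_gt0 ?muln_gt0 bin_gt0 leq_addl.
Qed.

Section Functional.
Variable L : {poly R} -> R.
Hypothesis HL : gb_functional d L.

Let LD := gbfD HL.
Let LZ := gbfZ HL.
Let Lnat := functional_nat LZ.

(** [gbf_ge0] alone is not strict; strictness comes from Parseval's identity, since a nonzero q has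
    a nonzero coefficient. *)
Lemma functional_sqr_gt0 q : q != 0 -> 0 < L (q * q).
Proof.
move=> q0; have qE := gb_expand HL (leqnn (size q)).
have E : L (q * q) = \sum_(i < size q) (r i)%:R * L (q * P i) ^+ 2.
  rewrite {2}qE mulr_sumr (functional_sum LD LZ); apply: eq_bigr => i _.
  by rewrite -scalerAr LZ expr2 mulrA.
have t0 (i : 'I_(size q)) : 0 <= (r i)%:R * L (q * P i) ^+ 2 by rewrite mulr_ge0 ?sqr_ge0.
rewrite lt_def E sumr_ge0// andbT; apply: contra q0; rewrite psumr_eq0// => /allP h.
apply/eqP; rewrite qE big1// => i _.
have /eqP := h i (mem_index_enum _).
by move=> /eqP; rewrite mulf_eq0 sqrf_eq0 pnatr_eq0 eqn0Ngt gb_dim_gt0 /= => /eqP ->; rewrite mulr0 scale0r.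
Qed.

(** Since 0 <= g <= 2, (g q)^2 <= 2 g q^2 pointwise, which reduces the weighted case to the
    unweighted one for g q. *)
Lemma functional_weighted_gt0 g q : g != 0 -> q != 0 ->
  (forall t, -1 <= t <= 1 -> 0 <= g.[t] <= 2) -> 0 < L (g * (q * q)).
Proof.
move=> g0 q0 hg.
have h1 := functional_sqr_gt0 (mulf_neq0 g0 q0).
suff : L (g * q * (g * q)) <= 2 * L (g * (q * q)).
  by move=> h2; have := lt_le_trans h1 h2; rewrite pmulr_rgt0.
rewrite -subr_ge0 -(functionalC LZ) -(functionalB LD LZ); apply: (gbf_ge0 HL) => t ht.
have /andP[h3 h4] := hg t ht.
rewrite !(hornerD, hornerN, hornerM, hornerC); move: (g.[t]) (q.[t]) h3 h4 => x y h3 h4.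
have -> : 2 * (x * (y * y)) - x * y * (x * y) = (x * (2 - x)) * y ^+ 2 by ring.
by rewrite mulr_ge0 ?sqr_ge0// mulr_ge0// subr_ge0.
Qed.

Lemma gb_kernel_orth eps j q : (size q <= j)%N ->
  L ((1 + 'X) ^+ eps * ((1 - 'X) * S eps j * q)) = 0.
Proof.
move=> sq; case: eps.
  have -> : (1 + 'X) ^+ true * ((1 - 'X) * S true j * q) =
      (2 * b j)%:R * (P j * q - P j.+1 * ('X * q)).
    rewrite expr1.
    transitivity ((1 - 'X^2) * S true j * q); first by ring.
    by rewrite gb_kernel_CD1 natrM; ring.
  rewrite Lnat (functionalB LD LZ) !(gb_orth HL) ?subr0 ?mulr0//.
  have [->|q0] := eqVneq q 0; first by rewrite mulr0 size_poly0.
  by rewrite mulrC size_mulX.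
rewrite expr0 mul1r gb_kernel_CD0 -mulrA Lnat mulrBl (functionalB LD LZ).
by rewrite !(gb_orth HL) ?subr0 ?mulr0// ltnW.
Qed.

Lemma functional_gb_kernel eps j : L ((1 + 'X) ^+ eps * S eps j) = 2 ^+ eps.
Proof.
have r0 : r 0 = 1%N by rewrite /gb_dim /gb_bin add0n binn.
have LP0 i : (0 < i)%N -> L (P i) = 0 by case: i => // i _; exact: functional_gb.
case: eps; last first.
  rewrite !expr0 mul1r (functional_sum LD LZ) big_ord_recl big1 ?addr0.
    by rewrite r0 mul1r gb0 (gbf1 HL).
  by move=> i _; rewrite Lnat LP0 ?mulr0.
rewrite !expr1 mulrDl mul1r.
suff : L (S true j + 'X * S true j) = 2 /\ L (S true j.+1 + 'X * S true j.+1) = 2 by case.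
have LX : L 'X = 0 by rewrite -(gb1 R d) LP0.
elim: j => [|j [IH1 IH2]].
  have E0 : S true 0 + 'X * S true 0 = 2%:R * 1 + 2%:R * 'X by rewrite /=; ring.
  have E1 : S true 1 + 'X * S true 1 = (2 * r 1)%:R * 'X + (2 * r 1)%:R * ('X * 'X).
    by rewrite /=; ring.
  have h : (r 1)%:R * L ('X * 'X) = 1 by have := gb_norm HL 1%N; rewrite gb1.
  rewrite E0 E1 !LD !Lnat (gbf1 HL) LX natrM -!mulrA h.
  by split; ring.
split=> //; rewrite gb_kernel1S mulrDr addrACA LD IH1 LD Lnat LP0// mulr0 add0r.
by rewrite mulrCA Lnat mulrC (mulrC 'X) (gb_orth HL) ?size_polyX// mul0r addr0.
Qed.

Lemma posdef_gb_kernel eps j : posdef d L (S eps j).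
Proof.
have pP k i : posdef d L ((k%:R : {poly R}) * P i).
  by rewrite -polyC_natr mul_polyC; apply: posdefZ => //; exact: posdef_gb.
case: eps; last by apply: posdef_sum => // i _.
suff : posdef d L (S true j) /\ posdef d L (S true j.+1) by case.
elim: j => [|j [IH1 IH2]].
  split; last by have := pP (2 * r 1)%N 1%N; rewrite gb1.
  by have := pP 2%N 0%N; rewrite gb0 mulr1.
by split=> //; rewrite gb_kernel1S; apply: posdefD.
Qed.

(** In q = q(1) + (1 - t) u the second term is killed by the orthogonality of S for the weight (1 -
    t)(1 + t)^eps. *)
Lemma gb_kernel_reproducing eps j q : (size q <= j.+1)%N ->
  L ((1 + 'X) ^+ eps * (S eps j * q)) = 2 ^+ eps * q.[1].
Proof.
move=> sq.
have [u su qE] := poly_split1 sq.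
rewrite {1}qE.
have -> : (1 + 'X) ^+ eps * (S eps j * (q.[1]%:P + (1 - 'X) * u)) =
  q.[1]%:P * ((1 + 'X) ^+ eps * S eps j) + (1 + 'X) ^+ eps * ((1 - 'X) * S eps j * u).
  by move: (_ ^+ eps) (_%:P) => x y; ring.
by rewrite LD gb_kernel_orth// addr0 (functionalC LZ) functional_gb_kernel mulrC.
Qed.

(** Cauchy-Schwarz for the reproducing kernel, obtained by expanding the square of D q - q(1) S;
    equality holds for q = S. *)
Lemma gb_extremal eps j q : (size q <= j.+1)%N ->
  2 ^+ eps * q.[1] ^+ 2 <= (D eps j)%:R * L ((1 + 'X) ^+ eps * (q * q)).
Proof.
move=> sq; set D' := (D eps j)%:R.
have D0 : 0 < D' by rewrite ltr0n gb_total_gt0.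
pose u := D'%:P * q - q.[1]%:P * S eps j.
have : 0 <= L ((1 + 'X) ^+ eps * (u * u)).
  apply: (gbf_ge0 HL) => t /andP[t1 t2].
  rewrite !hornerM horner_exp hornerD hornerC hornerX mulr_ge0 ?exprn_ge0 -?expr2 ?sqr_ge0//; lra.
have [sS _] := size_gb_kernel eps j.
have -> : (1 + 'X) ^+ eps * (u * u) =
   (D' ^+ 2)%:P * ((1 + 'X) ^+ eps * (q * q)) -
   (2 * D' * q.[1])%:P * ((1 + 'X) ^+ eps * (S eps j * q)) +
   (q.[1] ^+ 2)%:P * ((1 + 'X) ^+ eps * (S eps j * S eps j)).
  rewrite /u !expr2 !polyCM; move: (_ ^+ eps) (_.[1]%:P) (D'%:P) => x y z.
  rewrite (_ : 2%:P = 2%:R); last by rewrite polyC_natr.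
  by ring.
rewrite LD (functionalB LD LZ) !(functionalC LZ) !gb_kernel_reproducing ?sS//.
rewrite horner1_gb_kernel -/D' => h.
have : 0 <= D' * (D' * L ((1 + 'X) ^+ eps * (q * q)) - 2 ^+ eps * q.[1] ^+ 2).
  by move: h; set z := L _; set w := 2 ^+ eps; lra.
by rewrite pmulr_rge0// subr_ge0.
Qed.

End Functional.
End ChristoffelDarboux.

(** * Newton interpolation and partial products *)

Section PartialProducts.
Variable R : realFieldType.
Implicit Types (f p q : {poly R}) (rs : seq R) (tau : R -> R).

Definition root_prod rs : {poly R} := \prod_(x <- rs) ('X - x%:P).

Definition node_sum tau rs f : R := \sum_(x <- rs) tau x * f.[x].

Lemma size_root_prod rs : size (root_prod rs) = (size rs).+1.
Proof. exact: size_prod_XsubC. Qed.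

Lemma root_prod_cons x rs : root_prod (x :: rs) = ('X - x%:P) * root_prod rs.
Proof. exact: big_cons. Qed.

Lemma horner_root_prod0 rs x : x \in rs -> (root_prod rs).[x] = 0.
Proof. by move=> xs; apply/eqP; rewrite -/(root _ _) root_prod_XsubC. Qed.

Lemma node_sumD tau rs f q : node_sum tau rs (f + q) = node_sum tau rs f + node_sum tau rs q.
Proof. by rewrite -big_split; apply: eq_bigr => x _; rewrite hornerD mulrDr. Qed.

Lemma node_sumZ tau rs a f : node_sum tau rs (a *: f) = a * node_sum tau rs f.
Proof. by rewrite mulr_sumr; apply: eq_bigr => x _; rewrite hornerZ mulrCA. Qed.

Lemma node_sum_sqr_ge0 tau rs f : (forall x, x \in rs -> 0 < tau x) ->
  0 <= node_sum tau rs (f * f).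
Proof.
move=> tau0; rewrite /node_sum big_seq; apply: sumr_ge0 => x xs.
by rewrite hornerM -expr2 mulr_ge0 ?sqr_ge0// ltW// tau0.
Qed.

Lemma node_sum_sqr_eq0 tau rs f : uniq rs -> (forall x, x \in rs -> 0 < tau x) ->
  (size f <= size rs)%N -> node_sum tau rs (f * f) = 0 -> f = 0.
Proof.
move=> us tau0 sf s0; apply: (@roots_geq_poly_eq0 _ f rs) => //.
apply/allP => x xs; move/eqP: s0; rewrite /node_sum big_seq psumr_eq0.
  move=> /allP /(_ x xs); rewrite xs /= mulf_eq0 gt_eqF ?tau0//=.
  by rewrite hornerM mulf_eq0 orbb.
by move=> y ys; rewrite hornerM -expr2 mulr_ge0 ?sqr_ge0// ltW// tau0.
Qed.

(* Removing the smallest node x and multiplying the weights by t - x, the new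
   orthogonal polynomials are q_j = (p_(j+1) + kappa_j p_j) / (t - x), and each
   p_j is a nonnegative combination of q_j and q_(j-1). *)
Lemma node_sum_partial_prod_ge0 tau rs (p : nat -> {poly R}) :
  sorted <%R rs -> (forall x, x \in rs -> 0 < tau x) ->
  (forall j, (j <= size rs)%N -> [/\ size (p j) = j.+1, 0 < lead_coef (p j) &
     forall q, (size q <= j)%N -> node_sum tau rs (p j * q) = 0]) ->
  forall j i, (j <= size rs)%N -> 0 <= node_sum tau rs (p j * root_prod (take i rs)).
Proof.
elim: rs tau p => [|x rs IH] tau p; first by move=> *; rewrite /node_sum big_nil.
move=> srs tau0 hp j i; rewrite leq_eqVlt => /predU1P[->|jn].
  have us : uniq (x :: rs) by exact: sorted_uniq lt_trans (@ltxx _ _) _ srs.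
  have [sp lp op] := hp _ (leqnn (size (x :: rs))).
  (* The last polynomial is orthogonal to the product of all t - z with z a node other than y, so
     its value at y is zero. *)
  suff h y : y \in x :: rs -> (p (size (x :: rs))).[y] = 0.
    by rewrite /node_sum big_seq big1// => y ys; rewrite hornerM h// mul0r mulr0.
  move=> ys; pose q := root_prod (rem y (x :: rs)).
  have sq : (size q <= size (x :: rs))%N by rewrite size_root_prod size_rem.
  have := op q sq; rewrite /node_sum (big_rem y)//= big_seq big1 ?addr0.
    rewrite hornerM => /eqP; rewrite !mulf_eq0 gt_eqF ?tau0//=.
    have -> : (q.[y] == 0) = false.
      by rewrite -/(root q y) root_prod_XsubC mem_rem_uniqF.
    by rewrite orbF => /eqP.
  by move=> z zs; rewrite hornerM (horner_root_prod0 zs) !mulr0.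
have us : uniq (x :: rs) by exact: sorted_uniq lt_trans (@ltxx _ _) _ srs.
have /andP[xrs urs] := us.
have ltx y : y \in rs -> x < y.
  by move=> ys; have := order_path_min lt_trans srs => /allP; apply.
have {jn} jn : (j <= size rs)%N by [].
have hp1 k : (k <= size rs)%N -> [/\ size (p k) = k.+1, 0 < lead_coef (p k) &
     forall q, (size q <= k)%N -> node_sum tau (x :: rs) (p k * q) = 0].
  by move=> kn; apply: hp; apply: leqW.
case: i => [|i].
  rewrite take0 /root_prod big_nil; have [sp lp op] := hp1 j jn.
  case: j => [|j] in jn sp lp op *; last by rewrite op// size_poly1.
  have [c pc] : exists c, p 0%N = c%:P.
    by exists (p 0%N)`_0; apply: size1_polyC; rewrite sp.
  rewrite mulr1 /node_sum big_seq; apply: sumr_ge0 => y ys.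
  by move: lp; rewrite pc hornerC lead_coefC => c0; rewrite mulr_ge0// ltW// tau0.
rewrite /= root_prod_cons.
pose tau1 y := tau y * (y - x).
have tau1_gt0 y : y \in rs -> 0 < tau1 y.
  by move=> ys; rewrite mulr_gt0 ?subr_gt0 ?ltx// tau0// inE ys orbT.
have W1 f : node_sum tau (x :: rs) (('X - x%:P) * f) = node_sum tau1 rs f.
  rewrite /node_sum big_cons hornerM hornerXsubC subrr mul0r mulr0 add0r.
  by apply: eq_bigr => y _; rewrite hornerM hornerXsubC mulrA.
(* If p_k(x) = 0, then u = p_k / (t - x) has degree below k, and the orthogonality of p_k to u says
   that u has norm zero for the new positive weights. *)
have px k : (k <= size rs)%N -> (p k).[x] != 0.
  move=> kn; have [sp lp op] := hp1 k kn; apply/negP => /factor_theorem [u uE].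
  have p0 : p k != 0 by rewrite -size_poly_eq0 sp.
  have u0 : u != 0 by apply: contraNneq p0 => u0; rewrite uE u0 mul0r.
  have su : size u = k.
    by apply: succn_inj; rewrite -sp uE size_Mmonic ?monicXsubC// size_XsubC addn2.
  have := op u; rewrite su leqnn uE mulrAC mulrC W1 => /(_ isT) s0.
  have u00 : u = 0 by apply: (node_sum_sqr_eq0 urs tau1_gt0 _ s0); rewrite su.
  by rewrite u00 eqxx in u0.
pose kap k := - (p k.+1).[x] / (p k).[x].
pose q k := (p k.+1 + kap k *: p k) %/ ('X - x%:P).
have qE k : (k <= size rs)%N -> q k * ('X - x%:P) = p k.+1 + kap k *: p k.
  move=> kn; apply: divpK; rewrite dvdp_XsubCl /root hornerD hornerZ /kap.
  by rewrite mulfVK ?px// subrr.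
have hq k : (k <= size rs)%N -> [/\ size (q k) = k.+1, 0 < lead_coef (q k) &
    forall f, (size f <= k)%N -> node_sum tau1 rs (q k * f) = 0].
  move=> kn; have [sp lp op] := hp1 k kn.
  have [sp1 lp1 op1] : [/\ size (p k.+1) = k.+2, 0 < lead_coef (p k.+1) &
     forall q, (size q <= k.+1)%N -> node_sum tau (x :: rs) (p k.+1 * q) = 0] by apply: hp.
  have szk : (size (kap k *: p k) < size (p k.+1))%N.
    by rewrite sp1 ltnS; apply: leq_trans (size_scale_leq _ _) _; rewrite sp.
  have q0 : q k != 0.
    apply/eqP => q0; have := qE k kn; rewrite q0 mul0r => e.
    by have := size_polyDl szk; rewrite -e size_poly0 sp1.
  split.
  - apply: succn_inj; rewrite -sp1 -(size_polyDl szk) -qE//.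
    by rewrite size_Mmonic ?monicXsubC// size_XsubC addn2.
  - by rewrite -(@lead_coef_Mmonic _ (q k) ('X - x%:P)) ?monicXsubC// qE// lead_coefDl.
  - move=> f sf; rewrite -W1 mulrA [('X - _) * _]mulrC qE// mulrDl -scalerAl.
    by rewrite node_sumD node_sumZ op// op1 ?mulr0 ?addr0// leqW.
have {}IH k l : (k <= size rs)%N -> 0 <= node_sum tau1 rs (q k * root_prod (take l rs)).
  apply: (IH tau1 q) => //; exact: path_sorted srs.
rewrite mulrCA W1.
have [sp lp op] := hp1 j jn; have [sq lq oq] := hq j jn.
pose a := lead_coef (p j) / lead_coef (q j).
have a0 : 0 < a by rewrite divr_gt0.
pose E := p j - a *: q j.
have pE : p j = a *: q j + E by rewrite addrC subrK.
have sE : (size E <= j)%N.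
  apply/leq_sizeP => k; rewrite leq_eqVlt => /predU1P[<-|jk].
    have e1 : (p j)`_j = lead_coef (p j) by rewrite lead_coefE sp.
    have e : (q j)`_j = lead_coef (q j) by rewrite lead_coefE sq.
    by rewrite coefB coefZ e e1 /a mulfVK ?gt_eqF// subrr.
  by rewrite coefB coefZ !nth_default ?mulr0 ?subrr ?sp ?sq.
have EE : E = p j - a *: q j by [].
clearbody E a.
rewrite pE mulrDl -scalerAl node_sumD node_sumZ.
apply: addr_ge0; first by apply: mulr_ge0; [exact: ltW|exact: IH].
case: j => [|j] in jn sp lp op sq lq oq a0 pE sE EE *.
  suff -> : E = 0 by rewrite mul0r /node_sum big1// => y _; rewrite horner0 mulr0.
  by apply/eqP; rewrite -size_poly_eq0 -leqn0.
have jn' : (j <= size rs)%N by apply: ltnW.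
have [sq' lq' oq'] := hq j jn'.
pose y := E`_j / lead_coef (q j).
have EO f : (size f <= j)%N -> node_sum tau1 rs (E * f) = 0.
  move=> sf.
  have -> : E * f = p j.+1 * f - a *: (q j.+1 * f) by rewrite EE mulrBl scalerAl.
  rewrite -scaleN1r node_sumD !node_sumZ oq 1?leqW// !mulr0 addr0 -W1 mulrCA.
  rewrite op//; have [->|f0] := eqVneq f 0; first by rewrite mulr0 size_poly0.
  by rewrite mulrC size_Mmonic ?monicXsubC// size_XsubC addn2.
have Ey : E = y *: q j.
  apply/eqP; rewrite -subr_eq0; apply/eqP.
  set G := E - _.
  have sG : (size G <= j)%N.
    apply/leq_sizeP => k; rewrite leq_eqVlt => /predU1P[<-|jk].
      have e : (q j)`_j = lead_coef (q j) by rewrite lead_coefE sq'.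
      by rewrite coefB coefZ e /y mulfVK ?gt_eqF// subrr.
    by rewrite coefB coefZ !nth_default ?mulr0 ?subrr ?sq'//; exact: leq_trans sE _.
  apply: (node_sum_sqr_eq0 urs tau1_gt0); first exact: leq_trans sG _.
  have -> : G * G = E * G + (- y) *: (q j * G) by rewrite {1}/G mulrBl scaleNr scalerAl.
  by rewrite node_sumD node_sumZ EO// oq'// mulr0 addr0.
(* As (t - x) q_j = p_(j+1) + kappa_j p_j, y times the squared norm of q_j for the new weights is
   the squared norm of p_(j+1) for the old ones. *)
have y0 : 0 <= y.
  have q0 : 0 < node_sum tau1 rs (q j * q j).
    rewrite lt_def node_sum_sqr_ge0// andbT; apply/eqP => s0.
    have : q j = 0 by apply: (node_sum_sqr_eq0 urs tau1_gt0 _ s0); rewrite sq'.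
    by move=> q0; rewrite q0 size_poly0 in sq'.
  suff : 0 <= y * node_sum tau1 rs (q j * q j) by rewrite pmulr_lge0.
  rewrite -node_sumZ scalerAl -Ey.
  have -> : E * q j = p j.+1 * q j + (- a) *: (q j.+1 * q j).
    by rewrite EE mulrBl scaleNr scalerAl.
  rewrite node_sumD node_sumZ oq ?sq'// mulr0 addr0 -W1 mulrCA [_ * q j]mulrC qE//.
  rewrite mulrDr node_sumD -scalerAr node_sumZ (op (p j)); last by have [-> _ _] := hp1 j jn'.
  by rewrite mulr0 addr0 node_sum_sqr_ge0.
by rewrite Ey -scalerAl node_sumZ mulr_ge0// IH.
Qed.

End PartialProducts.

(** * Newton interpolation with nonnegative divided differences *)

Section NewtonInterpolation.
Variable R : realFieldType.
Implicit Types (f p q u T : {poly R}) (zs bs : seq R).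

(** Nonnegative coefficients in powers of t + 1: the polynomial form of absolute monotonicity from
    -1 on. *)
Definition shift_nneg T : Prop :=
  exists2 u : {poly R}, (forall i, 0 <= u`_i) & T = u \Po ('X + 1).

Lemma shift_nneg_horner T t : shift_nneg T -> -1 <= t -> 0 <= T.[t].
Proof.
move=> [u u0 ->] t1; rewrite horner_comp hornerD hornerX hornerC horner_coef.
by apply: sumr_ge0 => i _; rewrite mulr_ge0// exprn_ge0// -lerBlDr sub0r.
Qed.

(** Horner's scheme: the coefficients of the divided difference arise from those of u by additions
    and multiplications by a >= 0. *)
Let nneg_divided u (a : R) : (forall i, 0 <= u`_i) -> 0 <= a ->
  exists2 v : {poly R}, (forall i, 0 <= v`_i) & u = u.[a]%:P + ('X - a%:P) * v.
Proof.
move=> + a0; elim/poly_ind: u => [|u c IH] uc.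
  by exists 0; [move=> i; rewrite coef0|rewrite horner0 mulr0 addr0].
have u0 i : 0 <= u`_i.
  by have := uc i.+1; rewrite coefD coefMX coefC /= addr0.
have [v v0 vE] := IH u0.
have ua : 0 <= u.[a].
  by rewrite horner_coef; apply: sumr_ge0 => i _; rewrite mulr_ge0// exprn_ge0.
exists (u + a *: v) => [i|].
  by rewrite coefD coefZ addr_ge0// mulr_ge0.
rewrite hornerD hornerM hornerX hornerC polyCD polyCM -mul_polyC {1}vE.
rewrite {3}vE; move: (_.[a]%:P) (a%:P) (c%:P) => x y z; ring.
Qed.

Lemma shift_nneg_divided T a : shift_nneg T -> -1 <= a ->
  exists2 T', shift_nneg T' & T = T.[a]%:P + ('X - a%:P) * T'.
Proof.
move=> [u u0 ->] a1; have a0 : 0 <= a + 1 by rewrite -lerBlDr sub0r.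
have [v v0 vE] := nneg_divided u0 a0.
exists (v \Po ('X + 1)); first by exists v.
rewrite horner_comp hornerD hornerX hornerC {1}vE.
rewrite comp_polyD comp_polyC comp_polyM comp_polyB comp_polyX comp_polyC polyCD.
by rewrite polyC1; congr (_ + _ * _); ring.
Qed.

(** In Newton's form H is a sum of divided differences times partial products. The former are
    nonnegative, so H lies in every convex cone [K] that contains the latter. The prefactor [c]
    collects the factors already consumed by the induction. *)
Lemma newton_nneg (K : {poly R} -> Prop) zs :
  K 0 -> (forall p q, K p -> K q -> K (p + q)) ->
  (forall a p, 0 <= a -> K p -> K (a *: p)) ->
  all (>= -1) zs ->
  forall c T, shift_nneg T ->
  (forall j, (j < size zs)%N -> K (c * root_prod (take j zs))) ->
  exists H Q, [/\ T = H + root_prod zs * Q, shift_nneg Q, K (c * H) &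
                  (size H <= size zs)%N].
Proof.
move=> K0 KD KZ; elim: zs => [|z zs IH] /= zs1 c T nT Kc.
  exists 0, T; rewrite /root_prod big_nil mul1r add0r mulr0 size_poly0.
  by split.
have /andP[z1 {}zs1] := zs1.
have [T' nT' TE] := shift_nneg_divided nT z1.
have [|H [Q [T'E nQ KH sH]]] := IH zs1 (c * ('X - z%:P)) T' nT'.
  by move=> j jn; have := Kc j.+1 jn; rewrite /= root_prod_cons mulrA.
exists (T.[z]%:P + ('X - z%:P) * H), Q; split=> //.
- rewrite {1}TE T'E root_prod_cons.
  move: (_.[z]%:P) (z%:P) => a b; ring.
- rewrite mulrDr mulrA; apply: KD => //; rewrite mulrC mul_polyC.
  apply: KZ; first exact: shift_nneg_horner.
  by have := Kc 0%N isT; rewrite take0 /root_prod big_nil mulr1.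
- apply: leq_trans (size_polyD _ _) _; rewrite geq_max.
  rewrite (leq_trans (size_polyC_leq1 _))//=.
  apply: leq_trans (size_polyMleq _ _) _; rewrite size_XsubC; lia.
Qed.

(** The copies are adjacent so that each partial product is a product of two partial products of
    [bs], see [root_prod_take_dup]. *)
Definition dup_seq bs : seq R := flatten [seq [:: x; x] | x <- bs].

Lemma size_dup_seq bs : size (dup_seq bs) = (size bs).*2.
Proof. by elim: bs => //= x bs ->. Qed.

Lemma root_prod_dup bs : root_prod (dup_seq bs) = root_prod bs * root_prod bs.
Proof.
elim: bs => [|x bs IH]; first by rewrite /root_prod big_nil mulr1.
by rewrite /= !root_prod_cons IH; ring.
Qed.

Lemma root_prod_take_dup j bs : root_prod (take j (dup_seq bs)) =
  root_prod (take j./2 bs) * root_prod (take (uphalf j) bs).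
Proof.
have nil1 : root_prod [::] = 1 :> {poly R} by rewrite /root_prod big_nil.
elim/ltn_ind: j bs => -[|[|j]] IH [|x bs] /=; rewrite ?take0 ?nil1 ?mul1r//.
by rewrite !root_prod_cons IH//; ring.
Qed.

End NewtonInterpolation.

(** * The Levenshtein quadrature *)

Lemma size_polyM_deg (F : nzRingType) (p q : {poly F}) i j :
  (size p <= i.+1)%N -> (size q <= j.+1)%N -> (size (p * q)%R <= (i + j).+1)%N.
Proof. by move=> sp sq; apply: leq_trans (size_polyMleq p q) _; lia. Qed.

Section LevenshteinQuadrature.
Variables (R : realFieldType) (d : nat) (L : {poly R} -> R).
Hypothesis HL : gb_functional d L.
(** Here [k] is the k of the theorem minus 1, so m = 2k + 1 + eps; [bs] lists the k + 1 nodes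
    besides the node -1 present when eps = 1. [N_gt] and [N_le] read D(n, m) < N <= D(n, m+1), and
    [N_eq] is N = L_m(n, s). *)
Variables (N : R) (k : nat) (eps : bool) (bs : seq R) (s : R).

Let LD := gbfD HL.
Let LZ := gbfZ HL.
Let LB := functionalB LD LZ.
Let LC := functionalC LZ.

Notation b := (gb_bin d). Notation r := (gb_dim d).
Notation P := (@gb R d). Notation S := (@gb_kernel R d). Notation D := (gb_total d).
Notation B := (root_prod bs).

Hypothesis size_bs : size bs = k.+1.
Hypothesis sorted_bs : sorted <%R bs.
Hypothesis N_gt : (D (~~ eps) (k + eps))%:R < N.
Hypothesis N_le : N <= (D eps k.+1)%:R.
Hypothesis B_orth : forall u : {poly R}, (size u <= k)%N ->
  L ((1 + 'X) ^+ eps * ((1 - 'X) * B * u)) = 0.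
Hypothesis s_bs : s \in bs.
Hypothesis bs_neqN1 : eps -> -1 \notin bs.
Hypothesis N_eq : N = (D false (k + eps))%:R - (b (k + eps))%:R *
  ((1 + s) ^+ eps * ((P (k + eps)).[s] - (P (k.+1 + eps)).[s]) /
   ((1 - s) * (eps%:R * (P k.+1).[s] + (P (k.+1 + eps)).[s]))).

Local Arguments gb_total : simpl never.
Local Arguments gb_kernel : simpl never.

Let D_le1 : (D eps k <= D (~~ eps) (k + eps))%N.
Proof.
case: eps; rewrite /negb ?addn0 ?addn1 gb_total0E gb_total1E.
  by rewrite addSn binS addSnnS; lia.
by rewrite addnS binS; lia.
Qed.

Let D_le0 : (D false (k + eps) <= D (~~ eps) (k + eps))%N.
Proof.
case: eps; first exact: leqnn.
by rewrite /negb addn0 gb_total0E gb_total1E addnS binS; lia.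
Qed.

Let N_gt1 : (D eps k)%:R < N.
Proof. by apply: le_lt_trans N_gt; rewrite ler_nat. Qed.

Let N_gt0 : 0 < N.
Proof. by apply: le_lt_trans N_gt1; rewrite ler0n. Qed.

Let size_B : size B = k.+2. Proof. by rewrite size_root_prod size_bs. Qed.

Let onepX_bound (t : R) : -1 <= t <= 1 -> 0 <= (1 + t) ^+ eps <= 2.
Proof. by case: eps => /andP[? ?]; rewrite ?expr1 ?expr0; apply/andP; split; lra. Qed.

Let horner_wt (t : R) : ((1 + 'X) ^+ eps).[t] = (1 + t) ^+ eps.
Proof. by rewrite horner_exp hornerD hornerC hornerX. Qed.

Let onepX_neq0 : (1 + 'X) ^+ eps != 0 :> {poly R}.
Proof. by rewrite expf_neq0// addrC -size_poly_eq0 size_XaddC. Qed.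

Let onemX_neq0 : 1 - 'X != 0 :> {poly R}.
Proof. by rewrite -oppr_eq0 opprB -size_poly_eq0 size_XsubC. Qed.

Let wt_gt0 (q : {poly R}) : q != 0 -> 0 < L ((1 + 'X) ^+ eps * (q * q)).
Proof.
move=> q0; apply: (functional_weighted_gt0 HL) => // t ht.
by rewrite horner_wt onepX_bound.
Qed.

Let wt1_gt0 (q : {poly R}) : q != 0 -> 0 < L ((1 + 'X) ^+ eps * ((1 - 'X) * q * q)).
Proof.
move=> q0.
have -> : (1 + 'X) ^+ eps * ((1 - 'X) * q * q) = (1 + 'X) ^+ eps * (1 - 'X) * (q * q).
  by rewrite !mulrA.
apply: (functional_weighted_gt0 HL) => //; first exact: mulf_neq0.
move=> t /andP[t1 t2]; rewrite hornerM horner_wt hornerD hornerN hornerC hornerX.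
by case: eps; rewrite ?expr1 ?expr0; apply/andP; split; nra.
Qed.

(** [B] has degree k + 1 but is orthogonal only to degrees below k, so two consecutive orthogonal
    polynomials are required. What remains has degree below k and is orthogonal to itself. *)
Let decomposition : exists x y : R, 0 < x /\ B = x *: S eps k.+1 + y *: S eps k.
Proof.
have [sS lS] := size_gb_kernel R d eps k.+1.
have [sS' lS'] := size_gb_kernel R d eps k.
pose x := (lead_coef (S eps k.+1))^-1.
have x0 : 0 < x by rewrite invr_gt0.
have lB : lead_coef B = 1 by apply/monicP; exact: monic_prod_XsubC.
pose E := B - x *: S eps k.+1.
have sE : (size E <= k.+1)%N.
  apply/leq_sizeP => j; rewrite leq_eqVlt => /predU1P[<-|jk].
    have e1 : B`_k.+1 = 1 by rewrite -lB lead_coefE size_B.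
    have e2 : (S eps k.+1)`_k.+1 = lead_coef (S eps k.+1) by rewrite lead_coefE sS.
    by rewrite coefB coefZ e1 e2 mulVf ?subrr// gt_eqF.
  by rewrite coefB coefZ !nth_default ?mulr0 ?subrr ?size_B ?sS.
pose y := E`_k / lead_coef (S eps k).
exists x, y; split=> //; apply/eqP; rewrite -subr_eq0 opprD addrA -/E.
set G := E - _.
have sG : (size G <= k)%N.
  apply/leq_sizeP => j; rewrite leq_eqVlt => /predU1P[<-|jk].
    have e : (S eps k)`_k = lead_coef (S eps k) by rewrite lead_coefE sS'.
    by rewrite coefB coefZ e mulfVK ?subrr// gt_eqF.
  by rewrite coefB coefZ !nth_default ?mulr0 ?subrr ?sS'//; exact: leq_trans sE _.
apply: contraT => G0; have := wt1_gt0 G0.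
have -> : (1 + 'X) ^+ eps * ((1 - 'X) * G * G) =
   (1 + 'X) ^+ eps * ((1 - 'X) * B * G) -
   x%:P * ((1 + 'X) ^+ eps * ((1 - 'X) * S eps k.+1 * G)) -
   y%:P * ((1 + 'X) ^+ eps * ((1 - 'X) * S eps k * G)).
  rewrite {1}/G /E -!mul_polyC; move: (x%:P) (y%:P) (_ ^+ eps) (S _ _) (S _ _) => *; ring.
rewrite !LB !LC B_orth// !(gb_kernel_orth HL)//; last exact: leqW.
by rewrite !mulr0 !subr0 ltxx.
Qed.

(* N = L_m(n, s), together with B(s) = 0, says that N is the average of
   D eps k.+1 and D eps k with weights x and y. *)
Let levenshtein_mix x y : B = x *: S eps k.+1 + y *: S eps k ->
  N * (x + y) = x * (D eps k.+1)%:R + y * (D eps k)%:R.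
Proof.
move=> BE; have Bs : B.[s] = 0 by exact: horner_root_prod0.
(* With a zero denominator the quotient in [N_eq] is 0 by convention, and N would not exceed D(n,
   m). *)
have den0 : (1 - s) * (eps%:R * (P k.+1).[s] + (P (k.+1 + eps)).[s]) != 0.
  apply/negP => /eqP den0; move: N_gt; rewrite {1}N_eq den0 invr0 !mulr0 subr0.
  by apply/negP; rewrite -leNgt ler_nat.
move: Bs; rewrite BE hornerD !hornerZ => Bs.
have s1 : 1 - s != 0 by apply: contraNneq den0 => ->; rewrite mul0r.
case: eps N_eq den0 Bs bs_neqN1 => /= NE den0 Bs sN1.
- have sN : 1 + s != 0.
    apply: contraTneq s_bs => e; have -> : s = -1 by apply/eqP; rewrite -addr_eq0 addrC e.
    exact: sN1.
  move: NE den0; rewrite !expr1 mul1r !addn1 => NE den0.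
  have eP : (P k.+1).[s] + (P k.+2).[s] != 0 by apply: contraNneq den0 => ->; rewrite mulr0.
  have CD j : (1 - s ^+ 2) * (S true j).[s] = 2 * (b j)%:R * ((P j).[s] - s * (P j.+1).[s]).
    have := congr1 (fun p : {poly R} => p.[s]) (gb_kernel_CD1 R d j).
    by rewrite -!polyC_natr !(hornerM, hornerD, hornerN, hornerC, hornerX, hornerXn).
  have rec : (b k)%:R * ((P k).[s] - s * (P k.+1).[s]) =
             (b k.+1)%:R * (s * (P k.+1).[s] - (P k.+2).[s]).
    have := congr1 (fun p : {poly R} => p.[s]) (gb_rec R d k.+1).
    rewrite /= -!polyC_natr !(hornerM, hornerD, hornerN, hornerC, hornerX) /gb_dim natrD /=.
    lra.
  have b0 : (b k.+1)%:R != 0 :> R by rewrite pnatr_eq0 -lt0n gb_bin_gt0.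
  have key : x * ((P k.+1).[s] - s * (P k.+2).[s]) + y * (s * (P k.+1).[s] - (P k.+2).[s]) = 0.
    have e1 := CD k.+1; have e2 := CD k; rewrite -[RHS]mulrA rec in e2.
    apply: (mulfI b0); apply: (@mulfI _ 2); first by rewrite pnatr_eq0.
    have : (1 - s ^+ 2) * (x * (S true k.+1).[s] + y * (S true k).[s]) = 0 by rewrite Bs mulr0.
    rewrite mulrDr !(mulrCA (1 - s ^+ 2)) e1 e2 !mulr0 => <-; ring.
  have DS : (D true k.+1)%:R = (D true k)%:R + 2 * (b k.+1)%:R :> R.
    by rewrite gb_totalS natrD natrM.
  have D0 : (D false k.+1)%:R = (D true k)%:R + (b k.+1)%:R :> R.
    rewrite -natrD; congr _%:R; rewrite gb_total0E gb_total1E /gb_bin.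
    by rewrite addSn binS !addSnnS mul2n -addnn addnAC.
  rewrite NE DS D0; move: (_.[s]) (_.[s]) eP den0 key => v u eP den0 key.
  set Z := (1 + s) * _ / _.
  have ZE : (1 - s) * (u + v) * Z = (1 + s) * (u - v) by rewrite mulrC /Z mulfVK.
  suff ZE2 : (x + y) * Z = y - x.
    have : (b k.+1)%:R * ((x + y) * Z) = (b k.+1)%:R * (y - x) by rewrite ZE2.
    by move: ((b k.+1)%:R) ((D true k)%:R) => p q; lra.
  apply: (mulfI den0); rewrite mulrCA ZE.
  by move: key; lra.
- move: NE den0; rewrite !expr0 !mul1r mul0r add0r !addn0 => NE den0.
  have CD : (1 - s) * (S false k).[s] = (b k)%:R * ((P k).[s] - (P k.+1).[s]).
    have := congr1 (fun p : {poly R} => p.[s]) (gb_kernel_CD0 R d k).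
    by rewrite -!polyC_natr !(hornerM, hornerD, hornerN, hornerC, hornerX).
  have Pk0 : (P k.+1).[s] != 0 by apply: contraNneq den0 => ->; rewrite mulr0.
  have NE2 : N * (P k.+1).[s] = (D false k)%:R * (P k.+1).[s] - (S false k).[s].
    rewrite NE mulrBl; congr (_ - _); rewrite mulrA -CD; field; exact/andP.
  have SS : (S false k.+1).[s] = (S false k).[s] + (r k.+1)%:R * (P k.+1).[s].
    by rewrite gb_kernel0S hornerD -polyC_natr hornerM hornerC.
  have DS : (D false k.+1)%:R = (D false k)%:R + (r k.+1)%:R :> R by rewrite gb_totalS natrD.
  apply: (mulfI Pk0); rewrite DS mulrA [_ * N]mulrC NE2.
  by move: Bs; rewrite SS; lra.
Qed.

(** The functional f -> L f - f(1) / N kills the node polynomial itself and not only its multiples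
    by (1 - t) u given by [B_orth]; this gains the last degree of exactness, m. *)
Let functional_B : N * L ((1 + 'X) ^+ eps * B) = 2 ^+ eps * B.[1].
Proof.
have [x [y [x0 BE]]] := decomposition.
have E := levenshtein_mix BE.
have -> : (1 + 'X) ^+ eps * B = x%:P * ((1 + 'X) ^+ eps * S eps k.+1) +
    y%:P * ((1 + 'X) ^+ eps * S eps k).
  by rewrite BE -!mul_polyC; move: (x%:P) (y%:P) (_ ^+ eps) (S _ _) (S _ _) => *; ring.
rewrite LD !LC !(functional_gb_kernel HL) BE hornerD !hornerZ !horner1_gb_kernel -E; ring.
Qed.

(** By [levenshtein_mix], y (N - D(n, m-1)) = x (D(n, m+1) - N), so y >= 0 because N lies between
    the two. *)
Let posdef_B : posdef d L B.
Proof.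
have [x [y [x0 BE]]] := decomposition.
have E := levenshtein_mix BE.
have y0 : 0 <= y.
  have h1 : 0 < N - (D eps k)%:R by rewrite subr_gt0.
  rewrite -(pmulr_lge0 _ h1).
  have -> : y * (N - (D eps k)%:R) = x * ((D eps k.+1)%:R - N) by move: E; lra.
  by rewrite mulr_ge0 ?subr_ge0// ltW.
rewrite BE; apply: (posdefD HL); apply: (posdefZ HL); try exact: posdef_gb_kernel; lra.
Qed.

Definition node_seq : seq R := nseq eps (-1) ++ bs.

Notation G := (root_prod node_seq).

Definition node_weight (a : R) : R :=
  let l := root_prod (rem a node_seq) in (L l - l.[1] / N) / l.[a].

Notation rho := node_weight.

Let uniq_bs : uniq bs. Proof. exact: sorted_uniq lt_trans (@ltxx _ _) _ sorted_bs. Qed.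

Lemma uniq_node_seq : uniq node_seq.
Proof.
rewrite /node_seq; case: eps bs_neqN1 => //= h.
by rewrite h//= uniq_bs.
Qed.

Let G_eq : G = (1 + 'X) ^+ eps * B.
Proof.
rewrite /node_seq /root_prod big_cat /=; congr (_ * _); case: eps => /=.
  by rewrite big_seq1 polyCN opprK addrC expr1 polyC1.
by rewrite big_nil expr0.
Qed.

Let size_node_seq : size node_seq = (k.+1 + eps)%N.
Proof. by rewrite size_cat size_nseq size_bs addnC. Qed.

Let lagrange (f : {poly R}) : (size f <= size node_seq)%N ->
  f = \sum_(a <- node_seq) (f.[a] / (root_prod (rem a node_seq)).[a]) *: root_prod (rem a node_seq).
Proof.
move=> sf; apply/eqP; rewrite -subr_eq0; apply/eqP.
apply: (@roots_geq_poly_eq0 _ _ node_seq); last 2 first.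
- exact: uniq_node_seq.
- apply: leq_trans (size_polyD _ _) _; rewrite geq_max sf size_polyN.
  apply: leq_trans (size_sum _ _ _) _; apply/bigmax_leqP_seq => a aal _.
  apply: leq_trans (size_scale_leq _ _) _.
  by rewrite size_root_prod size_rem// prednK// size_node_seq.
apply/allP => c cal; rewrite /root hornerD hornerN horner_sum.
rewrite (big_rem c cal) /= hornerZ mulfVK; last first.
  by rewrite -/(root _ _) root_prod_XsubC mem_rem_uniqF ?uniq_node_seq.
rewrite big_seq big1 ?addr0 ?subrr// => a.
rewrite mem_rem_uniq ?uniq_node_seq// inE => /andP[ac aal].
rewrite hornerZ [X in _ * X]horner_root_prod0 ?mulr0//; rewrite mem_rem_uniq ?uniq_node_seq//.
by rewrite inE eq_sym ac.
Qed.

(** As for Gauss quadrature, f is divided by the node polynomial. The quotient has degree at most k;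
    split at 1, it is handled by [functional_B] and [B_orth]. The remainder is its own Lagrange
    interpolant. *)
Lemma levenshtein_quadrature (f : {poly R}) : (size f <= k.+1.*2 + eps)%N ->
  L f = f.[1] / N + \sum_(a <- node_seq) rho a * f.[a].
Proof.
move=> sf; pose M p := L p - p.[1] / N.
have MD p q : M (p + q) = M p + M q by rewrite /M LD hornerD mulrDl; ring.
have MZ c p : M (c *: p) = c * M p by rewrite /M LZ hornerZ; ring.
suff : M f = \sum_(a <- node_seq) rho a * f.[a] by move=> <-; rewrite /M addrC subrK.
have sG : size G = (k.+2 + eps)%N by rewrite size_root_prod size_node_seq.
have G0 : G != 0 by rewrite -size_poly_eq0 sG.
have fE := divp_eq f G.
have su : (size (f %/ G)%R <= k.+1)%N.
  by rewrite size_divp// sG leq_subLR; apply: leq_trans sf _; rewrite -addnn addnAC.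
have [u' su' uE] := poly_split1 su.
have MG : M (f %/ G * G) = 0.
  rewrite /M hornerM {1}uE.
  have -> : ((f %/ G).[1]%:P + (1 - 'X) * u') * G =
      (f %/ G).[1]%:P * ((1 + 'X) ^+ eps * B) + (1 + 'X) ^+ eps * ((1 - 'X) * B * u').
    by rewrite [X in _ * X]G_eq mulrDl; congr (_ + _); rewrite mulrCA; congr (_ * _); rewrite mulrAC.
  rewrite LD B_orth// addr0 LC G_eq hornerM horner_wt -[1 + 1]/2%:R -functional_B.
  by rewrite (mulrCA _ N) [N * _]mulrC mulfK ?subrr// gt_eqF.
rewrite fE MD MG add0r.
have sr : (size (f %% G)%R <= size node_seq)%N.
  by rewrite -ltnS -size_root_prod ltn_modp.
rewrite {1}(lagrange sr) (functional_sum MD MZ) big_seq [RHS]big_seq.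
apply: eq_bigr => a aal; rewrite MZ hornerD hornerM (horner_root_prod0 aal) mulr0 add0r.
by rewrite /M /rho [LHS]mulrC mulrA mulrAC.
Qed.

Let quadrature_wt (f : {poly R}) : (size f <= k.+1.*2)%N ->
  L ((1 + 'X) ^+ eps * f) =
  2 ^+ eps * f.[1] / N + \sum_(a <- bs) (1 + a) ^+ eps * rho a * f.[a].
Proof.
move=> sf; rewrite levenshtein_quadrature; last first.
  case: eps; last by rewrite expr0 mul1r addn0.
  rewrite expr1; apply: leq_trans (size_polyMleq _ _) _.
  by rewrite addrC size_XaddC /= addn1 ltnS.
rewrite hornerM horner_wt /node_seq big_cat /=; congr (_ + _).
rewrite [X in X + _](_ : _ = 0) ?add0r.
  by apply: eq_bigr => a _; rewrite hornerM horner_wt mulrCA mulrA.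
case: eps => /=; last by rewrite big_nil.
by rewrite big_seq1 hornerM expr1 hornerD hornerC hornerX subrr mul0r mulr0.
Qed.

Let sigma a := (1 + a) ^+ eps * rho a.

(** The square of [B] / (t - a) leaves only the points a and 1. Taking g = a - t, 1 - t and 1 + t
    gives in turn a < 1, the sign of the weight at a, and a > -1. *)
Let quadrature_omit a (g : {poly R}) : a \in bs -> (size g <= 2)%N ->
  L ((1 + 'X) ^+ eps * (g * (root_prod (rem a bs) * root_prod (rem a bs)))) =
  2 ^+ eps * (g.[1] * (root_prod (rem a bs)).[1] ^+ 2) / N +
  sigma a * (g.[a] * (root_prod (rem a bs)).[a] ^+ 2).
Proof.
move=> abs sg; set q := root_prod _.
have sq : size q = k.+1 by rewrite size_root_prod size_rem// size_bs.
rewrite quadrature_wt; last first.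
  rewrite doubleS -addnn; apply: (@size_polyM_deg _ _ _ 1 (k + k)) => //.
  by apply: size_polyM_deg; rewrite sq.
rewrite !hornerM -expr2; congr (_ + _).
rewrite (big_rem a)//= big_seq big1 ?addr0 ?hornerM -?expr2// => c.
by move=> cr; rewrite !hornerM (horner_root_prod0 cr) mul0r !mulr0.
Qed.

Let horner_omit_neq0 a : a \in bs -> (root_prod (rem a bs)).[a] != 0.
Proof.
by move=> abs; rewrite -/(root _ _) root_prod_XsubC mem_rem_uniqF.
Qed.

Let omit_neq0 a : root_prod (rem a bs) != 0.
Proof. by rewrite -size_poly_eq0 size_root_prod. Qed.

(** For g = a - t the node a drops out. If a >= 1, the extremal property and D(n, m-1) < N would
    make L((1 + t)^eps (1 - t) q^2) nonpositive. *)
Let bs_lt1 a : a \in bs -> a < 1.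
Proof.
move=> abs; rewrite ltNge; apply/negP => a1.
set q := root_prod (rem a bs).
have sq : (size q <= k.+1)%N by rewrite size_root_prod size_rem// size_bs.
have := quadrature_omit (g := a%:P - 'X) abs _.
rewrite -/q !hornerD !hornerN !hornerC !hornerX subrr mul0r mulr0 addr0.
have -> : (size (a%:P - 'X)%R <= 2)%N.
  by rewrite -size_polyN opprB size_XsubC.
move=> /(_ isT).
have -> : (1 + 'X) ^+ eps * ((a%:P - 'X) * (q * q)) =
  (a - 1)%:P * ((1 + 'X) ^+ eps * (q * q)) + (1 + 'X) ^+ eps * ((1 - 'X) * q * q).
  by rewrite polyCB polyC1; move: (_ ^+ eps) (a%:P) => w z; ring.
rewrite LD LC => E.
have h1 := wt1_gt0 (omit_neq0 a).
have h2 := gb_extremal HL eps sq.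
have h3 : (D eps k)%:R * L ((1 + 'X) ^+ eps * (q * q)) <= N * L ((1 + 'X) ^+ eps * (q * q)).
  by rewrite ler_wpM2r ?ltW// wt_gt0 ?omit_neq0.
have h4 : 2 ^+ eps * q.[1] ^+ 2 / N <= L ((1 + 'X) ^+ eps * (q * q)).
  by rewrite ler_pdivrMr// [_ * N]mulrC (le_trans h2).
have : (a - 1) * (2 ^+ eps * q.[1] ^+ 2 / N) <= (a - 1) * L ((1 + 'X) ^+ eps * (q * q)).
  by rewrite ler_wpM2l// subr_ge0.
rewrite (_ : (a - 1) * (2 ^+ eps * q.[1] ^+ 2 / N) = 2 ^+ eps * ((a - 1) * q.[1] ^+ 2) / N); last first.
  by rewrite !mulrA (mulrC (a - 1)).
by rewrite -E; move: h1; rewrite -/q; lra.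
Qed.

Let sigma_gt0 a : a \in bs -> 0 < sigma a.
Proof.
move=> abs; set q := root_prod (rem a bs).
have := quadrature_omit (g := 1 - 'X) abs _.
have -> : (size (1 - 'X : {poly R})%R <= 2)%N by rewrite -size_polyN opprB size_XsubC.
move=> /(_ isT); rewrite !hornerD !hornerN !hornerC !hornerX subrr mul0r mulr0 mul0r add0r.
rewrite (mulrA (1 - 'X)) => E; have := wt1_gt0 (omit_neq0 a); rewrite E.
by rewrite pmulr_lgt0// mulr_gt0 ?subr_gt0 ?bs_lt1// exprn_even_gt0//= horner_omit_neq0.
Qed.

(** If a <= -1, the node a contributes at most 0 to L((1 + t)^(eps+1) q^2), which contradicts the
    extremal property with constant D(n, m) < N. For eps = 1 that property is applied, without
    weight, to (1 + t) q of degree k + 1. *)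
Lemma node_seq_gtN1 a : a \in bs -> -1 < a.
Proof.
move=> abs; rewrite ltNge; apply/negP => a1.
set q := root_prod (rem a bs).
have sq : size q = k.+1 by rewrite size_root_prod size_rem// size_bs.
have := quadrature_omit (g := 1 + 'X) abs _; rewrite -/q.
have -> : (size (1 + 'X : {poly R})%R <= 2)%N by rewrite addrC size_XaddC.
move=> /(_ isT); rewrite !hornerD !hornerC !hornerX mulrA -exprSr => E.
have q1 : q.[1] != 0.
  rewrite -/(root _ _) root_prod_XsubC; apply/negP => /mem_rem/bs_lt1.
  by rewrite ltxx.
have h1 : L ((1 + 'X) ^+ eps.+1 * (q * q)) <= 2 ^+ eps.+1 * q.[1] ^+ 2 / N.
  rewrite E -[1 + 1]/2%:R mulrA -exprSr -lerBrDl subrr; apply: mulr_ge0_le0.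
    by apply: ltW; exact: sigma_gt0.
  by rewrite mulr_le0_ge0 ?sqr_ge0//; lra.
have h2 : 2 ^+ eps.+1 * q.[1] ^+ 2 <=
    (D (~~ eps) (k + eps))%:R * L ((1 + 'X) ^+ eps.+1 * (q * q)).
  case: eps => /=.
    have := gb_extremal HL false (j := k + 1) (q := (1 + 'X) * q) _.
    rewrite !expr0 !mul1r hornerM hornerD hornerC hornerX exprMn => H.
    rewrite -[2 ^+ 2 in X in X <= _]/((1 + 1) ^+ 2).
    rewrite (_ : (1 + 'X) ^+ 2 * (q * q) = (1 + 'X) * q * ((1 + 'X) * q)); last by ring.
    apply: H; apply: leq_trans (size_polyMleq _ _) _.
    by rewrite addrC size_XaddC sq !addn1.
  by have := gb_extremal HL true (j := k + 0) (q := q) _; apply; rewrite sq addn0.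
have h3 := le_trans h2 (ler_wpM2l (ler0n _ _) h1).
have h4 : 0 < 2 ^+ eps.+1 * q.[1] ^+ 2 by apply: mulr_gt0; [exact: exprn_gt0|rewrite exprn_even_gt0].
move: h3 h4; set A := _ * _ ^+ 2 => + A0.
rewrite mulrA ler_pdivlMr// [_ * N]mulrC ler_pM2r//.
by move=> h; have := lt_le_trans N_gt h; rewrite ltxx.
Qed.

Lemma node_seq_bounds a : a \in node_seq -> -1 <= a < 1.
Proof.
rewrite mem_cat => /orP[|abs]; last by rewrite bs_lt1// ltW// node_seq_gtN1.
by case: eps; rewrite //= inE => /eqP ->; rewrite lexx; lra.
Qed.

Lemma node_weight_ge0 a : a \in node_seq -> 0 <= rho a.
Proof.
rewrite mem_cat => /orP[|abs]; last first.
  have := sigma_gt0 abs; rewrite /sigma pmulr_rgt0; first exact: ltW.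
  by rewrite exprn_gt0// -ltrBlDl sub0r node_seq_gtN1.
have [e|//] := boolP eps.
rewrite /= inE => /eqP ->.
(* When eps = 1, [B]^2 has degree exactly m and vanishes at all nodes but -1, so it isolates the
   weight there. *)
have sBB : (size (B * B)%R <= k.+1.*2 + eps)%N.
  apply: leq_trans (size_polyMleq _ _) _; rewrite size_B e addn1 -addnn.
  by rewrite !addSn !addnS.
have := levenshtein_quadrature sBB; rewrite /node_seq e big_cat big_seq1 /=.
rewrite [X in _ + (_ + X)]big_seq [X in _ + (_ + X)]big1 ?addr0; last first.
  by move=> c cb; rewrite hornerM (horner_root_prod0 cb) !mulr0.
rewrite !hornerM -!expr2 => E.
have B1 : B.[-1] != 0.
  by rewrite -/(root _ _) root_prod_XsubC; apply: bs_neqN1.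
have h := gb_extremal HL false (j := k + eps) (q := B) _.
move: h; rewrite size_B e addn1 leqnn !expr0 !mul1r => /(_ isT) h.
have NL : B.[1] ^+ 2 / N <= L (B * B).
  rewrite ler_pdivrMr// [_ * N]mulrC; apply: le_trans h _.
  rewrite ler_wpM2r ?ltW ?(functional_sqr_gt0 HL)//.
    by rewrite -size_poly_eq0 size_B.
  by move: N_gt; rewrite e addn1.
have : 0 <= rho (-1) * B.[-1] ^+ 2 by move: NL; rewrite E expr2; lra.
by rewrite pmulr_lge0// exprn_even_gt0.
Qed.

(** Weights of a measure on the k + 1 points [bs] that agrees with (1 - t)(1 + t)^eps dmu_n up to
    degree 2k; [node_sum_partial_prod_ge0] is applied to it. *)
Let tau a := (1 - a) * sigma a.

Let quadrature_tau (g : {poly R}) : (size g <= k.*2.+1)%N ->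
  L ((1 + 'X) ^+ eps * ((1 - 'X) * g)) = node_sum tau bs g.
Proof.
move=> sg; rewrite quadrature_wt.
  rewrite hornerM hornerD hornerN hornerC hornerX subrr mul0r mulr0 mul0r add0r.
  apply: eq_bigr => a _; rewrite /tau /sigma hornerM hornerD hornerN hornerC hornerX.
  by rewrite mulrA [_ * (1 - a)]mulrC.
apply: leq_trans (size_polyMleq _ _) _.
by rewrite -size_polyN opprB size_XsubC add2n doubleS /= !ltnS.
Qed.

(** A product of at most k factors is expanded in the kernels S_j; the coefficients are, up to
    positive norms, node sums covered by [node_sum_partial_prod_ge0]. The full product is
    [posdef_B]. *)
Lemma posdef_partial_prod i : posdef d L (root_prod (take i bs)).
Proof.
have [ik|ki] := leqP i k; last by rewrite take_oversize ?size_bs.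
set f := root_prod _.
have sf : (size f <= k.+1)%N by rewrite size_root_prod size_takel ?size_bs// leqW.
have sS j : size (S eps j) = j.+1 by have [] := size_gb_kernel R d eps j.
have [|c fE] := @poly_basis R (S eps) k.+1 f _ sf; first by move=> j _.
(* In degree k + 1 the orthogonal polynomial of the discrete measure is [B], which vanishes at all
   of its points. *)
pose p j := if (j <= k)%N then S eps j else B.
have SO j l : j != l -> L ((1 + 'X) ^+ eps * ((1 - 'X) * (S eps j * S eps l))) = 0.
  rewrite neq_ltn => /orP[jl|lj].
    by rewrite [S eps j * _]mulrC (mulrA (1 - 'X)) (gb_kernel_orth HL)// sS.
  by rewrite (mulrA (1 - 'X)) (gb_kernel_orth HL)// sS.
have c0 (j : 'I_k.+1) : 0 <= c j.
  have S0 : S eps j != 0 by rewrite -size_poly_eq0 sS.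
  have W0 := wt1_gt0 S0; rewrite -(pmulr_lge0 _ W0).
  have -> : c j * L ((1 + 'X) ^+ eps * ((1 - 'X) * S eps j * S eps j)) =
      L ((1 + 'X) ^+ eps * ((1 - 'X) * (S eps j * f))).
    rewrite fE mulr_sumr mulr_sumr mulr_sumr (functional_sum LD LZ) (bigD1 j)//= big1 ?addr0.
      by rewrite -!scalerAr LZ (mulrA (1 - 'X)).
    by move=> l lj; rewrite -!scalerAr LZ SO ?mulr0// eq_sym.
  have jk : (j <= k)%N by rewrite -ltnS.
  rewrite quadrature_tau; last first.
    apply: leq_trans (size_polyMleq _ _) _; rewrite sS addSn /= -addnn -addnS.
    exact: leq_add.
  have -> : S eps j = p j by rewrite /p jk.
  apply: node_sum_partial_prod_ge0 => //; last by rewrite size_bs; exact: leqW.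
    by move=> a abs; rewrite mulr_gt0 ?sigma_gt0// subr_gt0 bs_lt1.
  move=> l; rewrite size_bs leq_eqVlt => /predU1P[->|lk].
    rewrite /p ltnn; split=> //.
      by rewrite (monicP (monic_prod_XsubC _ _ _)).
    move=> q _; rewrite /node_sum big_seq big1// => a abs.
    by rewrite hornerM (horner_root_prod0 abs) mul0r mulr0.
  have {}lk : (l <= k)%N by [].
  rewrite /p lk; split=> //; first by have [] := size_gb_kernel R d eps l.
  move=> q sq; rewrite -quadrature_tau; first by rewrite (mulrA (1 - 'X)) (gb_kernel_orth HL).
  apply: leq_trans (size_polyMleq _ _) _; rewrite sS addSn /= -addnn.
  by apply: leqW; apply: leq_add => //; exact: leq_trans lk.
rewrite fE; apply: (posdef_sum HL) => j _; apply: (posdefZ HL) => //.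
exact: posdef_gb_kernel.
Qed.

Lemma hermite_interpolant (T : {poly R}) : shift_nneg T ->
  exists H Q, [/\ T = H + (1 + 'X) ^+ eps * (B * B) * Q, shift_nneg Q, posdef d L H &
    (size H <= k.+1.*2 + eps)%N].
Proof.
move=> nT; pose zs := nseq eps (-1) ++ dup_seq bs.
have szs : size zs = (k.+1.*2 + eps)%N by rewrite size_cat size_nseq size_dup_seq size_bs addnC.
have Pzs : root_prod zs = (1 + 'X) ^+ eps * (B * B).
  rewrite /zs /root_prod big_cat /= -!/(root_prod _) root_prod_dup; congr (_ * _).
  case: eps => /=; last by rewrite /root_prod big_nil expr0.
  by rewrite /root_prod big_seq1 polyCN opprK addrC expr1 polyC1.
have zs1 : all (>= -1) zs.
  rewrite all_cat all_nseq lexx orbT /=; apply/allP => a /flatten_mapP[c cbs].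
  by rewrite !inE orbb => /eqP ->; rewrite ltW// node_seq_gtN1.
have [|||j jn|H [Q [TE nQ KH sH]]] := @newton_nneg R (posdef d L) zs _ _ _ zs1 1 T nT.
- exact: posdef0.
- exact: posdefD.
- exact: posdefZ.
- rewrite mul1r.
  have pd i : posdef d L (root_prod (take i (dup_seq bs))).
    by rewrite root_prod_take_dup; apply: (posdefM HL); exact: posdef_partial_prod.
  (* The node -1 comes first, so every nonempty partial product carries the factor 1 + t = P_0 +
     P_1. *)
  rewrite /zs; case: eps => /=; last exact: pd.
  case: j jn => [|j] _ /=; first by rewrite /root_prod big_nil; exact: posdef1.
  rewrite root_prod_cons; apply: (posdefM HL) => //.
  rewrite polyCN opprK polyC1 addrC; apply: (posdefD HL); first exact: posdef1.
  by rewrite -(gb1 R d); exact: posdef_gb.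
exists H, Q; split=> //; first by rewrite {1}TE Pzs.
  by rewrite -[H]mul1r.
by rewrite -szs.
Qed.

End LevenshteinQuadrature.

Local Open Scope classical_set_scope.
Local Open Scope ring_scope.

(** * The measure mu_n *)

Section ImproperIntegrals.
Context {R : realType}.
Notation mu := (@lebesgue_measure R).

Lemma cvg_to_at_right (T : Type) (F : set_system T) (FF : Filter F) (f : T -> R) (l : R) :
  f @ F --> l -> (\forall x \near F, l < f x) -> f @ F --> l^'+.
Proof.
move=> fl fgt P; rewrite /at_right /within /= => /fl h.
by apply: filterS (filterI h fgt) => x [h1 h2]; exact (h1 h2).
Qed.

(** The fundamental theorem on compact intervals, passed to the limit. The integrand f - g is given
    as a difference of nonnegative functions so that monotone convergence applies to each, with no
    integrability assumed. *)
Lemma integral_exhaust (A : set R) (u v : R^nat) (f g F : R -> R) (l : R) :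
  nondecreasing_seq (fun n => `[u n, v n]%classic) ->
  \bigcup_n `[u n, v n]%classic = A ->
  (forall n, u n < v n) ->
  (forall x, A x -> {for x, continuous f}) ->
  (forall x, A x -> {for x, continuous g}) ->
  (forall x, A x -> 0 <= f x) -> (forall x, A x -> 0 <= g x) ->
  (forall x, A x -> is_derive x 1 F (f x - g x)) ->
  F (v n) - F (u n) @[n --> \oo] --> l ->
  (\int[mu]_(x in A) (f x)%:E = \int[mu]_(x in A) (g x)%:E + l%:E)%E.
Proof.
move=> nd UA uv cf cg f0 g0 dF Fl.
have KA n x : `[u n, v n]%classic x -> A x.
  by move=> Kx; rewrite -UA; exists n.
have cK n (k : R -> R) : (forall x, A x -> {for x, continuous k}) ->
    {within `[u n, v n], continuous k}.
  move=> ck; apply: continuous_in_subspaceT => x; rewrite inE => Kx.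
  by apply: ck; apply: KA Kx.
have iK n (k : R -> R) : (forall x, A x -> {for x, continuous k}) ->
    mu.-integrable `[u n, v n] (EFin \o k).
  move=> ck; apply: continuous_compact_integrable; first exact: segment_compact.
  exact: cK.
have limK (k : R -> R) : (forall x, A x -> {for x, continuous k}) ->
    (forall x, A x -> 0 <= k x) ->
    (\int[mu]_(x in `[u n, v n]) (k x)%:E @[n --> \oo] -->
     \int[mu]_(x in A) (k x)%:E)%E.
  move=> ck k0; rewrite -UA; apply: ge0_nondecreasing_set_cvg_integral => //.
  - by move=> n; have /integrableP[] := iK n _ ck.
  - by move=> n x Kx; rewrite lee_fin; apply: k0; apply: KA Kx.
have contF x : A x -> {for x, continuous F}.
  move=> /dF dFx; apply: differentiable_continuous.
  by apply/derivable1_diffP; apply: ex_derive.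
have step n : (\int[mu]_(x in `[u n, v n]) (f x)%:E =
     \int[mu]_(x in `[u n, v n]) (g x)%:E + (F (v n) - F (u n))%:E)%E.
  have e : (\int[mu]_(x in `[u n, v n]) ((f \- g) x)%:E =
           (F (v n))%:E - (F (u n))%:E)%E.
    apply: continuous_FTC2 => //.
    - by apply: cK => x Ax; apply: cvgB; [exact: cf|exact: cg].
    - split.
      + move=> x xuv; have /dF ? : A x.
          by apply: (KA n); apply: subset_itv_oo_cc xuv.
        exact: ex_derive.
      + apply: cvg_at_right_filter; apply: contF; apply: (KA n).
        by rewrite /= in_itv/= lexx ltW.
      + apply: cvg_at_left_filter; apply: contF; apply: (KA n).
        by rewrite /= in_itv/= lexx ltW.
    - move=> x xuv; have /dF ? : A x.
        by apply: (KA n); apply: subset_itv_oo_cc xuv.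
      by rewrite derive1E derive_val.
  have e2 : (\int[mu]_(x in `[u n, v n]) ((f x)%:E - (g x)%:E) =
    \int[mu]_(x in `[u n, v n]) (f x)%:E - \int[mu]_(x in `[u n, v n]) (g x)%:E)%E.
    by apply: integralB_EFin => //; apply: iK.
  have e3 : (\int[mu]_(x in `[u n, v n]) ((f x)%:E - (g x)%:E) =
             (F (v n) - F (u n))%:E)%E.
    by rewrite EFinB -e; apply: eq_integral => x _; rewrite EFinB.
  have gfin : (\int[mu]_(x in `[u n, v n]) (g x)%:E)%E \is a fin_num.
    by apply: integrable_fin_num => //; apply: iK.
  by rewrite -e3 e2 addeC subeK.
apply: (cvg_unique (@ereal_hausdorff R) (limK f cf f0)).
rewrite (funext step).
apply: cvgeD; [exact: fin_num_adde_defl|exact: limK|].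
apply: cvg_EFin; [exact: nearW|exact: Fl].
Qed.

Lemma integral_itv0y (f g F : R -> R) (a b : R) :
  (forall x : R, 0 < x -> {for x, continuous f}) ->
  (forall x : R, 0 < x -> {for x, continuous g}) ->
  (forall x : R, 0 < x -> 0 <= f x) -> (forall x : R, 0 < x -> 0 <= g x) ->
  (forall x : R, 0 < x -> is_derive x 1 F (f x - g x)) ->
  F x @[x --> 0^'+] --> a -> F x @[x --> +oo] --> b ->
  (\int[mu]_(x in `]0%R, +oo[) (f x)%:E =
   \int[mu]_(x in `]0%R, +oo[) (g x)%:E + (b - a)%:E)%E.
Proof.
move=> cf cg f0 g0 dF Fa Fb.
have A0 x : `]0, +oo[%classic x -> 0 < x by rewrite /= in_itv/= andbT.
apply: (@integral_exhaust _ (fun n => n.+2%:R^-1) (fun n => n.+2%:R) f g F) => //;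
  try by move=> x /A0; auto.
- apply/nondecreasing_seqP => n; rewrite subsetEset => x /=.
  rewrite !in_itv/= => /andP[h1 h2]; apply/andP; split.
    by apply: le_trans h1; rewrite lef_pV2 ?posrE ?ltr0n// ler_nat.
  by apply: le_trans h2 _; rewrite ler_nat.
- apply/seteqP; split => [x [n _] /=|x /A0 x0].
    rewrite !in_itv/= andbT => /andP[h1 _]; apply: lt_le_trans h1.
    by rewrite invr_gt0 ltr0n.
  pose M := Num.bound (Num.max x x^-1).
  have hM : Num.max x x^-1 < M%:R.
    apply: archi_boundP; rewrite le_max; apply/orP; left; exact: ltW.
  move: hM; rewrite gt_max => /andP[h1 h2].
  exists M => //=; rewrite in_itv/=; apply/andP; split.
    rewrite -(invrK x) lef_pV2 ?posrE ?ltr0n ?invr_gt0//.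
    by apply: le_trans (ltW h2) _; rewrite ler_nat; lia.
  by apply: le_trans (ltW h1) _; rewrite ler_nat; lia.
- move=> n; apply: (@lt_trans _ _ 1); last by rewrite ltr1n.
  by rewrite invf_lt1 ?ltr0n// ltr1n.
- apply: cvgB.
    apply: (@cvg_comp _ _ _ (fun n : nat => n.+2%:R : R) F) Fb.
    apply/cvgryPge => M; near=> n.
    apply: (@le_trans _ _ n%:R); last by rewrite ler_nat; lia.
    by near: n; exact: nbhs_infty_ger.
  move/cvg_at_rightP : Fa; apply; split.
    by move=> n; rewrite invr_gt0 ltr0n.
  by have := @cvg_harmonic R; rewrite -cvg_shiftS.
Unshelve. all: by end_near. Qed.

Lemma integral_itvN11 (f g F : R -> R) (a b : R) :
  (forall x : R, -1 < x < 1 -> {for x, continuous f}) ->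
  (forall x : R, -1 < x < 1 -> {for x, continuous g}) ->
  (forall x : R, -1 < x < 1 -> 0 <= f x) -> (forall x : R, -1 < x < 1 -> 0 <= g x) ->
  (forall x : R, -1 < x < 1 -> is_derive x 1 F (f x - g x)) ->
  F x @[x --> (-1)^'+] --> a -> F x @[x --> 1^'-] --> b ->
  (\int[mu]_(x in `](-1)%R, 1%R[) (f x)%:E =
   \int[mu]_(x in `](-1)%R, 1%R[) (g x)%:E + (b - a)%:E)%E.
Proof.
move=> cf cg f0 g0 dF Fa Fb.
have A0 x : `](-1), 1[%classic x -> -1 < x < 1 by rewrite /= in_itv.
have V0 n : 0 < n.+2%:R^-1 :> R by rewrite invr_gt0 ltr0n.
apply: (@integral_exhaust _ (fun n => -1 + n.+2%:R^-1) (fun n => 1 - n.+2%:R^-1) f g F) => //;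
  try by move=> x /A0; auto.
- apply/nondecreasing_seqP => n; rewrite subsetEset => x /=.
  have : n.+3%:R^-1 <= n.+2%:R^-1 :> R by rewrite lef_pV2 ?posrE ?ltr0n// ler_nat.
  move: (n.+3%:R^-1) (n.+2%:R^-1) => p q.
  by rewrite !in_itv/= => h /andP[h1 h2]; apply/andP; split; lra.
- apply/seteqP; split => [x [n _] /=|x /A0 x0].
    move: (V0 n); move: (n.+2%:R^-1) => q.
    by rewrite !in_itv/= => ? /andP[? ?]; apply/andP; split; lra.
  pose d := Num.min (1 - x) (1 + x).
  have d0 : 0 < d by rewrite lt_min; apply/andP; split; lra.
  pose M := Num.bound d^-1.
  have hM : d^-1 < M%:R by apply: archi_boundP; rewrite invr_ge0 ltW.
  have : M.+2%:R^-1 <= d.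
    rewrite -(invrK d) lef_pV2 ?posrE ?ltr0n ?invr_gt0//.
    by apply: le_trans (ltW hM) _; rewrite ler_nat; lia.
  rewrite le_min => /andP[h1 h2]; exists M => //=; rewrite in_itv/=.
  by move: (M.+2%:R^-1) h1 h2 => q h1 h2; apply/andP; split; lra.
- move=> n; have : n.+2%:R^-1 <= 2^-1 :> R.
    by rewrite lef_pV2 ?posrE ?ltr0n// ler_nat.
  have : 2^-1 < 1 :> R by rewrite invf_lt1 ?ltr0n// ltr1n.
  by move: (n.+2%:R^-1) => q; lra.
- have cV : n.+2%:R^-1 @[n --> \oo] --> (0 : R).
    by have := @cvg_harmonic R; rewrite -cvg_shiftS.
  apply: cvgB.
    move/cvg_at_leftP : Fb; apply; split.
      by move=> n; rewrite ltrBlDr ltrDl.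
    by rewrite -[X in _ --> X]subr0; apply: cvgB => //; exact: cvg_cst.
  move/cvg_at_rightP : Fa; apply; split.
    by move=> n; rewrite ltrDl.
  by rewrite -[X in _ --> X]addr0; apply: cvgD => //; exact: cvg_cst.
Qed.
End ImproperIntegrals.

(** * The Gamma function at half-integers *)

Section GammaHalfIntegers.
Context {R : realType}.
Notation mu := (@lebesgue_measure R).

Lemma continuous_powR (a x : R) : 0 < x -> {for x, continuous (fun t : R => t `^ a)}.
Proof.
move=> x0; apply: differentiable_continuous; apply/derivable1_diffP.
by have [] := is_derive1_powR a x0.
Qed.

Lemma powR_expRN_cvg0 (a : R) : t `^ a * expR (- t) @[t --> +oo] --> (0 : R).
Proof.
pose m := Num.bound `|a|.
have am : a <= m%:R.
  by apply: le_trans (ler_norm _) (ltW _); apply: archi_boundP.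
pose c : R := (m.+1)`!%:R.
have cV : c * t^-1 @[t --> +oo] --> (0 : R).
  rewrite -[X in _ --> X](mulr0 c); apply: cvgMr.
  apply/gtr0_cvgV0; last exact: cvg_id.
  by near=> t; rewrite -(invrK t) invr_gt0 invr_gt0; near: t; exact: nbhs_pinfty_gt.
apply: (squeeze_cvgr _ (cvg_cst 0) cV).
near=> t.
have t1 : 1 <= t by near: t; exact: nbhs_pinfty_ge.
have t0 : 0 < t by lra.
apply/andP; split; first by rewrite mulr_ge0 ?powR_ge0 ?expR_ge0.
have h1 : t `^ a <= t ^+ m.
  by rewrite -powR_mulrn ?(ltW t0)//; apply: ler_powR.
have h2 : t ^+ m.+1 <= c * expR t.
  have := @expR_ge1Dxn R t m (ltW t0) => h.
  rewrite mulrC -ler_pdivrMr ?ltr0n ?fact_gt0//; lra.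
rewrite expRN ler_pdivrMr ?expR_gt0//.
apply: (le_trans h1).
rewrite mulrAC ler_pdivlMr//; apply: le_trans h2.
by rewrite exprSr.
Unshelve. all: by end_near. Qed.

Let gamma_fun (a t : R) := t `^ a * expR (- t).

Let gamma_fun_ge0 a t : 0 <= gamma_fun a t.
Proof. by rewrite mulr_ge0 ?powR_ge0 ?expR_ge0. Qed.

Let gamma_fun_cont a t : 0 < t -> {for t, continuous (gamma_fun a)}.
Proof.
move=> t0; apply: cvgM; first exact: continuous_powR.
apply: continuous_comp; last exact: continuous_expR.
exact: opp_continuous.
Qed.

Let integral_gammaS (x : R) : 0 < x ->
  (\int[mu]_(t in `]0%R, +oo[) (gamma_fun x t)%:E =
   x%:E * \int[mu]_(t in `]0%R, +oo[) (gamma_fun (x - 1) t)%:E)%E.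
Proof.
move=> x0.
rewrite -ge0_integralZl//=; last 3 first.
- apply/measurable_EFinP; apply: subspace_continuous_measurable_fun => //.
  apply: continuous_in_subspaceT => t; rewrite inE /= in_itv/= andbT => t0.
  exact: gamma_fun_cont.
- by move=> t _; rewrite lee_fin.
- by rewrite lee_fin ltW.
have dF (t : R) : 0 < t ->
    is_derive t 1 (fun t => - gamma_fun x t) (gamma_fun x t - x * gamma_fun (x - 1) t).
  move=> t0; have dp := is_derive1_powR x t0.
  have de : is_derive t 1 (fun t : R => expR (- t)) (- expR (- t)).
    by apply: is_derive_eq; rewrite mulrN1.
  apply: is_derive_eq.
  by rewrite /gamma_fun /GRing.scale/=; ring.
rewrite (integral_itv0y _ _ _ _ dF (a := 0) (b := 0)); first by rewrite subr0 adde0.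
- by move=> t; exact: gamma_fun_cont.
- by move=> t t0; apply: cvgM; [exact: cvg_cst|exact: gamma_fun_cont].
- by move=> t _.
- by move=> t _; rewrite mulr_ge0 ?gamma_fun_ge0 ?ltW.
- rewrite -[X in _ --> X]oppr0; apply: cvgN.
  rewrite -[X in _ --> X](mul0r (expR (- 0))); apply: cvgM; first exact: powR_cvg0.
  apply: cvg_at_right_filter; apply: continuous_comp; last exact: continuous_expR.
  exact: opp_continuous.
- by rewrite -[X in _ --> X]oppr0; apply: cvgN; exact: powR_expRN_cvg0.
Qed.

Let integral_gamma1 : (\int[mu]_(t in `]0%R, +oo[) (gamma_fun 0 t)%:E = 1)%E.
Proof.
have dF (t : R) : 0 < t ->
    is_derive t 1 (fun t => - expR (- t)) (gamma_fun 0 t - (fun=> 0) t).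
  move=> t0; apply: is_derive_eq.
  by rewrite /gamma_fun powRr0 mul1r subr0 mulrN1 opprK.
rewrite (integral_itv0y _ _ _ _ dF (a := -1) (b := 0)).
- by rewrite integral0 add0e sub0r opprK.
- by move=> t; exact: gamma_fun_cont.
- by move=> t _; exact: cvg_cst.
- by [].
- by [].
- apply: cvg_at_right_filter; rewrite -[in X in _ --> X]expR0 -[in X in _ --> X]oppr0.
  apply: cvgN; apply: continuous_comp; last exact: continuous_expR.
  exact: opp_continuous.
- by rewrite -[X in _ --> X]oppr0; apply: cvgN; exact: cvgr_expR.
Qed.

(** By the substitution t = x^2, [G] at sqrt t is an antiderivative of t^(-1/2) e^(-t); its limit
    sqrt pi is the Gaussian integral. *)
Let G (x : R) : R := 2 * (\int[mu]_(t in `[0%R, x]) gauss_fun t).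

Let integral_gamma_half :
  (\int[mu]_(t in `]0%R, +oo[) (gamma_fun (- 2^-1) t)%:E = (Num.sqrt pi)%:E)%E.
Proof.
have intg x : mu.-integrable `[0%R, x] (EFin \o @gauss_fun R).
  apply: (@integrableS _ _ _ _ setT) => //; exact: integrableT_gauss.
have dG (x : R) : 0 < x -> is_derive x 1 G (2 * gauss_fun x).
  move=> x0; apply: is_deriveZ.
  have [||||d1 d2] := @continuous_FTC1_closed R (@gauss_fun R) 0 x (x + 1).
  - by rewrite ltrDl.
  - exact: intg.
  - by [].
  - exact: continuous_gauss_fun.
  by split; [exact: d1|rewrite -derive1E; exact: d2].
have dF (t : R) : 0 < t ->
    is_derive t 1 (G \o (fun t => t `^ (2^-1))) (gamma_fun (- 2^-1) t - (fun=> 0) t).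
  move=> t0; have dp := is_derive1_powR (2^-1) t0.
  have dg := dG _ (powR_gt0 (2^-1) t0).
  have dc := @is_derive1_comp R G (fun t => t `^ 2^-1) t _ _ dg dp.
  suff -> : gamma_fun (- 2^-1) t - 0 =
      2 * gauss_fun (t `^ 2^-1) * (2^-1 * t `^ (2^-1 - 1)) by exact: dc.
  have -> : 2^-1 - 1 = - 2^-1 :> R by lra.
  rewrite /gamma_fun /gauss_fun subr0 powR12_sqrt ?(ltW t0)// sqr_sqrtr ?(ltW t0)//.
  by rewrite mulrACA [2 * 2^-1]divff ?mul1r ?pnatr_eq0 1?mulrC.
rewrite (integral_itv0y _ _ _ _ dF (a := 0) (b := Num.sqrt pi)).
- by rewrite integral0 add0e subr0.
- by move=> t; exact: gamma_fun_cont.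
- by move=> t _; exact: cvg_cst.
- by [].
- by [].
- have c0 : G x @[x --> 0] --> (0 : R).
    rewrite -[X in _ --> X](mulr0 2); apply: cvgMr.
    exact: (@parameterized_integral_cvg_left R 0 1 (@gauss_fun R) ltr01 (intg 1)).
  apply: cvg_comp c0.
  by apply: powR_cvg0; rewrite invr_gt0.
- have cy : G x @[x --> +oo] --> Num.sqrt (pi : R).
    have -> : Num.sqrt pi = 2 * Num.sqrt (pi / 4) :> R.
      rewrite sqrtrM ?pi_ge0// sqrtrV// (_ : 4 = 2 ^+ 2 :> R); last by ring.
      by rewrite sqrtr_sqr ger0_norm// mulrCA divff ?mulr1// pnatr_eq0.
    apply: cvgMr.
    have : Num.sqrt (gauss_integral_proof.integral0_gauss x ^+ 2) @[x --> +oo] --> Num.sqrt (pi / 4 : R).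
      apply: continuous_cvg; first exact: sqrt_continuous.
      exact: gauss_integral_proof.cvg_integral0_gauss_sqr.
    apply: cvg_trans; apply: near_eq_cvg; apply: nearW => x.
    by rewrite sqrtr_sqr ger0_norm// gauss_integral_proof.integral0_gauss_ge0.
  apply: cvg_comp cy.
  apply/cvgryPge => M; near=> t.
  have t0 : 0 <= t by near: t; exact: nbhs_pinfty_ge.
  rewrite powR12_sqrt//; apply: le_trans (ler_norm M) _.
  rewrite -sqrtr_sqr ler_sqrt//.
Unshelve. all: by end_near. Qed.

(** The induction goes by two from Gamma(1/2) and Gamma(1). It carries the finiteness of the
    extended integral, because [Gamma] is a real-valued integral that defaults to 0 when
    infinite. *)
Lemma Gamma_half_int n : (0 < n)%N ->
  [/\ 0 < Gamma (n%:R / 2) :> R,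
      (\int[mu]_(t in `]0%R, +oo[) (gamma_fun (n%:R / 2 - 1) t)%:E =
      (Gamma (n%:R / 2))%:E)%E &
      Gamma (n.+2%:R / 2) = n%:R / 2 * Gamma (n%:R / 2) :> R].
Proof.
elim/ltn_ind: n => -[//|n] IH _.
have E (x y : R) : (\int[mu]_(t in `]0%R, +oo[) (gamma_fun (x - 1) t)%:E = y%:E)%E ->
   Gamma x = y by move=> e; rewrite /Gamma /Rintegral e.
have [g [g0 gE]] : exists g : R, 0 < g /\
    (\int[mu]_(t in `]0%R, +oo[) (gamma_fun (n.+1%:R / 2 - 1) t)%:E = g%:E)%E.
  case: n IH => [_|[_|n IH]].
  - exists (Num.sqrt pi); split; first by rewrite sqrtr_gt0 pi_gt0.
    by rewrite -integral_gamma_half (_ : 1 / 2 - 1 = - 2^-1 :> R)//; lra.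
  - exists 1; split=> //.
    by rewrite divff ?pnatr_eq0// subrr integral_gamma1.
  - have [//|//|h1 h2 h3] := IH n.+1.
    exists (n.+1%:R / 2 * Gamma (n.+1%:R / 2)); split.
      by rewrite mulr_gt0// divr_gt0// ltr0n.
    have -> : n.+3%:R / 2 - 1 = n.+1%:R / 2 :> R.
      by rewrite (_ : n.+3%:R = n.+1%:R + 2) -?natrD ?addn2//; field.
    by rewrite integral_gammaS ?divr_gt0 ?ltr0n// h2 EFinM.
rewrite (E _ _ gE); split => //.
apply: E.
have -> : n.+3%:R / 2 - 1 = n.+1%:R / 2 :> R.
  by rewrite (_ : n.+3%:R = n.+1%:R + 2) -?natrD ?addn2//; field.
by rewrite integral_gammaS ?divr_gt0 ?ltr0n// gE EFinM.
Qed.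

Lemma Gamma1 : Gamma 1 = 1 :> R.
Proof. by rewrite /Gamma /Rintegral -[1 - 1]/(1 - 1) subrr integral_gamma1. Qed.

Lemma Gamma_half : Gamma (1 / 2) = Num.sqrt pi :> R.
Proof.
rewrite /Gamma /Rintegral.
by rewrite (_ : 1 / 2 - 1 = - 2^-1) ?integral_gamma_half//; lra.
Qed.

End GammaHalfIntegers.

(** * Integrability, integration by parts and total mass of mu_n *)

Section GegenbauerMeasure.
Context {R : realType}.
Notation mu := (@lebesgue_measure R).
Implicit Types (p q : {poly R}) (n : nat) (t : R).

Let e n : R := (n%:R - 3) / 2.
Let wt n t : R := (1 - t ^+ 2) `^ e n.
Let I n p : R := \int[mu]_(t in `](-1)%R, 1%R[) (p.[t] * wt n t).

Let oo t : `](-1), 1[%classic t -> -1 < t < 1.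
Proof. by rewrite /= in_itv. Qed.

Let onesq t : -1 < t < 1 -> 0 < 1 - t ^+ 2 <= 1.
Proof. by move=> /andP[? ?]; apply/andP; split; nra. Qed.

Let wt_ge0 n t : 0 <= wt n t. Proof. exact: powR_ge0. Qed.

Let wt_cont n t : -1 < t < 1 -> {for t, continuous (wt n)}.
Proof.
move=> /onesq/andP[t1 _].
apply: (@continuous_comp _ _ _ (fun t => 1 - t ^+ 2) (fun u => u `^ e n)).
  by apply: cvgB; [exact: cvg_cst|exact: exprn_continuous].
exact: continuous_powR.
Qed.

Let pw_cont n p t : -1 < t < 1 -> {for t, continuous (fun t => p.[t] * wt n t)}.
Proof. by move=> ht; apply: cvgM; [exact: continuous_horner|exact: wt_cont]. Qed.

Let pw_meas n p : measurable_fun (`](-1)%R, 1%R[%classic : set R) (fun t => p.[t] * wt n t).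
Proof.
apply: subspace_continuous_measurable_fun => //.
apply: continuous_in_subspaceT => t; rewrite inE => /oo ht.
exact: pw_cont.
Qed.

Let cvg_asin_left : asin x @[x --> 1^'-] --> (pi / 2 : R).
Proof.
have p0 := @pi_gt0 R.
apply/cvgrPdist_le => eps eps0.
pose d := Num.min eps (pi / 2).
have d0 : 0 < d by rewrite lt_min eps0 divr_gt0.
have dp : d <= pi / 2 by rewrite ge_min lexx orbT.
have de : d <= eps by rewrite ge_min lexx.
have s1 : sin (pi / 2 - d) < 1 :> R.
  rewrite -[X in _ < X]sin_pihalf; clearbody d; by rewrite ltr_sin ?in_itv/=; try (apply/andP; split); lra.
near=> x.
have xs : sin (pi / 2 - d) < x by near: x; exact: nbhs_left_gt.
have x1 : x < 1 by near: x; exact: nbhs_left_lt.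
have xm : -1 <= x by apply: le_trans (sin_geN1 _) (ltW xs).
have h1 := asin_ltpi2 (introT andP (conj xm x1)).
have x11 : -1 <= x <= 1 by rewrite xm ltW.
have h2 := asin_geNpi2 x11.
have : pi / 2 - d < asin x.
  clearbody d; rewrite -ltr_sin ?in_itv/= ?asinK ?in_itv//=; try (apply/andP; split); lra.
by move=> h3; rewrite ger0_norm; lra.
Unshelve. all: by end_near. Qed.

Let cvg_asin_right : asin x @[x --> (-1)^'+] --> (- (pi / 2) : R).
Proof.
have p0 := @pi_gt0 R.
apply/cvgrPdist_le => eps eps0.
pose d := Num.min eps (pi / 2).
have d0 : 0 < d by rewrite lt_min eps0 divr_gt0.
have dp : d <= pi / 2 by rewrite ge_min lexx orbT.
have de : d <= eps by rewrite ge_min lexx.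
have s1 : -1 < sin (d - pi / 2) :> R.
  have -> : -1 = sin (- (pi / 2)) :> R by rewrite sinN sin_pihalf.
  clearbody d; rewrite ltr_sin ?in_itv/=; try (apply/andP; split); lra.
near=> x.
have xs : x < sin (d - pi / 2) by near: x; exact: nbhs_right_lt.
have x1 : -1 < x by near: x; exact: nbhs_right_gt.
have xm : x <= 1 by apply: le_trans (ltW xs) (sin_le1 _).
have h1 := asin_gtNpi2 (introT andP (conj x1 xm)).
have x11 : -1 <= x <= 1 by rewrite xm ltW.
have h2 := asin_lepi2 x11.
have : asin x < d - pi / 2.
  clearbody d; rewrite -ltr_sin ?in_itv/= ?asinK ?in_itv//=; try (apply/andP; split); lra.
by move=> h3; rewrite ler0_norm; lra.
Unshelve. all: by end_near. Qed.

Let integral_wt2 : (\int[mu]_(t in `](-1)%R, 1%R[) (wt 2 t)%:E = (pi : R)%:E)%E.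
Proof.
have dF t : -1 < t < 1 -> is_derive t 1 asin (wt 2 t - (fun=> 0) t).
  move=> ht; have [t0 _] := andP (onesq ht).
  suff -> : wt 2 t - 0 = (Num.sqrt (1 - t ^+ 2))^-1 by exact: is_derive1_asin.
  rewrite subr0 /wt /e (_ : (2%:R - 3) / 2 = - 2^-1 :> R); last by lra.
  by rewrite powRN powR12_sqrt// ltW.
rewrite (integral_itvN11 _ _ _ _ dF cvg_asin_right cvg_asin_left).
- by rewrite integral0 add0e opprK -splitr.
- by move=> t; exact: wt_cont.
- by move=> t _; exact: cvg_cst.
- by [].
- by [].
Qed.

(** The density for n = 2 is unbounded at both ends but has the antiderivative asin. As 0 < 1 - t^2
    <= 1, it dominates all the others and makes them integrable. *)
Let wt_le2 n t : (2 <= n)%N -> -1 < t < 1 -> wt n t <= wt 2 t.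
Proof.
move=> n2 /onesq ht; apply: ger_powR => //.
by rewrite /e ler_pM2r ?invr_gt0// lerD2r ler_nat.
Qed.

Let wt2_integrable : mu.-integrable `](-1)%R, 1%R[ (EFin \o wt 2).
Proof.
apply/integrableP; split.
  apply/measurable_EFinP; have := @pw_meas 2 1.
  by apply: eq_measurable_fun => t _; rewrite hornerC mul1r.
under eq_integral do rewrite /= ger0_norm ?wt_ge0//.
by rewrite integral_wt2 ltry.
Qed.

Lemma horner_bounded p : exists2 C : R, 0 <= C & forall t, -1 <= t <= 1 -> `|p.[t]| <= C.
Proof.
exists (\sum_(i < size p) `|p`_i|); first by apply: sumr_ge0.
move=> t ht; rewrite horner_coef; apply: (le_trans (ler_norm_sum _ _ _)).
apply: ler_sum => i _; rewrite normrM normrX ler_piMr//.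
by apply: exprn_ile1 => //; rewrite ler_norml.
Qed.

Let pw_integrable n p : (2 <= n)%N ->
  mu.-integrable `](-1)%R, 1%R[ (EFin \o (fun t => p.[t] * wt n t)).
Proof.
move=> n2; have [C C0 Cp] := horner_bounded p.
have iC : mu.-integrable `](-1)%R, 1%R[ (fun t => C%:E * (EFin \o wt 2) t)%E.
  exact: integrableZl.
apply: le_integrable iC => //; first by apply/measurable_EFinP; exact: pw_meas.
move=> t /oo ht /=; rewrite lee_fin !normrM (ger0_norm C0) !(ger0_norm (wt_ge0 _ _)).
apply: ler_pM => //; last exact: wt_le2.
by apply: Cp; case/andP: ht => *; rewrite !ltW.
Qed.

Let mu_intE n p : (2 <= n)%N -> mu_int n p = gamma_const n * I n p.
Proof.
move=> n2; rewrite /I -RintegralZl//; last exact: pw_integrable.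
rewrite /mu_int /Rintegral; congr fine.
rewrite [LHS]integral_itv_bndoo.
  by apply: eq_integral => t _; rewrite /mu_density mulrCA.
apply/measurable_EFinP.
apply: (eq_measurable_fun (fun t => gamma_const n * (p.[t] * wt n t))).
  by move=> t _; rewrite /mu_density mulrCA.
by apply: measurable_funM; [exact: measurable_cst|exact: pw_meas].
Qed.

Let ID n p q : (2 <= n)%N -> I n (p + q) = I n p + I n q.
Proof.
move=> n2; rewrite /I -RintegralD//; try exact: pw_integrable.
by apply: eq_Rintegral => t _; rewrite hornerD mulrDl.
Qed.

Let IZ n a p : (2 <= n)%N -> I n (a *: p) = a * I n p.
Proof.
move=> n2; rewrite /I -RintegralZl//; last exact: pw_integrable.
by apply: eq_Rintegral => t _; rewrite hornerZ mulrA.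
Qed.

Let IN n p : (2 <= n)%N -> I n (- p) = - I n p.
Proof. by move=> n2; rewrite -scaleN1r IZ// mulN1r. Qed.

Let I_ge0 n p : (forall t, -1 <= t <= 1 -> 0 <= p.[t]) -> 0 <= I n p.
Proof.
move=> p0; apply: Rintegral_ge0 => t /oo /andP[? ?].
by rewrite mulr_ge0// p0// !ltW.
Qed.

(** The integrand is the derivative of p (1 - t^2)^((n-1)/2), which tends to 0 at both ends. *)
Let I_pearson n p : (2 <= n)%N ->
  I n ((1 - 'X^2) * p^`() - (n - 1)%:R *: ('X * p)) = 0.
Proof.
move=> n2; set q := _ - _.
(* Adding the constant C makes q + C nonnegative, as [integral_itvN11] requires; it cancels at the
   end. *)
have [C C0 Cq] := horner_bounded q.
pose a : R := (n%:R - 1) / 2.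
have a0 : 0 < a by rewrite divr_gt0// subr_gt0 ltr1n.
have ea : e n = a - 1 by rewrite /e /a; field.
pose F t : R := p.[t] * (1 - t ^+ 2) `^ a.
have dF t : -1 < t < 1 -> is_derive t 1 F ((q + C%:P).[t] * wt n t - C%:P.[t] * wt n t).
  move=> ht; have [t0 _] := andP (onesq ht).
  have dpow := is_derive1_powR a t0.
  have dsq : is_derive t 1 (fun t : R => 1 - t ^+ 2) (- (2 * t)).
    apply: is_derive_eq; rewrite /GRing.scale/=; ring.
  have dc := @is_derive1_comp R (fun u => u `^ a) (fun t => 1 - t ^+ 2) t _ _ dpow dsq.
  have dFt := is_deriveM (is_derive_poly p t) dc.
  suff <- : p.[t] *: (a * (1 - t ^+ 2) `^ (a - 1) * - (2 * t)) +
     ((fun u => u `^ a) \o (fun t => 1 - t ^+ 2)) t *: p^`().[t] =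
      (q + C%:P).[t] * wt n t - C%:P.[t] * wt n t by exact: dFt.
  rewrite /= -(mulr_powRB1 (ltW t0) a0) /wt ea /q !hornerE /GRing.scale/=.
  have -> : (n - 1)%:R = 2 * a by rewrite natrB 1?(ltn_trans _ n2)// /a; field.
  ring.
have c1 : ((1 - t ^+ 2) `^ a) @[t --> 1^'-] --> (0 : R).
  apply: cvg_comp (powR_cvg0 a0); apply: cvg_to_at_right.
    rewrite -[X in _ --> X](_ : 1 - 1 ^+ 2 = 0); last by ring.
    by apply: cvg_at_left_filter; apply: cvgB; [exact: cvg_cst|exact: exprn_continuous].
  near=> t; have t1 : t < 1 by near: t; exact: nbhs_left_lt.
  have t0 : -1 < t by near: t; apply: nbhs_left_gt; lra.
  by have /andP[] : 0 < 1 - t ^+ 2 <= 1 by apply: onesq; rewrite t0.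
have c2 : ((1 - t ^+ 2) `^ a) @[t --> (-1)^'+] --> (0 : R).
  apply: cvg_comp (powR_cvg0 a0); apply: cvg_to_at_right.
    rewrite -[X in _ --> X](_ : 1 - (- 1) ^+ 2 = 0); last by ring.
    by apply: cvg_at_right_filter; apply: cvgB; [exact: cvg_cst|exact: exprn_continuous].
  near=> t; have t1 : -1 < t by near: t; exact: nbhs_right_gt.
  have t0 : t < 1 by near: t; apply: nbhs_right_lt; lra.
  by have /andP[] : 0 < 1 - t ^+ 2 <= 1 by apply: onesq; rewrite t1.
have cF1 : F t @[t --> 1^'-] --> (0 : R).
  rewrite -[X in _ --> X](mulr0 p.[1]); apply: cvgM => //.
  by apply: cvg_at_left_filter; exact: continuous_horner.
have cF2 : F t @[t --> (-1)^'+] --> (0 : R).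
  rewrite -[X in _ --> X](mulr0 p.[-1]); apply: cvgM => //.
  by apply: cvg_at_right_filter; exact: continuous_horner.
have E := integral_itvN11 (f := fun t => (q + C%:P).[t] * wt n t)
  (g := fun t => C%:P.[t] * wt n t) _ _ _ _ dF cF2 cF1.
have : I n (q + C%:P) = I n C%:P.
  rewrite /I /Rintegral E ?subr0 ?adde0//.
  - by move=> t; exact: pw_cont.
  - by move=> t; exact: pw_cont.
  - move=> t /andP[t1 t2]; rewrite mulr_ge0// hornerD hornerC.
    have : `|q.[t]| <= C by apply: Cq; rewrite !ltW.
    by rewrite ler_norml => /andP[h _]; rewrite -lerBlDr sub0r.
  - by move=> t _; rewrite mulr_ge0// hornerC.
by rewrite ID// -[X in _ = X]add0r => /addIr.
Unshelve. all: by end_near. Qed.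

Lemma mu_intD n p q : (2 <= n)%N -> mu_int n (p + q) = mu_int n p + mu_int n q.
Proof. by move=> n2; rewrite !mu_intE// ID// mulrDr. Qed.

Lemma mu_intZ n a p : (2 <= n)%N -> mu_int n (a *: p) = a * mu_int n p.
Proof. by move=> n2; rewrite !mu_intE// IZ// mulrCA. Qed.

Lemma gamma_const_gt0 n : (2 <= n)%N -> 0 < gamma_const n :> R.
Proof.
move=> n2; rewrite /gamma_const.
have -> : n%:R - 1 = (n - 1)%:R :> R by rewrite natrB ?(ltn_trans _ n2).
have [|g1 _ _] := @Gamma_half_int R n; first exact: ltn_trans n2.
have [|g2 _ _] := @Gamma_half_int R (n - 1); first by rewrite subn_gt0.
by rewrite divr_gt0// mulr_gt0// sqrtr_gt0 pi_gt0.
Qed.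

Lemma mu_int_ge0 n p : (2 <= n)%N ->
  (forall t, -1 <= t <= 1 -> 0 <= p.[t]) -> 0 <= mu_int n p.
Proof.
by move=> n2 p0; rewrite mu_intE// mulr_ge0 ?I_ge0// ltW// gamma_const_gt0.
Qed.

Lemma mu_int_pearson n p : (2 <= n)%N ->
  mu_int n ((1 - 'X^2) * p^`()) = (n - 1)%:R * mu_int n ('X * p).
Proof.
move=> n2; have := @I_pearson n p n2; rewrite ID// IN// IZ// => /eqP.
by rewrite subr_eq0 => /eqP E; rewrite !mu_intE// E mulrCA.
Qed.

Lemma mu_int1 n : (2 <= n)%N -> mu_int n 1 = 1 :> R.
Proof.
elim/ltn_ind: n => n IH n2.
have [->|n2'] := eqVneq n 2%N.
  rewrite mu_intE// /I /Rintegral.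
  under eq_integral do rewrite hornerC mul1r.
  rewrite integral_wt2 /= /gamma_const divff ?pnatr_eq0// Gamma1.
  rewrite (_ : 2%:R - 1 = 1 :> R) ?Gamma_half; last by ring.
  by rewrite -expr2 sqr_sqrtr ?pi_ge0// mul1r mulVf// gt_eqF// pi_gt0.
have [->|n3] := eqVneq n 3%N.
  rewrite mu_intE// /I.
  under eq_Rintegral do rewrite hornerC mul1r /wt /e subrr mul0r powRr0.
  rewrite -[RHS](_ : gamma_const 3 * 2 = 1).
    congr (_ * _); rewrite /Rintegral.
    have dF t : -1 < t < 1 -> is_derive t 1 id ((fun=> 1) t - (fun=> 0) t).
      by move=> _; rewrite subr0; exact: is_derive_id.
    rewrite (integral_itvN11 (f := fun=> 1) _ _ _ _ dF (a := -1) (b := 1)).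
    - by rewrite integral0 add0e opprK.
    - by move=> t _; exact: cvg_cst.
    - by move=> t _; exact: cvg_cst.
    - by [].
    - by [].
    - by apply: cvg_at_right_filter; exact: cvg_id.
    - by apply: cvg_at_left_filter; exact: cvg_id.
  have c2 : 3 - 1 = 2 :> R by lra.
  have [//|g1 _ E] := @Gamma_half_int R 1.
  rewrite /gamma_const c2 E divff ?pnatr_eq0// Gamma1 Gamma_half.
  have sp : Num.sqrt (pi : R) != 0 by rewrite gt_eqF// sqrtr_gt0 pi_gt0.
  by field.
have [k nE] : exists k, n = k.+4 by exists (n - 4)%N; lia.
have {}IH : mu_int k.+2 1 = 1 :> R by apply: IH => //; rewrite nE.
(* The induction goes by two: the density in dimension k + 4 is 1 - t^2 times the one in dimension k
   + 2, and the Pearson identity for p = t evaluates the integral of 1 - t^2. *)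
have S2 : I k.+4 1 = I k.+2 (1 - 'X^2).
  apply: eq_Rintegral => t; rewrite inE => /oo /onesq/andP[t0 _].
  rewrite /wt !hornerE (_ : e k.+4 = 1 + e k.+2); last by rewrite /e -!natr1; field.
  rewrite powRD ?powRr1 ?(ltW t0)//; last by rewrite (gt_eqF t0) implybT.
have k2 : (2 <= k.+2)%N by [].
have P2 := I_pearson 'X k2.
have : I k.+2 (1 - 'X^2) = (k.+1)%:R / (k.+2)%:R * I k.+2 1.
  have k1 : k.+2%:R = k.+1%:R + 1 :> R by rewrite -natr1.
  have k0 : k.+2%:R != 0 :> R by rewrite pnatr_eq0.
  move: P2; rewrite derivX mulr1 (ID _ _ k2) (IN _ k2) (IZ _ _ k2) -expr2 subSS subn0.
  have : I k.+2 1 = I k.+2 (1 - 'X^2) + I k.+2 'X^2 by rewrite -(ID _ _ k2) subrK.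
  move: (I _ _) (I _ _) (I _ _) => x y z e1 e2; apply: (mulfI k0); rewrite mulrA mulrCA (divff k0) mulr1.
  by rewrite e1 k1; move: e2; lra.
rewrite nE (mu_intE _ (isT : (2 <= k.+4)%N)) S2 => ->.
rewrite -[RHS]IH (mu_intE _ k2) mulrA; congr (_ * _).
have c1 : k.+4%:R - 1 = k.+3%:R :> R by rewrite -[k.+4%:R]natr1 addrK.
have c2 : k.+2%:R - 1 = k.+1%:R :> R by rewrite -[k.+2%:R]natr1 addrK.
rewrite /gamma_const c1 c2.
have [//|g1 _ ->] := @Gamma_half_int R k.+2.
have [//|g2 _ ->] := @Gamma_half_int R k.+1.
have sp : Num.sqrt (pi : R) != 0 by rewrite gt_eqF// sqrtr_gt0 pi_gt0.
move: (lt0r_neq0 g1) (lt0r_neq0 g2) sp.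
have k10 : k.+1%:R != 0 :> R by rewrite pnatr_eq0.
have k20 : k.+2%:R != 0 :> R by rewrite pnatr_eq0.
move: (Gamma (k.+2%:R / 2)) (Gamma (k.+1%:R / 2)) (Num.sqrt _) => x y z.
move: (k.+1%:R) (k.+2%:R) k10 k20 => u v u0 v0 x0 y0 z0.
by field; rewrite ?x0 ?y0 ?z0 ?u0 ?v0.
Qed.

End GegenbauerMeasure.

(** * Absolutely monotone potentials *)

Section DeriveWithin.
Context {R : realType}.
Implicit Types (g : R -> R) (t l : R).
Local Notation A := (`[(-1)%R, 1%R[%classic : set R).

Lemma is_derive_within g t l : -1 < t < 1 ->
  diff_quotient g t u @[u --> within A t^'] --> l -> is_derive t 1 g l.
Proof.
move=> /andP[t1 t2] cv.
have H : h^-1 *: ((g \o shift t) (h *: 1) - g t) @[h --> 0^'] --> l.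
  move=> P Pl; have /nbhs_ballP[e /= e0 He] := cv P Pl.
  apply/nbhs_ballP; exists (Num.min e (Num.min (1 - t) (1 + t))) => /=.
    by rewrite !lt_min e0 /=; apply/andP; split; lra.
  move=> h; rewrite /ball/= sub0r normrN !lt_min => /and3P[h1 h2 h3] h0.
  have ht : h *: 1 + t = h + t by rewrite /GRing.scale/= mulr1.
  have := He (h + t); rewrite /ball/= opprD addrC addrNK normrN => /(_ h1).
  have hn : h + t != t by rewrite -subr_eq0 addrK.
  move=> /(_ hn); rewrite /diff_quotient addrK => H.
  rewrite /preimage/= /shift/= ht /GRing.scale/= mulrC; apply: H.
  rewrite in_itv/=; move: h2 h3; rewrite !ltr_norml => /andP[? ?] /andP[? ?].
  by apply/andP; split; lra.
split; first by apply/cvg_ex; exists l.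
exact: (cvg_lim (@Rhausdorff R) H).
Qed.

Lemma derivable_within_cvg_right g l :
  diff_quotient g (-1) u @[u --> within A (-1 : R)^'] --> l ->
  g u @[u --> (-1 : R)^'+] --> g (-1).
Proof.
move=> cv.
have H : diff_quotient g (-1) u @[u --> (-1 : R)^'+] --> l.
  move=> P Pl; have /nbhs_ballP[e /= e0 He] := cv P Pl.
  apply/nbhs_ballP; exists (Num.min e 1) => /=; first by rewrite lt_min e0 ltr01.
  move=> u; rewrite /ball/= lt_min => /andP[u1 u2] u3.
  apply: (He u) => //; first by rewrite gt_eqF.
  rewrite /= in_itv/= (ltW u3)/=; move: u2; rewrite ltr_norml => /andP[? ?]; lra.
have : diff_quotient g (-1) u * (u - -1) + g (-1) @[u --> (-1 : R)^'+] --> l * (-1 - -1) + g (-1).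
  apply: cvgD; last exact: cvg_cst.
  apply: cvgM => //; apply: cvg_at_right_filter; apply: cvgB; [exact: cvg_id|exact: cvg_cst].
rewrite subrr mulr0 add0r; apply: cvg_trans; apply: near_eq_cvg.
near=> u; rewrite /diff_quotient mulfVK ?subrK//.
rewrite subr_eq0 gt_eqF//; near: u; exact: nbhs_right_gt.
Unshelve. all: by end_near. Qed.

End DeriveWithin.

(** * Bernstein's theorem: absolutely monotone functions are sums of their Taylor series *)

Section LittleBernstein.
Context {R : realType}.
Implicit Types (f g : R -> R) (i M : nat).

Lemma nondecreasing_itv0 f f' (a : R) :
  (forall x : R, 0 < x < a -> is_derive x 1 f (f' x)) ->
  f x @[x --> 0^'+] --> f 0 ->
  (forall x : R, 0 < x < a -> 0 <= f' x) ->
  forall x y : R, 0 <= x -> x <= y -> y < a -> f x <= f y.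
Proof.
move=> df cf f'0 x y x0; rewrite le_eqVlt => /predU1P[<-//|xy] ya.
have cont z : 0 < z < a -> {for z, continuous f}.
  move=> /df dfz; apply: differentiable_continuous; apply/derivable1_diffP.
  exact: ex_derive.
have sub z : x < z < y -> 0 < z < a.
  by move=> /andP[xz zy]; rewrite (le_lt_trans x0 xz) (lt_trans zy ya).
have [||c] := @MVT R f f' x y xy.
- by move=> z; rewrite in_itv/= => /sub; exact: df.
- apply/(continuous_within_itvP _ xy); split=> //.
  + by move=> z; rewrite in_itv/= => /sub; exact: cont.
  + move: x0; rewrite le_eqVlt => /predU1P[<-//|x0].
    by apply: cvg_at_right_filter; apply: cont; rewrite x0 (lt_trans xy).
  + by apply: cvg_at_left_filter; apply: cont; rewrite (le_lt_trans x0 xy).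
rewrite in_itv/= => /sub hc e; rewrite -subr_ge0 e mulr_ge0 ?f'0//.
by rewrite subr_ge0 ltW.
Qed.

Variables (F : nat -> R -> R) (a : R).
Hypothesis dF : forall i (x : R), 0 < x < a -> is_derive x 1 (F i) (F i.+1 x).
Hypothesis cF : forall i, F i x @[x --> 0^'+] --> F i 0.
Hypothesis F_ge0 : forall i (x : R), 0 <= x < a -> 0 <= F i x.

Definition taylor i M : {poly R} := \poly_(j < M) (F (i + j) 0 / j`!%:R).

Let rem i M x := F i x - (taylor i M).[x].

Let taylor0 i : taylor i 0 = 0.
Proof. by apply/polyP => j; rewrite coef_poly coef0. Qed.

Let taylor_deriv i M : (taylor i M.+1)^`() = taylor i.+1 M.
Proof.
apply/polyP => j; rewrite coef_deriv !coef_poly ltnS; case: ifP => _; last by rewrite mul0rn.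
rewrite addnS addSn -[LHS]mulr_natr -mulrA; congr (_ * _).
have f0 : j`!%:R != 0 :> R by rewrite pnatr_eq0 -lt0n fact_gt0.
have j0 : j.+1%:R != 0 :> R by rewrite pnatr_eq0.
by rewrite factS natrM invfM mulrAC mulVf// mul1r.
Qed.

Let rem0 i M : rem i M.+1 0 = 0.
Proof.
by rewrite /rem horner_coef0 coef_poly /= addn0 fact0 divr1 subrr.
Qed.

Let d_rem i M x : 0 < x < a -> is_derive x 1 (rem i M.+1) (rem i.+1 M x).
Proof.
move=> hx; have dFx := dF i hx; have dp := is_derive_poly (taylor i M.+1) x.
have := is_deriveB dFx dp; rewrite taylor_deriv; exact.
Qed.

Let c_rem i M : rem i M x @[x --> 0^'+] --> rem i M 0.
Proof.
apply: cvgB; first exact: cF.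
by apply: cvg_at_right_filter; exact: continuous_horner.
Qed.

(** The remainder of order M + 1 of F_i vanishes at 0 and its derivative is the remainder of order M
    of F_(i+1). *)
Lemma taylor_le i M x : 0 <= x < a -> (taylor i M).[x] <= F i x.
Proof.
suff : 0 <= x < a -> 0 <= rem i M x by move=> h /h; rewrite subr_ge0.
elim: M i x => [|M IH] i x hx.
  by rewrite /rem taylor0 horner0 subr0 F_ge0.
rewrite -(rem0 i M); have /andP[x0 xa] := hx.
apply: (@nondecreasing_itv0 _ (rem i.+1 M) a) => //.
- by move=> y; exact: d_rem.
- by move=> y /andP[y0 ya]; apply: IH; rewrite ltW.
Qed.

(** In other words, the remainder divided by x^M is nondecreasing. The difference of the two sides
    is differentiated, which lowers M. *)
Let rem_scale i M (c x : R) : 0 < c <= 1 -> 0 <= x < a ->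
  rem i M (c * x) <= c ^+ M * rem i M x.
Proof.
move=> /andP[c0 c1]; elim: M i x => [|M IH] i x hx.
  rewrite expr0 mul1r /rem taylor0 !horner0 !subr0.
  have /andP[x0 xa] := hx.
  apply: (@nondecreasing_itv0 _ (F i.+1) a) => //.
  - by move=> y /andP[y0 ya]; apply: F_ge0; rewrite ltW.
  - by rewrite mulr_ge0// ltW.
  - by rewrite ler_piMl.
pose f y := c ^+ M.+1 * rem i M.+1 y - rem i M.+1 (c * y).
suff : f 0 <= f x by rewrite /f mulr0 !rem0 mulr0 subrr subr_ge0.
have cy y : 0 < y < a -> 0 < c * y < a.
  by move=> /andP[y0 ya]; rewrite mulr_gt0//= (le_lt_trans _ ya)// ler_piMl// ltW.
have /andP[x0 xa] := hx.
apply: (@nondecreasing_itv0 _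
  (fun y => c ^+ M.+1 * rem i.+1 M y - rem i.+1 M (c * y) * c) a) => //.
- move=> y hy; have d1 := d_rem i M hy; have d2 := d_rem i M (cy y hy).
  have dc : is_derive y 1 (fun y : R => c * y) c.
    by apply: is_derive_eq; rewrite /GRing.scale/= mulr1 ?mulr0 ?addr0.
  have dcomp := @is_derive1_comp R (rem i M.+1) (fun y => c * y) y _ _ d2 dc.
  exact: (is_deriveB (is_deriveZ (c ^+ M.+1) d1) dcomp).
- apply: cvgB; first by apply: cvgM; [exact: cvg_cst|exact: c_rem].
  have h0 : rem i M.+1 y @[y --> 0^'+] --> rem i M.+1 (c * 0) by rewrite mulr0; exact: c_rem.
  apply: cvg_comp h0.
  apply: cvg_to_at_right.
    rewrite -[X in _ --> X](mulr0 c); apply: cvg_at_right_filter.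
    by apply: cvgM; [exact: cvg_cst|exact: cvg_id].
  by near=> y; rewrite mulr_gt0//; near: y; exact: nbhs_right_gt.
- move=> y /andP[y0 ya].
  have := IH i.+1 y; rewrite ltW//= => /(_ ya) h.
  rewrite exprS subr_ge0 mulrC -mulrA ler_pM2l//.
Unshelve. all: by end_near. Qed.

Lemma taylor_cvg i x : 0 <= x < a -> (taylor i M).[x] @[M --> \oo] --> F i x.
Proof.
move=> /andP[]; rewrite le_eqVlt => /predU1P[<- a0|x0 xa].
  have : (fun=> F i 0) n @[n --> \oo] --> F i 0 by exact: cvg_cst.
  apply: cvg_trans; apply: near_eq_cvg.
  exists 1%N => // -[|M] // _.
  by rewrite horner_coef0 coef_poly /= addn0 fact0 divr1.
(* Any b between x and a would do: the remainder at x = c b is at most c^M F_i(b), with c < 1. *)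
pose b := (x + a) / 2; pose c := x / b.
have xb : x < b by rewrite /b; lra.
have b0 : 0 < b by exact: lt_trans xb.
have ba : b < a by rewrite /b; lra.
have c0 : 0 < c by rewrite divr_gt0.
have c1 : c < 1 by rewrite ltr_pdivrMr// mul1r.
have cb : c * b = x by rewrite /c mulfVK// gt_eqF.
have up M : F i x - c ^+ M * F i b <= (taylor i M).[x].
  rewrite lerBlDr -lerBlDl -/(rem i M x) -cb.
  have hb : 0 <= b < a by rewrite ltW.
  apply: le_trans (rem_scale i M _ hb) _; first by rewrite c0 ltW.
  rewrite ler_pM2l ?exprn_gt0// /rem lerBlDr lerDl horner_coef.
  apply: sumr_ge0 => j _; rewrite mulr_ge0 ?exprn_ge0 ?(ltW b0)// coef_poly.
  by case: ifP => // _; rewrite divr_ge0// F_ge0// lexx (lt_trans b0).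
have cM : c ^+ M @[M --> \oo] --> (0 : R) by apply: cvg_expr; rewrite gtr0_norm.
have lo : F i x - c ^+ M * F i b @[M --> \oo] --> F i x - 0 * F i b.
  apply: cvgB; first exact: cvg_cst.
  by apply: cvgM => //; exact: cvg_cst.
rewrite mul0r subr0 in lo.
apply: (squeeze_cvgr _ lo (cvg_cst (F i x))).
by apply: nearW => M; rewrite up /= taylor_le// ltW.
Qed.

Lemma taylor_ge0 i M j : 0 < a -> 0 <= (taylor i M)`_j.
Proof.
move=> a0; rewrite coef_poly; case: ifP => // _.
by rewrite divr_ge0// F_ge0// lexx.
Qed.

End LittleBernstein.

(** * The linear programming bounds *)

Section GegenbauerExpansion.
Context {R : realType}.
Variable n : nat.
Hypothesis n2 : (2 <= n)%N.
Implicit Types (f p q : {poly R}).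

Notation d := (n - 2)%N.
Notation L := (@mu_int R n).
Notation P := (@gb R d).

Lemma gb_functional_mu_int : gb_functional d L.
Proof.
split.
- by move=> p q; exact: mu_intD.
- by move=> a p; exact: mu_intZ.
- exact: mu_int1.
- by move=> p; rewrite mu_int_pearson// -subSn.
- by move=> p; exact: mu_int_ge0.
Qed.

Let HL := gb_functional_mu_int.
Let LD := gbfD HL.
Let LZ := gbfZ HL.

Lemma gegenbauerE i : gegenbauer n i = P i.
Proof.
have Lint p q : \int[lebesgue_measure]_(t in `[-1, 1]) (p.[t] * q.[t] * mu_density n t) =
    L (p * q) by apply: eq_Rintegral => t _; rewrite hornerM.
have [sP lP] := size_gb R d i.
apply: xget_unique.
  split=> //; first exact: horner1_gb.
  by move=> q sq; rewrite Lint (gb_orth HL).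
move=> p [sp p1 op].
pose a := lead_coef p / lead_coef (P i).
pose E := p - a *: P i.
have sE : (size E <= i)%N.
  apply/leq_sizeP => j; rewrite leq_eqVlt => /predU1P[<-|ij].
    have e1 : p`_i = lead_coef p by rewrite lead_coefE sp.
    have e2 : (P i)`_i = lead_coef (P i) by rewrite lead_coefE sP.
    by rewrite coefB coefZ e1 e2 mulfVK ?subrr// gt_eqF.
  by rewrite coefB coefZ !nth_default ?mulr0 ?subrr ?sp ?sP.
have E0 : E = 0.
  apply/eqP; apply: contraT => E0; have := functional_sqr_gt0 HL E0.
  rewrite {1}/E mulrBl (functionalB LD LZ) -scalerAl LZ (gb_orth HL)// mulr0 subr0.
  by rewrite -Lint op// ltxx.
have pE : p = a *: P i by apply/eqP; rewrite -subr_eq0 -/E E0.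
have a1 : a = 1 by move: p1; rewrite pE hornerZ horner1_gb mulr1.
by rewrite pE a1 scale1r.
Qed.

Lemma gegenbauer_coefsE f j : (gegenbauer_coefs n f)`_j = (gb_dim d j)%:R * L (f * P j).
Proof.
suff : f = \sum_(i < size (gegenbauer_coefs n f)) (gegenbauer_coefs n f)`_i *: gegenbauer n i.
  move: (gegenbauer_coefs n f) => c ->.
  have E i : L ((c`_i *: gegenbauer n i) * P j) = c`_i * L (P i * P j).
    by rewrite gegenbauerE -scalerAl LZ.
  rewrite mulr_suml (functional_sum LD LZ) mulr_sumr.
  have [jc|cj] := ltnP j (size c).
    rewrite (bigD1 (Ordinal jc))//= big1 ?addr0; last first.
      move=> i ij; rewrite E (gb_orth_neq HL) ?mulr0//.
    by rewrite E mulrCA (gb_norm HL) mulr1.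
  rewrite nth_default// big1// => i _.
  by rewrite E (gb_orth_neq HL) ?mulr0// ltn_eqF// (leq_trans (ltn_ord i)).
apply: (@xgetPex _ 0
  [set c : {poly R} | f = \sum_(i < size c) c`_i *: gegenbauer n i]).
pose e i := (gb_dim d i)%:R * L (f * P i).
pose c := \poly_(i < size f) e i.
have sc : (size c <= size f)%N by exact: size_poly.
exists c => /=; rewrite [LHS](gb_expand HL (leqnn (size f))).
transitivity (\sum_(i < size f) c`_i *: P i).
  by apply: eq_bigr => i _; rewrite coef_poly ltn_ord.
transitivity (\sum_(i < size c) c`_i *: P i); last first.
  by apply: eq_bigr => i _; rewrite gegenbauerE.
rewrite (big_ord_widen _ (fun i => c`_i *: P i) sc) [RHS]big_mkcond.
apply: eq_bigr => i _; case: ifP => // /negbT; rewrite -leqNgt => h.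
by rewrite nth_default// scale0r.
Qed.

Lemma gegenbauer_coefs_sum f :
  f = \sum_(j < size f) (gegenbauer_coefs n f)`_j *: P j.
Proof.
rewrite [LHS](gb_expand HL (leqnn (size f))).
by apply: eq_bigr => j _; rewrite gegenbauer_coefsE.
Qed.

Lemma posdef_gegenbauer_coefs_ge0 f j : posdef d L f -> 0 <= (gegenbauer_coefs n f)`_j.
Proof. by move=> pf; rewrite gegenbauer_coefsE mulr_ge0. Qed.

Lemma gegenbauer_coefs0 f : (gegenbauer_coefs n f)`_0 = L f.
Proof. by rewrite gegenbauer_coefsE gb0 mulr1 /gb_dim /gb_bin /= add0n binn mul1r. Qed.

Lemma levenshtein_funE k eps s : levenshtein_fun n k.+1 eps s =
  (gb_total d false (k + eps))%:R - (gb_bin d (k + eps))%:R *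
  ((1 + s) ^+ eps * ((P (k + eps)).[s] - (P (k.+1 + eps)).[s]) /
   ((1 - s) * (eps%:R * (P k.+1).[s] + (P (k.+1 + eps)).[s]))) :> R.
Proof.
rewrite /levenshtein_fun !gegenbauerE.
have -> : (k.+1 - 1 + eps = k + eps)%N by lia.
have -> : (k.+1 + n + eps - 3 = k + eps + d)%N by lia.
have -> : (2 * k.+1 + n + 2 * eps - 3 = 2 * (k + eps) + d.+1)%N by lia.
have -> : (n - 1 = d.+1)%N by lia.
rewrite -/(gb_bin d _) mulrBr; congr (_ - _).
have d0 : d.+1%:R != 0 :> R by rewrite pnatr_eq0.
apply: (mulIf d0); rewrite mulrA mulfVK// -!natrM; congr _%:R.
rewrite gb_total0E /gb_bin; move: (k + eps)%N d {d0} => j e.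
have h1 : ('C(j + e.+1, e.+1) * e.+1 = (j + e.+1) * 'C(j + e, e))%N.
  by rewrite mulnC -mul_bin_diag addnS.
have h2 : ('C(j + e, e.+1) * e.+1 = j * 'C(j + e, e))%N.
  by rewrite mulnC mul_bin_left addnK.
by rewrite mulnDl h1 h2 -mulnDl mulnC; congr (_ * _)%N; lia.
Qed.

Lemma delsarte_boundE k (eps : bool) :
  delsarte_bound n (2 * k.+1 - 1 + eps) = gb_total d (~~ eps) (k + eps).
Proof.
rewrite /delsarte_bound.
have -> : (2 * k.+1 - 1 + eps).+1./2 = k.+1.
  by case: eps; rewrite ?addn1 ?addn0; lia.
have -> : ~~ odd (2 * k.+1 - 1 + eps) = eps by case: eps; lia.
have -> : (n - 1 = d.+1)%N by lia.
case: eps; rewrite /negb ?gb_total0E ?gb_total1E.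
  by congr ('C(_, _) + 'C(_, _))%N; lia.
by rewrite mul2n -addnn; congr ('C(_, _) + 'C(_, _))%N; lia.
Qed.

Lemma delsarte_boundSE k (eps : bool) :
  delsarte_bound n (2 * k.+1 - 1 + eps).+1 = gb_total d eps k.+1.
Proof.
case: eps.
  have -> : (2 * k.+1 - 1 + true).+1 = (2 * k.+2 - 1 + false)%N by lia.
  by rewrite delsarte_boundE addn0.
have -> : (2 * k.+1 - 1 + false).+1 = (2 * k.+1 - 1 + true)%N by lia.
by rewrite delsarte_boundE addn1.
Qed.

End GegenbauerExpansion.

(** * From the Levenshtein polynomial to the nodes and weights *)

Section NodeExtraction.
Context {R : realType}.
Variable n : nat.
Hypothesis n2 : (2 <= n)%N.

Notation d := (n - 2)%N.
Notation L := (@mu_int R n).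

Let HL := @gb_functional_mu_int R n n2.
Let LZ := gbfZ HL.

Lemma sorted_codom_ord (r : nat) (alpha : 'I_r -> R) :
  (forall i j : 'I_r, (i < j)%N -> alpha i < alpha j) -> sorted <%R (codom alpha).
Proof.
move=> alt; rewrite /codom /image_mem sorted_map.
have : sorted ltn (map val (enum 'I_r)) by rewrite val_enum_ord iota_ltn_sorted.
by rewrite sorted_map; apply: sub_sorted => i j /= /alt.
Qed.

(** The zero polynomial would have a root beyond all |alpha_i|. For the Levenshtein polynomial this
    rules out the default value of the chosen kernel. *)
Lemma poly_roots_finite (p : {poly R}) (r : nat) (alpha : 'I_r -> R) :
  (forall t, root p t -> exists i, alpha i = t) -> p != 0.
Proof.
move=> h; apply/eqP => p0.
have /h [i ai] : root p (1 + \sum_i `|alpha i|) by rewrite p0 root0.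
suff : alpha i < 1 + \sum_i `|alpha i| by rewrite -ai ltxx.
rewrite (bigD1 i)//=; have := ler_norm (alpha i).
have : 0 <= \sum_(j | j != i) `|alpha j| by apply: sumr_ge0.
lra.
Qed.

(* The orthogonality of B is the reproducing property of K applied to the
   multiples of t - s. *)
Lemma levenshtein_nodes_seq (k : nat) (eps : bool) (s : R) (alpha : 'I_(k.+1 + eps) -> R) :
  levenshtein_nodes n s alpha ->
  exists bs, [/\ sorted <%R bs, size bs = k.+1, s \in bs, (eps -> -1 \notin bs) &
    perm_eq (codom alpha) (node_seq eps bs) /\
    forall u : {poly R}, (size u <= k)%N ->
      L ((1 + 'X) ^+ eps * ((1 - 'X) * root_prod bs * u)) = 0].
Proof.
move=> [alt ralpha].
set al := codom alpha.
have sal : sorted <%R al by exact: sorted_codom_ord.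
have ual : uniq al by exact: sorted_uniq lt_trans (@ltxx _ _) _ sal.
have szal : size al = (k.+1 + eps)%N by rewrite size_codom card_ord.
have memal t : root (levenshtein_poly n k.+1 eps s) t = (t \in al).
  by apply/idP/codomP => [/ralpha[i <-]|[i ->]]; [exists i|apply/ralpha; exists i].
have lp0 : levenshtein_poly n k.+1 eps s != 0.
  by apply: (poly_roots_finite (alpha := alpha)) => t /ralpha.
move: memal lp0; rewrite /levenshtein_poly /reproducing_kernel.
case: xgetP => [K KE [sK KP] | _]; last first.
  by rewrite expr0n /= mulr0 scaler0 eqxx.
set g := (1 + 'X) ^+ eps * ('X - s%:P) * K ^+ 2.
rewrite scaler_eq0 negb_or invr_eq0 lead_coef_eq0 => memal /andP[g0 _].
(* With K to the first power, h has the same roots as g but degree at most k + 1 + eps, the number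
   of nodes. Hence its roots are simple and it is a multiple of the node polynomial. *)
pose h := (1 + 'X) ^+ eps * (('X - s%:P) * K).
have K0 : K != 0.
  by apply: contraNneq g0 => K0; rewrite /g K0 expr0n /= mulr0.
have w0 : (1 + 'X) ^+ eps != 0 :> {poly R}.
  by rewrite expf_neq0// addrC -size_poly_eq0 size_XaddC.
have h0 : h != 0 by rewrite !mulf_neq0// -size_poly_eq0 size_XsubC.
have rooth t : root h t = (t \in al).
  rewrite -memal rootZ ?invr_eq0 ?lead_coef_eq0//.
  by rewrite /g /h expr2 !rootM orbb orbA.
have sh : (size h <= (size al).+1)%N.
  rewrite szal /h addnC; apply: (@size_polyM_deg _ _ _ eps (1 + k)).
    case: (eps); last by rewrite expr0 size_poly1.
    by rewrite expr1 addrC size_XaddC.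
  by apply: (@size_polyM_deg _ _ _ 1 k) => //; rewrite size_XsubC.
have arh : all (root h) al by apply/allP => t; rewrite rooth.
have szh : size h = (size al).+1.
  by apply/eqP; rewrite eqn_leq sh max_poly_roots.
have hE := all_roots_prod_XsubC szh arh; rewrite uniq_rootsE in hE.
have {}hE := hE ual; rewrite -/(root_prod al) in hE.
pose bs := if eps then rem (-1) al else al.
have N1 : eps -> -1 \in al.
  by move=> e; rewrite -rooth /h e expr1 rootM /root hornerD hornerC hornerX subrr eqxx.
have pbs : perm_eq al (node_seq eps bs).
  rewrite /node_seq /bs; case: (eps) N1 => /= [/(_ isT)|_]; last exact: perm_refl.
  exact: perm_to_rem.
have sbs : size bs = k.+1.
  by have /perm_size := pbs; rewrite szal size_cat size_nseq addnC => /addnI/esym.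
have rpal : root_prod al = (1 + 'X) ^+ eps * root_prod bs.
  rewrite /root_prod (perm_big _ pbs) /node_seq big_cat /=; congr (_ * _).
  case: (eps) => /=; last by rewrite big_nil expr0.
  by rewrite big_seq1 polyCN opprK addrC expr1 polyC1.
have BE : ('X - s%:P) * K = lead_coef h *: root_prod bs.
  by apply: (mulfI w0); rewrite -/h [LHS]hE rpal scalerAr.
have lh : lead_coef h != 0 by rewrite lead_coef_eq0.
have sb : s \in bs.
  have : root (lead_coef h *: root_prod bs) s.
    by rewrite -BE rootM /root hornerXsubC subrr eqxx.
  by rewrite rootZ// root_prod_XsubC.
exists bs; split=> //.
- rewrite /bs; case: (eps) => //.
  by have := subseq_sorted lt_trans (rem_subseq (-1) al) sal.
- by rewrite /bs => e; rewrite e mem_rem_uniqF.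
split=> // u su.
apply: (mulfI lh); rewrite mulr0 -LZ.
have -> : lead_coef h *: ((1 + 'X) ^+ eps * ((1 - 'X) * root_prod bs * u)) =
   K * (('X - s%:P) * u) * ((1 - 'X) * (1 + 'X) ^+ eps).
  have -> : root_prod bs = (lead_coef h)^-1 *: (('X - s%:P) * K).
    by rewrite BE scalerA mulVf// scale1r.
  rewrite -!mul_polyC; set c := lead_coef h.
  have cc : c%:P * (c^-1)%:P = 1 :> {poly R} by rewrite -polyCM divff.
  transitivity ((c%:P * (c^-1)%:P) * (K * (('X - s%:P) * u) * ((1 - 'X) * (1 + 'X) ^+ eps))).
    move: (c%:P) (c^-1%:P) (_ ^+ eps) ('X - _) => x y z t; ring.
  by rewrite cc mul1r.
rewrite KP; first by rewrite hornerM hornerXsubC subrr mul0r.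
by apply: leq_trans (size_polyMleq _ _) _; rewrite size_XsubC.
Qed.

Variables (k : nat) (eps : bool) (N : R) (bs : seq R) (alpha : 'I_(k.+1 + eps) -> R).
Hypothesis perm_bs : perm_eq (codom alpha) (node_seq eps bs).

Lemma levenshtein_weightE i :
  levenshtein_weight n N alpha i = node_weight L N eps bs (alpha i).
Proof.
rewrite /levenshtein_weight /node_weight.
suff -> : node_poly alpha i = root_prod (rem (alpha i) (node_seq eps bs)) by [].
have X0 : 'X - (alpha i)%:P != 0 by rewrite -size_poly_eq0 size_XsubC.
apply: (mulfI X0); rewrite -root_prod_cons /root_prod.
have ai : alpha i \in node_seq eps bs by rewrite -(perm_mem perm_bs) codom_f.
rewrite -(perm_big _ (perm_to_rem ai)) -(perm_big _ perm_bs) /=.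
by rewrite /codom big_image /= [RHS](bigD1 i).
Qed.

Lemma sum_levenshtein_weight (F : R -> R) :
  \sum_i levenshtein_weight n N alpha i * F (alpha i) =
  \sum_(a <- node_seq eps bs) node_weight L N eps bs a * F a.
Proof.
rewrite -(perm_big _ perm_bs) /= big_image /=; apply: eq_bigr => i _.
by rewrite levenshtein_weightE.
Qed.

End NodeExtraction.

(** * Taylor polynomials of a potential at -1 *)

Section PotentialTaylor.
Context {R : realType}.
Variable h : R -> \bar R.
Hypothesis hpot : potential h.
Hypothesis ham : absolutely_monotone h.

Let F i (x : R) := potential_derive h i (x - 1).

Let cvg_derive i (t : R) : -1 <= t < 1 ->
  diff_quotient (potential_derive h i) t u @[u --> within `[-1, 1[ t^'] -->
  potential_derive h i.+1 t.
Proof. by move=> ht; have := ham.1 i t ht. Qed.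

Let dF i (x : R) : 0 < x < 2 -> is_derive x 1 (F i) (F i.+1 x).
Proof.
move=> hx; have ht : -1 < x - 1 < 1 by apply/andP; split; lra.
have ht' : -1 <= x - 1 < 1 by have /andP[h1 ->] := ht; rewrite ltW.
have d1 := is_derive_within ht (@cvg_derive i _ ht').
have d2 : is_derive x 1 (fun x : R => x - 1) 1.
  by apply: is_derive_eq; rewrite subr0.
have := @is_derive1_comp R (potential_derive h i) (fun x => x - 1) x _ _ d1 d2.
by rewrite mulr1.
Qed.

Let cF i : F i x @[x --> 0^'+] --> F i 0.
Proof.
have N1 : -1 <= (-1 : R) < 1 by rewrite lexx; lra.
have c1 := derivable_within_cvg_right (@cvg_derive i _ N1).
rewrite /F sub0r; apply: cvg_comp c1.
apply: cvg_to_at_right.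
  rewrite -[X in _ --> X](sub0r 1); apply: cvg_at_right_filter.
  by apply: cvgB; [exact: cvg_id|exact: cvg_cst].
near=> x; have : 0 < x by near: x; exact: nbhs_right_gt.
lra.
Unshelve. all: by end_near. Qed.

Let F_ge0 i (x : R) : 0 <= x < 2 -> 0 <= F i x.
Proof. by move=> hx; apply: ham.2; apply/andP; split; lra. Qed.

Let shift_range (t : R) : -1 <= t < 1 -> 0 <= t + 1 < 2.
Proof. by move=> ht; apply/andP; split; lra. Qed.

Definition potential_taylor M : {poly R} := taylor F 0 M.

Lemma coef_potential_taylor M i : (i < M)%N ->
  (potential_taylor M)`_i = potential_derive h i (-1) / i`!%:R.
Proof. by move=> iM; rewrite coef_poly iM /F add0n sub0r. Qed.

Lemma potential_taylor_ge0 M i : 0 <= (potential_taylor M)`_i.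
Proof. by apply: (taylor_ge0 F_ge0). Qed.

Lemma potential_taylor_le M (t : R) : -1 <= t < 1 ->
  (((potential_taylor M) \Po ('X + 1)).[t]%:E <= h t)%E.
Proof.
move=> ht; have [_ _ hfin] := hpot.
rewrite -(fineK (hfin t ht)) lee_fin horner_comp hornerD hornerX hornerC.
have := taylor_le dF cF F_ge0 0 M (shift_range ht).
by rewrite /F addrK.
Qed.

Lemma potential_taylor_cvg (t : R) : -1 <= t < 1 ->
  ((potential_taylor M) \Po ('X + 1)).[t] @[M --> \oo] --> fine (h t).
Proof.
move=> ht; have := @taylor_cvg _ _ _ dF cF F_ge0 0%N _ (shift_range ht).
rewrite {2}/F addrK; apply: cvg_trans; apply: near_eq_cvg; apply: nearW => M.
by rewrite horner_comp hornerD hornerX hornerC.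
Qed.

End PotentialTaylor.

Lemma scaled_coef_le {R : realType} (c e : nat -> R) (m : nat) :
  (forall i, 0 < c i) -> exists2 eta, 0 < eta & forall i, (i < m)%N -> eta * e i <= c i.
Proof.
move=> c0; elim: m => [|m [eta eta0 IH]]; first by exists 1.
pose eta' := c m / (1 + `|e m|).
have d0 : 0 < 1 + `|e m| by rewrite ltr_pwDl.
have eta'0 : 0 < eta' by rewrite divr_gt0.
exists (Num.min eta eta'); first by rewrite lt_min eta0.
move=> i; rewrite ltnS leq_eqVlt => /predU1P[->|im].
  have h1 : Num.min eta eta' * e m <= Num.min eta eta' * (1 + `|e m|).
    apply: ler_wpM2l; first by rewrite le_min !ltW.
    by apply: le_trans (ler_norm _) _; rewrite lerDr.
  apply: le_trans h1 _; rewrite -ler_pdivlMr//.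
  by rewrite ge_min lexx orbT.
have [ei|ei] := leP 0 (e i).
  apply: le_trans (IH i im); apply: ler_wpM2r => //.
  by rewrite ge_min lexx.
by apply: le_trans (ltW (c0 i)); rewrite mulr_ge0_le0 ?le_min ?ltW.
Qed.

Theorem theorem3p1 (R : realType) (n N : nat) (w : 'I_N -> R)
    (k m : nat) (eps : bool) (s : R) (alpha : 'I_(k + eps) -> R)
    (h : R -> \bar R)
    (hn : (2 <= n)%N)
    (hw : weight_vector w)
    (hN : 2 < eff_card w)
    (hk : (1 <= k)%N)
    (hm : m = (2 * k - 1 + eps)%N)
    (hD : (delsarte_bound n m)%:R < eff_card w <= (delsarte_bound n m.+1)%:R)
    (hs : levenshtein_interval n k eps s)
    (hL : levenshtein_fun n k eps s = eff_card w)
    (halpha : levenshtein_nodes n s alpha)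
    (hpot : potential h)
    (ham : absolutely_monotone h) :
  ((forall j : nat, (1 <= j)%N -> 0 <= test_function n (eff_card w) alpha j) ->
     ULB n w h = ULB_deg m n w h)
  /\
  (strictly_absolutely_monotone h ->
   (forall i : nat, 0 < potential_derive h i (-1)) ->
   forall j : nat, (m.+1 <= j)%N -> test_function n (eff_card w) alpha j < 0 ->
     (exists f : {poly R},
        [/\ lp_feasible n h f, size f = j.+1 &
            (ULB_deg m n w h < (lp_value n w f)%:E)%E])
     /\ (ULB_deg m n w h < ULB n w h)%E).
Proof.
case: k => // k in alpha hk hm hs hL halpha *; move=> {hs hk}.
have deg : (k.+1.*2 + eps)%N = m.+1 by rewrite hm; lia.
have [bs [sorted_bs size_bs s_bs bsN1 [perm_bs B_orth]]] := levenshtein_nodes_seq hn halpha.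
pose d := (n - 2)%N; pose L := @mu_int R n.
have HL : gb_functional d L by exact: gb_functional_mu_int.
have LD := gbfD HL; have LZ := gbfZ HL.
set M := eff_card w in hN hD hL *.
move: (hD); rewrite {1 2}hm delsarte_boundE// delsarte_boundSE// => /andP[M_gt M_le].
have M_eq := hL; rewrite levenshtein_funE// in M_eq; move/esym in M_eq.
have quad := levenshtein_quadrature HL size_bs sorted_bs M_gt M_le B_orth s_bs bsN1 M_eq.
have bounds := node_seq_bounds HL size_bs sorted_bs M_gt M_le B_orth s_bs bsN1 M_eq.
have rho_ge0 := node_weight_ge0 HL size_bs sorted_bs M_gt M_le B_orth s_bs bsN1 M_eq.
have interp := hermite_interpolant HL size_bs sorted_bs M_gt M_le B_orth s_bs bsN1 M_eq.
pose rho := node_weight L M eps bs.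
pose ns := node_seq eps bs.
pose A (F : R -> R) := \sum_(a <- ns) rho a * F a.
have lpE (f : {poly R}) : lp_value n w f = L f - f.[1] / M.
  by rewrite /lp_value gegenbauer_coefs0// /M /eff_card invrK.
have quadA (f : {poly R}) : (size f <= m.+1)%N -> lp_value n w f = A (horner f).
  by move=> sf; rewrite lpE quad ?deg// addrC addKr.
have testE j : test_function n M alpha j = M^-1 + A (horner (gb R d j)).
  rewrite /test_function; congr (_ + _).
  apply: etrans (sum_levenshtein_weight n M perm_bs (horner (gb R d j))).
  by apply: eq_bigr => i _; rewrite gegenbauerE.
have lpP j : (0 < j)%N -> lp_value n w (gb R d j) = A (horner (gb R d j)) - test_function n M alpha j.
  case: j => // j _; rewrite lpE testE (functional_gb HL) horner1_gb; ring.
have lpP0 : lp_value n w (gb R d 0) = A (horner (gb R d 0)).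
  by apply: quadA; rewrite gb0 size_poly1.
have lpD (f g : {poly R}) : lp_value n w (f + g) = lp_value n w f + lp_value n w g.
  by rewrite !lpE LD hornerD; ring.
have lpZ c (f : {poly R}) : lp_value n w (c *: f) = c * lp_value n w f.
  by rewrite !lpE LZ hornerZ; ring.
have AD (f g : {poly R}) : A (horner (f + g)) = A (horner f) + A (horner g).
  by rewrite -big_split; apply: eq_bigr => a _; rewrite hornerD mulrDr.
have AZ c (f : {poly R}) : A (horner (c *: f)) = c * A (horner f).
  by rewrite mulr_sumr; apply: eq_bigr => a _; rewrite hornerZ mulrCA.
pose V := A (fun t => fine (h t)).
have [_ _ hfin] := hpot.
have A_le (f : {poly R}) : lp_feasible n h f -> A (horner f) <= V.
  move=> [fh _]; rewrite /A /V [leLHS]big_seq [leRHS]big_seq; apply: ler_sum => a ans.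
  have ab := bounds a ans.
  apply: ler_wpM2l; first exact: rho_ge0.
  by rewrite -lee_fin fineK ?fh ?hfin.
pose T M := potential_taylor h M \Po ('X + 1).
have Tnn M' : shift_nneg (T M') by exists (potential_taylor h M') => // i; exact: potential_taylor_ge0.
have TV : A (horner (T M')) @[M' --> \oo] --> V.
  rewrite /A /V /A.
  have : {subset ns <= [pred a : R | -1 <= a < 1]} by move=> a /bounds.
  elim: (ns) => [|a l IH] sub.
    under eq_fun do rewrite big_nil.
    by rewrite big_nil; exact: cvg_cst.
  under eq_fun do rewrite big_cons.
  rewrite big_cons; apply: cvgD; last first.
    by apply: IH => b bl; apply: sub; rewrite inE bl orbT.
  apply: cvgMr; apply: potential_taylor_cvg => //.
  by apply: sub; rewrite mem_head.
have wtB_ge0 (t : R) : -1 <= t < 1 -> 0 <= ((1 + 'X) ^+ eps * (root_prod bs * root_prod bs)).[t].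
  move=> /andP[t1 _]; rewrite !hornerM horner_exp hornerD hornerC hornerX.
  by rewrite mulr_ge0 ?exprn_ge0 -?expr2 ?sqr_ge0// -lerBlDl sub0r.
have wtB0 a : a \in ns -> ((1 + 'X) ^+ eps * (root_prod bs * root_prod bs)).[a] = 0.
  rewrite mem_cat => /orP[|/horner_root_prod0 e]; last by rewrite !hornerM e !mulr0.
  case: (eps) => //=; rewrite inE => /eqP ->.
  by rewrite expr1 hornerM hornerD hornerC hornerX subrr mul0r.
have feasible (f : {poly R}) : posdef d L f -> (forall t, -1 <= t < 1 -> (f.[t]%:E <= h t)%E) ->
    lp_feasible n h f.
  by move=> pf fh; split=> // i _; exact: posdef_gegenbauer_coefs_ge0.
have ULB_degE : ULB_deg m n w h = V%:E.
  apply/eqP; rewrite eq_le; apply/andP; split.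
    apply: ge_ereal_sup => _ [f [ff sf] <-]; rewrite lee_fin quadA//.
    exact: A_le.
  (* No maximizer is exhibited: each value A(T_M') is attained by an interpolant of degree at most
     m, and these values would eventually exceed a supremum below V. *)
  rewrite leNgt; apply/negP => lt.
  have T_le M' : ((A (horner (T M')))%:E <= ULB_deg m n w h)%E.
    have [H [Q [TE nQ pdH sH]]] := interp (T M') (Tnn M').
    rewrite deg in sH.
    have -> : A (horner (T M')) = lp_value n w H.
      rewrite quadA// TE; apply: eq_big_seq => a ans.
      by rewrite hornerD hornerM wtB0// mul0r addr0.
    apply: ereal_sup_ubound; exists H => //; split=> //; apply: feasible => // t ht.
    apply: le_trans (potential_taylor_le hpot ham M' ht).
    rewrite lee_fin -/(T M') TE hornerD lerDl hornerM mulr_ge0 ?wtB_ge0//.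
    by apply: shift_nneg_horner => //; case/andP: ht.
  move: lt T_le; case: (ULB_deg _ _ _ _) => [u| |] //; last by move=> _ /(_ 0%N).
  rewrite lte_fin => uV T_le.
  have [M0 _ /(_ M0 (leqnn M0))] := cvgr_gt _ TV _ uV.
  by rewrite /= ltNge -lee_fin T_le.
have ULB_ge : (ULB_deg m n w h <= ULB n w h)%E.
  by apply: ereal_sup_le => _ [f [ff _] <-]; exists f.
split.
  move=> Q_ge0; apply/eqP; rewrite eq_le; apply/andP; split; last exact: ULB_ge.
  rewrite ULB_degE.
  apply: ge_ereal_sup => _ [f ff <-]; rewrite lee_fin.
  apply: le_trans (A_le f ff).
  have lp_sum (I : Type) (r : seq I) (P : pred I) (G : I -> {poly R}) :
      lp_value n w (\sum_(i <- r | P i) G i) = \sum_(i <- r | P i) lp_value n w (G i).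
    exact: (functional_sum (L := lp_value n w)).
  have A_sum (I : Type) (r : seq I) (P : pred I) (G : I -> {poly R}) :
      A (horner (\sum_(i <- r | P i) G i)) = \sum_(i <- r | P i) A (horner (G i)).
    exact: (functional_sum (L := fun f => A (horner f))).
  (* The comparison is made coefficient by coefficient: f_0 has no sign, but P_0 gives equality; for
     j >= 1 both f_j and Q_j are nonnegative. *)
  rewrite (gegenbauer_coefs_sum hn f) lp_sum A_sum; apply: ler_sum => -[[|j] jf] _ /=.
    by rewrite lpZ AZ lpP0.
  rewrite lpZ AZ; apply: ler_wpM2l; first by apply: ff.2.
  by rewrite lpP// lerBlDr lerDl Q_ge0.
move=> _ h0 j mj Qj.
suff [f [ff sf fV]] : exists f : {poly R}, [/\ lp_feasible n h f, size f = j.+1 &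
            (ULB_deg m n w h < (lp_value n w f)%:E)%E].
  split; first by exists f.
  by apply: (lt_le_trans fV); apply: ereal_sup_ubound; exists f.
pose c i : R := potential_derive h i (-1) / i`!%:R.
have c0 i : 0 < c i by rewrite divr_gt0// ltr0n fact_gt0.
(* The coefficients of P_j in powers of t + 1. The choice of eta keeps those of T_M' - eta P_j
   nonnegative. *)
pose e := gb R d j \Po ('X - 1).
have [eta eta0 etaP] := scaled_coef_le (fun i => e`_i) j.+1 c0.
(* M' > j ensures that the Taylor polynomial has its coefficients up to degree j, from which those
   of eta P_j are subtracted. *)
have [M' jM VM] : exists2 M', (j.+1 <= M')%N & V + eta * test_function n M alpha j < A (horner (T M')).
  have VQ : V + eta * test_function n M alpha j < V by rewrite gtrDl pmulr_rlt0.
  have [M0 _ HM] := cvgr_gt _ TV _ VQ.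
  exists (maxn M0 j.+1); first exact: leq_maxr.
  by apply: HM => /=; exact: leq_maxl.
have [sgb _] := size_gb R d j.
have se : (size e <= j.+1)%N by rewrite size_comp_poly2 ?sgb// size_XsubC.
pose T' := T M' - eta *: gb R d j.
have nT' : shift_nneg T'.
  exists (potential_taylor h M' - eta *: e) => [i|].
    rewrite coefB coefZ; have [ij|ji] := ltnP i j.+1.
      rewrite coef_potential_taylor; last exact: leq_trans ij jM.
      by rewrite subr_ge0 etaP.
    by rewrite [e`_i]nth_default ?mulr0 ?subr0 ?potential_taylor_ge0//; apply: leq_trans se _.
  rewrite comp_polyB comp_polyZ /e -comp_polyA comp_polyB comp_polyX comp_polyC.
  by rewrite polyC1 addrK comp_polyXr.
have [H [Q [T'E nQ pdH sH]]] := interp T' nT'.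
rewrite deg in sH.
exists (H + eta *: gb R d j); split.
- apply: feasible.
    apply: (posdefD HL) => //; apply: (posdefZ HL); [exact: ltW|exact: posdef_gb].
  move=> t ht; apply: le_trans (potential_taylor_le hpot ham M' ht).
  rewrite lee_fin -/(T M').
  have -> : T M' = H + eta *: gb R d j + (1 + 'X) ^+ eps * (root_prod bs * root_prod bs) * Q.
    by rewrite addrAC -T'E /T' subrK.
  rewrite [leRHS]hornerD lerDl hornerM mulr_ge0 ?wtB_ge0//.
  by apply: shift_nneg_horner => //; case/andP: ht.
(* The degree is exactly j because H has degree at most m < j and eta is nonzero. *)
- by rewrite addrC size_polyDl size_scale ?gt_eqF// sgb// ltnS (leq_trans sH mj).
- rewrite ULB_degE lte_fin lpD lpZ lpP; last by apply: leq_trans mj.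
  rewrite quadA//.
  have -> : A (horner H) = A (horner T').
    rewrite T'E; apply: eq_big_seq => a ans.
    by rewrite hornerD hornerM wtB0// mul0r addr0.
  have -> : A (horner T') = A (horner (T M')) - eta * A (horner (gb R d j)).
    by rewrite /T' -scaleNr AD AZ mulNr.
  lra.
Qed.
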